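(* Every planar graph $G$ of girth at least $9$ (respectively at least $8$, at least $7$) has a partition of $V(G)$ into an independent set $I$ and a set $F$ such that $G[F]$ is a forest with each component of order at most $3$ (respectively at most $4$, at most $6$).
   Context: All graphs are finite and simple. The girth of a graph is the length of a shortest cycle (infinite if the graph is acyclic). The order of a component is its number of vertices. The sets $I$ and $F$ may be empty. *)

(* Defs.v *)
From mathcomp Require Import all_boot all_order all_algebra.
From mathcomp Require Import all_classical all_reals all_analysis.
Set Implicit Arguments.
Unset Strict Implicit.
Unset Printing Implicit Defensive.
Import Order.TTheory GRing.Theory Num.Theory.
Import numFieldNormedType.Exports.

(* A finite simple graph is a symmetric irreflexive relation on a finType.    *)
Section Graphs.
Variables (T : finType) (e : rel T).

(* The bound on the size excludes [::] and [:: x; y] (an edge traversed back  *)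
(* and forth), which [ucycleb] accepts.                                       *)
Definition graph_cycle (c : seq T) : bool := (2 < size c) && ucycleb e c.

(* Acyclic graphs have infinite girth, hence girth at least g for every g.    *)
Definition girth_geq (g : nat) : Prop :=
  forall c : seq T, graph_cycle c -> g <= size c.

Definition forest : Prop := forall c : seq T, ~~ graph_cycle c.

Definition component (x : T) : {set T} := [set y | connect e x y]%SET.

Definition independent (I : {set T}) : Prop :=
  {in I &, forall x y, ~~ e x y}.

Definition induced (F : {set T}) : rel {x : T | x \in F} :=
  fun x y => e (val x) (val y).

End Graphs.

Definition IF_partition (T : finType) (e : rel T) (k : nat)
    (I F : {set T}) : Prop :=
  [/\ I :|: F = [set: T]%SET,
      [disjoint I & F],
      independent e I,
      forest (@induced T e F)
    & forall x : {x : T | x \in F}, #|component (@induced T e F) x| <= k].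

Section Planarity.
Variable R : realType.
Local Open Scope classical_set_scope.
Local Open Scope ring_scope.

Definition arc_between (A : set (R * R)) (p q : R * R) : Prop :=
  exists gamma : R -> R * R,
    [/\ {within `[0, 1], continuous gamma},
        set_inj `[0, 1] gamma,
        gamma 0 = p, gamma 1 = q
      & A = gamma @` `[0, 1]].

(* [pos] places the vertices in the plane and [edge] maps the edge xy,        *)
(* represented by the unordered pair {x, y}, to an arc from x to y. An arc    *)
(* meets the vertices only at its own ends, and two distinct arcs meet only   *)
(* at vertices, so their interiors are disjoint.                              *)
Definition plane_drawing (T : finType) (e : rel T)
    (pos : T -> R * R) (edge : {set T} -> set (R * R)) : Prop :=
  [/\ injective pos,
      forall x y, e x y -> arc_between (edge [set x; y]%SET) (pos x) (pos y),
      forall x y z, e x y -> edge [set x; y]%SET (pos z) ->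
        z = x \/ z = y
    & forall x y u v, e x y -> e u v -> [set x; y]%SET <> [set u; v]%SET ->
        edge [set x; y]%SET `&` edge [set u; v]%SET `<=` range pos].

Definition planar (T : finType) (e : rel T) : Prop :=
  exists pos edge, @plane_drawing T e pos edge.

End Planarity.

(* Main.v *)
(* Give each vertex [v] a weight [w v] (the number of vertices for which it counts
   in its component of [F]) and a flag [m v] (a neighbour outside the graph has
   been put in [I], so that [v] must be in [F]). Let [v] contribute [u (w v)], less
   [E - I] if it is flagged, and let the potential of [R] be the sum of the
   contributions minus [E] times the number of edges in [R]. In a smallest uncolourable graph
   all of whose subgraphs have potential at least [theta], a colouring of a proper
   subset [R] turns the rest into a smaller weighted graph, so [R] has potential
   well above [theta] (the gap lemmas); this slack pays for raising a few weights,
   which makes the vertices of small degree reducible, and discharging shows that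
   what is left has potential below [theta].

   Planarity is used only through Euler's bound [g * e(W) <= 2 * e(W) + g * |W|].
   A fine enough square grid covers the middle of each arc of the drawing, and a
   neighbourhood of each vertex, by connected sets of cells that meet only where
   they should; so the graph is a minor of a grid. Each cycle of a grid bounds,
   modulo 2, a set of unit squares; hence the faces, the classes of squares not
   separated by the minor, span its cycle space, and each edge is on at most two
   of them.

   Since the girth exceeds [k], a component of order at most [k] is a tree. *)

Require Import Defs.
From mathcomp Require Import all_boot all_order all_algebra.
From mathcomp Require Import boolp.
From mathcomp Require Import zify ring lra.
Set Implicit Arguments.
Unset Strict Implicit.
Unset Printing Implicit Defensive.
Import Order.TTheory GRing.Theory Num.Theory.

(** Euler's bound reads [(g - 2) * e(W) <= g * |W|], which dictates the ratio of [u 1] to [E]: 9 to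
    7, 12 to 9 and 7 to 5 for girth 9, 8 and 7. Unweighted sets then have nonnegative potential.
    When a coloured set [R] is cut off, an edge to an independent vertex returns [E] and costs a
    flag, [E - I]; an edge to a vertex of [F] returns [E] and costs at most [u 1 - I]. So each
    outside vertex touching [R] gains at least [E + I - u 1], and this gives the first gap. The
    first gap pays for one extra unit of weight at a single vertex of [R]; colouring [R] with that
    unit keeps room in a class for one more vertex, and this gives the second gap. For order 3,
    [E + I - u 1 = 0] only allows a first gap of 1, while raising a weight from 1 to 2 costs 3;
    hence [theta = -2] there. Moreover, a vertex of weight 1 and degree 2 whose neighbours both have
    weight 1 escapes reduction. Such vertices give their surplus to their neighbours, and
    discharging does not yield a contradiction at once: it bounds by 4 the number of other vertices,
    and the remaining graphs are coloured explicitly. *)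

Lemma sum_disjU (V : nmodType) (T : finType) (A B : {set T}) (F : T -> V) :
    [disjoint A & B] ->
  (\sum_(x in A :|: B) F x = \sum_(x in A) F x + \sum_(x in B) F x)%R.
Proof. by move=> dAB; rewrite -bigU //; apply: eq_bigl => x; rewrite !inE. Qed.

Lemma sumn_disjU (T : finType) (A B : {set T}) (F : T -> nat) :
    [disjoint A & B] ->
  \sum_(x in A :|: B) F x = \sum_(x in A) F x + \sum_(x in B) F x.
Proof. exact: sum_disjU. Qed.

Ltac biglia :=
  intros;
  repeat match goal with
  | H : context [\big[_/_]_(_ <- _ | _) _] |- _ => move: H
  end;
  repeat match goal with
  | |- context [@bigop.body ?R ?J ?z ?r ?b] => move: (@bigop.body R J z r b) => ?
  end; lia.

Lemma sumz_disjU (T : finType) (A B : {set T}) (F : T -> int) :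
    [disjoint A & B] ->
  (\sum_(x in A :|: B) F x = \sum_(x in A) F x + \sum_(x in B) F x)%R.
Proof. exact: sum_disjU. Qed.

Lemma sumzB (T : finType) (A : {set T}) (F G : T -> int) :
  (\sum_(x in A) (F x - G x) = \sum_(x in A) F x - \sum_(x in A) G x)%R.
Proof. exact: sumrB. Qed.

(** * Degrees and colourings *)

Section Degrees.
Variables (T : finType) (e : rel T).
Hypotheses (e_sym : symmetric e) (e_irr : irreflexive e).
Implicit Types (A B R S : {set T}) (x y v : T).

Definition nbrs A x : {set T} := [set y in A | e x y]%SET.
Definition deg A x : nat := #|nbrs A x|.
Definition crossing A B : nat := \sum_(x in A) deg B x.
(** [crossing A A] counts each edge inside [A] once from each end; [crossing_even] makes the halving
    exact. *)
Definition nedges A : nat := (crossing A A)./2.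

Lemma in_nbrs A x y : (y \in nbrs A x) = (y \in A) && e x y.
Proof. by rewrite inE. Qed.

Lemma degE A x : deg A x = \sum_(y in A) e x y.
Proof.
rewrite /deg /nbrs -sum1_card (eq_bigl (fun y => (y \in A) && e x y)); last first.
  by move=> y; rewrite inE.
by rewrite big_mkcondr; apply: eq_bigr => y _; case: (e x y).
Qed.

Lemma crossingC A B : crossing A B = crossing B A.
Proof.
rewrite /crossing; under eq_bigr do rewrite degE.
rewrite exchange_big; apply: eq_bigr => y _; rewrite degE.
by apply: eq_bigr => x _; rewrite e_sym.
Qed.

Lemma crossingUl A B R : [disjoint A & B] ->
  crossing (A :|: B)%SET R = crossing A R + crossing B R.
Proof. by move=> dAB; exact: sumn_disjU. Qed.

Lemma crossingUr A B R : [disjoint A & B] ->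
  crossing R (A :|: B)%SET = crossing R A + crossing R B.
Proof. by move=> dAB; rewrite !(crossingC R) crossingUl. Qed.

Lemma crossing1l x A : crossing [set x]%SET A = deg A x.
Proof. by rewrite /crossing big_set1. Qed.

Lemma crossing_even A : ~~ odd (crossing A A).
Proof.
have [n] := ubnP #|A|; elim: n A => // n IHn A leAn.
have [->|[x xA]] := set_0Vmem A; first by rewrite /crossing big_set0.
have dx : [disjoint [set x]%SET & (A :\ x)%SET].
  by rewrite disjoints1 !inE eqxx.
rewrite -(setD1K xA) crossingUl // !crossingUr // !crossing1l.
have -> : deg [set x]%SET x = 0.
  by rewrite degE big_set1 e_irr.
rewrite (crossingC (A :\ x)%SET [set x]%SET) crossing1l add0n addnA addnn oddD.
rewrite odd_double /= IHn //.
by move: leAn; rewrite (cardsD1 x) xA.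
Qed.

Lemma handshake A : (nedges A).*2 = crossing A A.
Proof. by rewrite even_halfK // crossing_even. Qed.

Lemma nedgesU A B : [disjoint A & B] ->
  nedges (A :|: B)%SET = nedges A + nedges B + crossing A B.
Proof.
move=> dAB; apply: double_inj; rewrite !doubleD !handshake.
rewrite crossingUl // !crossingUr // (crossingC B A); lia.
Qed.

Lemma nedges1 x : nedges [set x]%SET = 0.
Proof. by rewrite /nedges crossing1l degE big_set1 e_irr. Qed.

Lemma degU A B x : [disjoint A & B] ->
  deg (A :|: B)%SET x = deg A x + deg B x.
Proof. by move=> dAB; rewrite !degE; exact: sumn_disjU. Qed.

End Degrees.

Section Colorings.
Variables (T : finType) (e : rel T).
Hypotheses (e_sym : symmetric e) (e_irr : irreflexive e).
Implicit Types (A B R S : {set T}) (x y v : T) (c : T -> option nat).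

Definition compat (o o' : option nat) : bool :=
  match o, o' with
  | None, None => false
  | Some a, Some b => a == b
  | _, _ => true
  end.

Lemma compatC o o' : compat o o' = compat o' o.
Proof. by case: o o' => [a|] [b|] //=; rewrite eq_sym. Qed.

Definition class_weight S (w : T -> nat) c a := \sum_(x in S | c x == Some a) w x.

(* [c x = None] puts [x] in the independent part. The labels [Some a] need only
   be constant on components of the other part, so that a label class is a union
   of components and colourings of disjoint sets can be glued by relabelling. *)
Definition coloring k S (w : T -> nat) (m : pred T) c : Prop :=
  [/\ {in S &, forall x y, e x y -> compat (c x) (c y)},
      {in S, forall x, m x -> c x != None}
    & forall a, class_weight S w c a <= k].

Definition colorable k S w m := exists c, coloring k S w m c.

Lemma coloringW k S w w' m c : (forall x, x \in S -> w x <= w' x) ->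
  coloring k S w' m c -> coloring k S w m c.
Proof.
move=> lew [h1 h2 h3]; split=> // a; apply: leq_trans (h3 a).
by apply: leq_sum => x /andP[xS _]; apply: lew.
Qed.

Lemma colorable0 k w m : colorable k set0 w m.
Proof.
exists (fun => None); split=> [x y|x|a]; rewrite ?inE //.
by rewrite /class_weight big1 // => x; rewrite inE.
Qed.

Definition upd c v o := fun x => if x == v then o else c x.

Lemma class_weight_upd S w c v o a : v \notin S ->
  class_weight (v |: S)%SET w (upd c v o) a
    = (if o == Some a then w v else 0) + class_weight S w c a.
Proof.
move=> vS; rewrite /class_weight big_mkcondr /= (big_setU1 _ vS) /=.
rewrite {1}/upd eqxx; congr (_ + _); rewrite [RHS]big_mkcondr /=.
apply: eq_bigr => x xS; rewrite /upd.
by have [xv|//] := eqVneq x v; rewrite -xv xS in vS.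
Qed.

Lemma coloring_ext k S w w' m c v o : v \notin S ->
    coloring k S w' m c -> (forall x, x \in S -> w x <= w' x) ->
    (forall y, y \in S -> e v y -> compat o (c y)) -> (m v -> o != None) ->
    (forall a, o = Some a -> w v + class_weight S w c a <= k) ->
  coloring k (v |: S)%SET w m (upd c v o).
Proof.
move=> vS cc lew cmp mv wv; have [h1 h2 h3] := coloringW lew cc.
split=> [x y|x|a]; last 1 first.
- rewrite class_weight_upd //; case: eqP => [/wv //|_]; exact: h3.
- rewrite !inE /upd; have [->|xv] := eqVneq x v; have [->|yv] := eqVneq y v => //=.
  + by rewrite e_irr.
  + by move=> _ yS; apply: cmp.
  + by move=> xS _; rewrite e_sym compatC; apply: cmp.
  + exact: h1.
- by rewrite !inE /upd; have [->|xv] := eqVneq x v => //= xS; apply: h2.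
Qed.

Lemma fresh S c : exists n, forall x, x \in S -> c x != Some n.
Proof.
exists (\max_(x in S) odflt 0 (c x)).+1 => x xS; apply/eqP => cx.
have := @leq_bigmax_cond _ (mem S) (fun x => odflt 0 (c x)) x xS.
by rewrite cx /= ltnn.
Qed.

Lemma class_weight0 S w c a : (forall x, x \in S -> c x != Some a) ->
  class_weight S w c a = 0.
Proof.
by move=> h; rewrite /class_weight big1 // => x /andP[/h /negPf ->].
Qed.

Lemma coloring_extI k S w w' m c v : v \notin S ->
    coloring k S w' m c -> (forall x, x \in S -> w x <= w' x) ->
    (forall y, y \in S -> e v y -> c y != None) -> ~~ m v ->
  coloring k (v |: S)%SET w m (upd c v None).
Proof.
move=> vS cc lew cmp mv; apply: (coloring_ext vS cc) => //.
- by move=> y yS /(cmp _ yS); case: (c y).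
- by rewrite (negPf mv).
Qed.

Lemma coloring_extF k S w w' m c v : v \notin S ->
    coloring k S w' m c -> (forall x, x \in S -> w x <= w' x) ->
    (forall y, y \in S -> e v y -> c y = None) -> w v <= k ->
  exists a, coloring k (v |: S)%SET w m (upd c v (Some a)) /\
    forall x, x \in S -> c x != Some a.
Proof.
move=> vS cc lew cmp wv; have [a ha] := fresh S c.
exists a; split=> //; apply: (coloring_ext vS cc) => //.
- by move=> y yS /(cmp _ yS) ->.
- by move=> b [<-]; rewrite class_weight0 // addn0.
Qed.

(** The excess of [w'] over [w] at [x] is room reserved in the class of [x] while the smaller set
    was coloured; [v] now takes that room. *)
Lemma coloring_extJ k S w w' m c v x a : v \notin S ->
    coloring k S w' m c -> (forall x, x \in S -> w x <= w' x) ->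
    x \in S -> c x = Some a -> w x + w v <= w' x ->
    (forall y, y \in S -> e v y -> c y = None \/ c y = Some a) ->
  coloring k (v |: S)%SET w m (upd c v (Some a)).
Proof.
move=> vS cc lew xS cx wx cmp; apply: (coloring_ext vS cc) => //.
- by move=> y yS /(cmp _ yS) [] -> //=.
- move=> b [<-]; have [_ _ /(_ a)] := cc; apply: leq_trans.
  have xa : (x \in S) && (c x == Some a) by rewrite xS cx eqxx.
  rewrite /class_weight (bigD1 x xa) [leqRHS](bigD1 x xa) /=.
  rewrite addnA (addnC (w v)).
  by apply: leq_add => //; apply: leq_sum => y /andP[/andP[/lew]].
Qed.

(* Two colourings of disjoint sets glue as soon as every edge between the two
   sets has exactly one independent end, or joins class [l] to class [n]. *)
Lemma coloring_glue k R S w m c1 c2 l n : [disjoint R & S] ->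
    coloring k R w m c1 -> coloring k S w m c2 ->
    (forall x y, x \in R -> y \in S -> e x y ->
      (c1 x == None) != (c2 y == None) \/ (c1 x = Some l /\ c2 y = Some n)) ->
    class_weight R w c1 l + class_weight S w c2 n <= k ->
  colorable k (R :|: S)%SET w m.
Proof.
move=> dRS [h1 m1 w1] [h2 m2 w2] cr wln.
(* Labels of [R] become even and labels of [S] odd, which keeps the classes apart, except that class
   [n] of [S] is sent onto class [l] of [R]. *)
pose f b := if b == n then l.*2 else b.*2.+1.
pose c x := if x \in R then omap double (c1 x) else omap f (c2 x).
have f_inj : injective f.
  rewrite /f => a b; case: eqP => [->|_]; case: eqP => [->|_] //; lia.
have SR x : x \in S -> (x \in R) = false.
  by move=> xS; apply: contraTF xS => xR; rewrite (disjointFr dRS).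
have crc x y : x \in R -> y \in S -> e x y -> compat (c x) (c y).
  move=> xR yS exy; rewrite /c xR SR //.
  case: (cr x y xR yS exy) => [|[-> ->]] /=; last by rewrite /f eqxx.
  by case: (c1 x) => [a|]; case: (c2 y).
exists c; split.
- move=> x y; rewrite !inE => /orP[xR|xS] /orP[yR|yS] exy.
  + rewrite /c xR yR; have := h1 x y xR yR exy.
    by case: (c1 x) (c1 y) => [a|] [b|] //= /eqP ->.
  + exact: crc.
  + by rewrite compatC; apply: crc => //; rewrite e_sym.
  + rewrite /c !SR //; have := h2 x y xS yS exy.
    by case: (c2 x) (c2 y) => [a|] [b|] //= /eqP ->.
- move=> x; rewrite !inE => /orP[xR|xS] mx; rewrite /c ?xR ?SR //.
  + by have := m1 x xR mx; case: (c1 x).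
  + by have := m2 x xS mx; case: (c2 x).
- move=> a; rewrite /class_weight big_mkcondr sumn_disjU //=.
  rewrite -!big_mkcondr /=.
  rewrite (eq_bigl (fun x => (x \in R) && (omap double (c1 x) == Some a))); last first.
    by move=> x; rewrite /c; case: (x \in R).
  rewrite [X in _ + X](eq_bigl (fun x => (x \in S) && (omap f (c2 x) == Some a))); last first.
    by move=> x; rewrite /c; case xS: (x \in S); rewrite // SR.
  have E2 b : f b = a -> \sum_(x in S | omap f (c2 x) == Some a) w x = class_weight S w c2 b.
    move=> <-; apply: eq_bigl => x; congr andb; case: (c2 x) => [d|] //=.
    exact: (inj_eq f_inj).
  have E1 b : b.*2 = a -> \sum_(x in R | omap double (c1 x) == Some a) w x = class_weight R w c1 b.
    move=> <-; apply: eq_bigl => x; congr andb; case: (c1 x) => [d|] //=.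
    by apply/eqP/eqP => [[/double_inj ->]|[->]].
  have [al|al] := eqVneq a l.*2.
    by rewrite (E1 l) // (E2 n) // /f eqxx.
  have [ao|ae] := boolP (odd a).
    rewrite big1 ?add0n => [|x /andP[_]]; last first.
      by case: (c1 x) => [d|] //= /eqP [da]; rewrite -da odd_double in ao.
    have [an|an] := eqVneq a n.*2.+1; last first.
      by rewrite (E2 a./2) // /f; case: eqP => [?|_]; lia.
    rewrite big1 // => x /andP[_]; case: (c2 x) => [d|] //= /eqP /Some_inj.
    by rewrite /f; case: eqP => [_|dn] fda; lia.
  rewrite [X in _ + X]big1 ?addn0 => [|x /andP[_]]; last first.
    case: (c2 x) => [d|] //= /eqP /Some_inj.
    by rewrite /f; case: eqP => [_|dn] fda; lia.
  by rewrite (E1 a./2) // even_halfK.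
Qed.

End Colorings.

(** * Potentials and gap lemmas *)

Section Potential.
Variables (T : finType) (e : rel T).
Hypotheses (e_sym : symmetric e) (e_irr : irreflexive e).
Implicit Types (A B R S W : {set T}) (x y v : T) (c : T -> option nat).
Implicit Types (w : T -> nat) (m : pred T).
Local Notation deg := (deg e).
Local Notation nbrs := (nbrs e).
Local Notation nedges := (nedges e).

Variables (k E I : nat) (u : nat -> nat) (theta : int).

Definition charge (a : nat) (b : bool) : int :=
  ((u a)%:Z - (if b then E%:Z - I%:Z else 0))%R.

Definition pot w m A : int :=
  (\sum_(v in A) charge (w v) (m v) - (E * nedges A)%:Z)%R.

Lemma potU w m A B : [disjoint A & B] ->
  pot w m (A :|: B)%SET = (pot w m A + pot w m B - (E * crossing e A B)%:Z)%R.
Proof. by move=> dAB; rewrite /pot sumz_disjU // nedgesU //; lia. Qed.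

Lemma pot_unweighted A :
  pot (fun=> 1) xpred0 A = ((#|A| * u 1)%:Z - (E * nedges A)%:Z)%R.
Proof.
rewrite /pot /charge (eq_bigr (fun=> Posz (u 1))) => [|v _]; last by rewrite subr0.
by rewrite sumr_const -mulr_natr natz -PoszM mulnC.
Qed.

Lemma pot1 w m v : pot w m [set v]%SET = charge (w v) (m v).
Proof. by rewrite /pot big_set1 nedges1 // muln0 subr0. Qed.

Lemma potU1 w m v A : v \notin A ->
  pot w m (v |: A)%SET = (pot w m A + charge (w v) (m v) - (E * deg A v)%:Z)%R.
Proof.
move=> vA; rewrite potU ?disjoints1 // pot1 crossing1l; lia.
Qed.

Lemma pot_shift w w' m m' A :
  (pot w' m' A = pot w m A
    - \sum_(v in A) (charge (w v) (m v) - charge (w' v) (m' v)))%R.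
Proof. rewrite /pot sumzB; lia. Qed.

(** Each edge is split evenly between its ends; these local terms are the initial charges of the
    discharging arguments. *)
Lemma pot_handshake w m A :
  (2 * pot w m A = \sum_(v in A) (2 * charge (w v) (m v) - (E * deg A v)%:Z))%R.
Proof.
rewrite /pot [RHS]sumzB.
have -> : (\sum_(v in A) 2 * charge (w v) (m v) = 2 * \sum_(v in A) charge (w v) (m v))%R.
  by rewrite mulr_sumr.
have -> : (\sum_(v in A) (E * deg A v)%:Z = (E * crossing e A A)%:Z)%R.
  by rewrite /crossing big_distrr /= (big_morph Posz PoszD (erefl _)).
rewrite -(handshake e_sym e_irr); lia.
Qed.

Definition sparse w m S := forall R, R \subset S -> R != set0 ->
  (theta <= pot w m R)%R.

Lemma sparseS w m S S' : S' \subset S -> sparse w m S -> sparse w m S'.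
Proof. by move=> sS h R sR; apply: h; apply: subset_trans sS. Qed.

Variables (step gap1 gap2 : int).

(* A vertex of weight greater than [k] can only be independent, whence
   [u a = I]. *)
Record admissible : Prop := Admissible {
  k_gt1 : 1 < k;
  u_mono : forall a, u a.+1 <= u a;
  u_big : forall a, k < a -> u a = I;
  u_step : forall a, ((u a)%:Z - (u a.+1)%:Z <= step)%R;
  leIE : I <= E;
  leEu : E <= u 1;
  leuE : u 1 <= E + I;
  gap1E : (gap1 <= (E + I - u 1)%N%:Z + 1)%R;
  step_gap1 : (step <= gap1 - theta)%R;
  gap2_gap1 : (gap2 - 1 <= gap1 - theta + (E + I - u 1)%N%:Z)%R;
  gap2I : (gap2 - 1 <= I%:Z)%R;
  gap2u : forall a, 0 < a -> (gap2 - 1 <= E%:Z - (u a)%:Z + (u (a + k.-1))%:Z)%R;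
  gap1_gap2 : (gap1 <= gap2)%R;
  EI_theta : (I%:Z + I%:Z - E%:Z < theta)%R;
  u_merge : forall a b, 0 < b -> b <= k ->
    ((u a)%:Z - (u (a + b))%:Z <= E%:Z + E%:Z - I%:Z - (u b)%:Z)%R
}.
Hypothesis adm : admissible.

Lemma u_le a b : a <= b -> u b <= u a.
Proof.
move/subnKC <-; elim: (b - a) => [|n IHn]; first by rewrite addn0.
by rewrite addnS; apply: leq_trans (u_mono adm _) IHn.
Qed.

Lemma u_geI a : I <= u a.
Proof.
have := u_le (leq_addr k.+1 a); rewrite (u_big adm) //; lia.
Qed.

Section Minimal.
Variables (S : {set T}) (w : T -> nat) (m : pred T).
Hypothesis w_gt0 : forall x, 0 < w x.
Hypothesis IH : forall S' w' m', #|S'| < #|S| -> (forall x, 0 < w' x) ->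
  sparse w' m' S' -> colorable e k S' w' m'.
Hypothesis spS : sparse w m S.
Hypothesis not_col : ~ colorable e k S w m.

Section Glue.
Variables (R : {set T}) (c : T -> option nat) (J : pred T) (l : nat).
Hypotheses (sRS : R \subset S).
Hypothesis cR : coloring e k R w m c.
Hypothesis J1 : forall v v', J v -> J v' -> v = v'.
Hypothesis Jl : forall v y, J v -> y \in R -> e v y ->
  c y = None \/ c y = Some l.
Hypothesis Jw : forall v, J v -> class_weight R w c l < k.

(* The instance left on the complement of [R]. A vertex with a neighbour in the
   forest part of [R] gets a weight greater than [k], so that it must be
   independent; the vertex of [J], if any, may instead stay alone in a class,
   which can then be merged with class [l], of weight less than [k]. *)
Definition Fnbrs v := [set y in nbrs R v | c y != None]%SET.
Definition Inbrs v := [set y in nbrs R v | c y == None]%SET.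
Definition glue_w v :=
  w v + (if Fnbrs v == set0 then 0 else if J v then k.-1 else k).
Definition glue_m v := m v || (Inbrs v != set0).

(** In a colouring of the rest, a vertex seeing [F] in [R] is too heavy for any class unless it
    satisfies [J], and a vertex seeing an independent vertex of [R] is flagged. Hence every edge to
    [R] has exactly one independent end, apart from edges at the vertex of [J], whose class is
    merged with class [l]. A colouring of all of [S] would result. *)
Lemma glue_not_colorable : ~ colorable e k (S :\: R)%SET glue_w glue_m.
Proof.
move=> [c2 cc2]; apply: not_col.
have dRS : [disjoint R & S :\: R] by rewrite -setI_eq0 setDE setICA setICr setI0.
have SE : (R :|: (S :\: R))%SET = S.
  by apply/setP => x; rewrite !inE; case xR: (x \in R) => //=; rewrite (subsetP sRS).
have lew x : x \in (S :\: R)%SET -> w x <= glue_w x by rewrite leq_addr.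
have cc2' : coloring e k (S :\: R)%SET w m c2.
  have [h1 h2 h3] := coloringW lew cc2; split=> // x xS mx.
  by apply: h2; rewrite // /glue_m mx.
have w0 : class_weight R w c l <= k by have [_ _] := cR.
have FN x y : x \in R -> e x y -> c x != None -> Fnbrs y != set0.
  move=> xR exy cx; apply/set0Pn; exists x.
  by rewrite inE in_nbrs xR e_sym exy.
have IN x y : x \in R -> e x y -> c x == None -> Inbrs y != set0.
  move=> xR exy cx; apply/set0Pn; exists x.
  by rewrite inE in_nbrs xR e_sym exy.
have [_ m2 k2] := cc2.
have big2 y b : y \in (S :\: R)%SET -> Fnbrs y != set0 -> c2 y = Some b -> J y.
  move=> yS /negPf Fy cy; apply/negPn/negP => /negPf nJ.
  have := k2 b; rewrite /class_weight (bigD1 y) /= ?yS ?cy ?eqxx //.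
  by rewrite {1}/glue_w Fy nJ; have := w_gt0 y; lia.
have [/existsP[y /and3P[yS Jy Fy]]|noJ] :=
  boolP [exists z, [&& z \in (S :\: R)%SET, J z & Fnbrs z != set0]]; last first.
  have [n hn] := fresh (S :\: R)%SET c2.
  rewrite -SE; apply: (coloring_glue e_sym dRS cR cc2' (l := l) (n := n)).
    move=> x y xR yS exy; left; case cx: (c x) => [a|] /=; case cy: (c2 y) => [b|] //=.
      have Fy := FN x y xR exy; rewrite cx in Fy.
      by case/existsP: noJ; exists y; rewrite yS (big2 y b) ?Fy.
    have Iy := IN x y xR exy; rewrite cx in Iy.
    by have := m2 y yS; rewrite cy /glue_m Iy // orbT => /(_ isT).
  by rewrite [X in _ + X]class_weight0 // addn0.
(* The class of [y] has [glue_w] at most [k], of which [k.-1] was added at [y]; its true weight is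
   thus at most 1, and class [l] has weight below [k]. *)
have [n [cn nn]] : exists n, (c2 y = Some n \/ c2 y = None) /\
    class_weight R w c l + class_weight (S :\: R)%SET w c2 n <= k.
  case cy: (c2 y) => [n|]; last first.
    have [n hn] := fresh (S :\: R)%SET c2; exists n; split; first by right.
    by rewrite [X in _ + X]class_weight0 // addn0.
  exists n; split; first by left.
  have yn : (y \in (S :\: R)%SET) && (c2 y == Some n) by rewrite yS cy eqxx.
  have := k2 n; rewrite /class_weight (bigD1 y yn) /=.
  have -> : \sum_(x in S :\: R | c2 x == Some n) w x = w y +
      \sum_(x in S :\: R | (c2 x == Some n) && (x != y)) w x.
    by rewrite (bigD1 y yn) /=; under eq_bigl do rewrite -andbA.
  under [X in _ + X <= _ -> _]eq_bigl do rewrite -andbA.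
  rewrite {1}/glue_w (negPf Fy) Jy; have := Jw Jy; rewrite /class_weight.
  have : \sum_(i in S :\: R | (c2 i == Some n) && (i != y)) w i <=
    \sum_(i in S :\: R | (c2 i == Some n) && (i != y)) glue_w i.
    by apply: leq_sum => i /andP[/lew].
  by have := w_gt0 y; biglia.
rewrite -SE; apply: (coloring_glue e_sym dRS cR cc2' _ nn).
move=> x z xR zS exz; case cx: (c x) => [a|] /=; case cz: (c2 z) => [b|] /=; try by left.
- have Fz := FN x z xR exz; rewrite cx in Fz.
  have Jz := big2 z b zS (Fz isT) cz.
  have zy := J1 Jz Jy; rewrite zy in exz cz.
  case: (@Jl y x Jy xR); rewrite ?(e_sym y) // cx // => -[<-].
  by right; case: cn; rewrite cz // => -[->].
- have Iz := IN x z xR exz; rewrite cx in Iz.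
  by have := m2 z zS; rewrite cz /glue_m Iz // orbT => /(_ isT).
Qed.

(** The edges from [v] to [R], which the complement no longer pays for, less the charge that [v]
    loses through its new weight and flag. *)
Definition gain v : int := ((E * deg R v)%:Z
  - (charge (w v) (m v) - charge (glue_w v) (glue_m v)))%R.

Lemma deg_FI v : deg R v = #|Fnbrs v| + #|Inbrs v|.
Proof.
rewrite !/(deg _ _) -(cardsID [set y | c y != None]%SET (nbrs R v)).
congr (_ + _); apply: eq_card => y; rewrite !inE //.
by rewrite negbK andbC.
Qed.

Lemma glue_w_gt0 v : 0 < glue_w v.
Proof. by rewrite ltn_addr. Qed.

(** Every edge to [R] returns [E]. Neighbours in [F] cost at most [u 1 - I] in total, since [u]
    never drops below [I], and independent neighbours cost at most [E - I] in total. As [leuE]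
    holds, the truncated subtraction is exact. *)
Lemma gain_bound v : 0 < deg R v -> ((E + I - u 1)%N%:Z <= gain v)%R.
Proof.
rewrite /gain deg_FI /glue_w /glue_m /charge => d0.
have [[h1 h2] h3] := (leIE adm, leEu adm, leuE adm).
have u1 : u (w v) <= u 1 by apply: u_le.
have iF : (Fnbrs v == set0) = (#|Fnbrs v| == 0) by rewrite cards_eq0.
have iI : (Inbrs v == set0) = (#|Inbrs v| == 0) by rewrite cards_eq0.
move: d0; rewrite {}iF {}iI.
move: #|Fnbrs v| #|Inbrs v| => [|a] [|b] //= _; rewrite ?addn0 ?orbF ?orbT.
- by rewrite add0n mulnS; case: (m v) => /=; nia.
- have I2 := u_geI (w v + if J v then k.-1 else k).
  by rewrite mulnS; case: (m v) => /=; nia.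
- have I2 := u_geI (w v + if J v then k.-1 else k).
  by rewrite addSn addnS !mulnS; case: (m v) => /=; nia.
Qed.

Lemma gain0 v : deg R v = 0 -> gain v = 0%R.
Proof.
move=> d0; have /andP[/eqP F0 /eqP I0] : (#|Fnbrs v| == 0) && (#|Inbrs v| == 0).
  by rewrite -addn_eq0 -deg_FI d0.
rewrite /gain d0 /glue_w /glue_m (cards0_eq F0) (cards0_eq I0) eqxx /=.
by rewrite addn0 orbF; lia.
Qed.

Lemma gain_ge0 v : (0 <= gain v)%R.
Proof. by have [/gain0->//|/gain_bound] := posnP (deg R v); lia. Qed.

Lemma pot_glue W : [disjoint R & W] ->
  pot glue_w glue_m W = (pot w m (R :|: W)%SET - pot w m R + \sum_(v in W) gain v)%R.
Proof.
move=> dRW; have -> : (\sum_(v in W) gain v = (E * crossing e W R)%:Z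
    - \sum_(v in W) (charge (w v) (m v) - charge (glue_w v) (glue_m v)))%R.
  rewrite /gain [LHS]sumzB /crossing big_distrr /=.
  by rewrite (big_morph Posz PoszD (erefl _)).
rewrite (pot_shift w _ m) potU // crossingC //.
by move: (\sum_(v in W) _)%R => x; lia.
Qed.

(** The weak case is a single neighbour in [F] and none in [I], where being made overweight may
    leave only [E + I - u 1]. An independent neighbour or a second edge to [F] brings the gain up to
    [I]; under [J] the added weight is only [k.-1], which is the case measured by [gap2u]. *)
Lemma gain_bound2 v : 0 < deg R v ->
  [|| 0 < #|Inbrs v|, 1 < #|Fnbrs v| | J v] -> (gap2 - 1 <= gain v)%R.
Proof.
rewrite /gain deg_FI /glue_w /glue_m /charge => d0.
have [[h1 h2] h3] := (leIE adm, leEu adm, leuE adm).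
have u1 : u (w v) <= u 1 by apply: u_le.
have [[Iu g2] gu] := (u_geI (w v), gap2I adm, gap2u adm (w_gt0 v)).
have iF : (Fnbrs v == set0) = (#|Fnbrs v| == 0) by rewrite cards_eq0.
have iI : (Inbrs v == set0) = (#|Inbrs v| == 0) by rewrite cards_eq0.
move: d0; rewrite {}iF {}iI.
move: #|Fnbrs v| #|Inbrs v| => [|a] [|b] //=; rewrite ?addn0 ?orbF ?orbT.
- by rewrite add0n mulnS; case: (m v) => /=; nia.
- case: (J v); rewrite ?orbF; first by rewrite mulnS; case: (m v) => /=; nia.
  have I2 := u_geI (w v + k).
  by case: a => // a _ _; rewrite !mulnS; case: (m v) => /=; nia.
- have I2 := u_geI (w v + if J v then k.-1 else k).
  by rewrite addSn addnS !mulnS; case: (m v) => /=; nia.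
Qed.

Hypothesis RS : R != S.
Hypothesis R0 : R != set0.

(** A set without neighbours in [R] keeps its weights, flags and potential, so only the sets [W]
    touching [R] have to be checked for sparsity. *)
Lemma glue_sparse_contra :
  (forall W v, W \subset (S :\: R)%SET -> v \in W -> 0 < deg R v ->
    (theta <= pot w m (R :|: W)%SET - pot w m R + \sum_(v in W) gain v)%R) -> False.
Proof.
move=> h; apply: glue_not_colorable; apply: IH.
- apply: proper_card; rewrite properE subsetDl /=; apply/negP => sS.
  have [x xR] := set0Pn _ R0.
  by have := subsetP sS x (subsetP sRS x xR); rewrite inE xR.
- exact: glue_w_gt0.
- move=> W sW W0.
  have dRW : [disjoint R & W].
    rewrite disjoint_sym; apply: disjointWl sW _.
    by rewrite -setI_eq0 setIC setDE setICA setICr setI0.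
  have [/existsP[v /andP[vW dv]]|n] := boolP [exists v, (v \in W) && (0 < deg R v)].
    by rewrite pot_glue //; apply: h dv.
  have d0 v : v \in W -> deg R v = 0.
    move=> vW; apply/eqP; rewrite -leqn0 leqNgt; apply: contra n => dv.
    by apply/existsP; exists v; rewrite vW.
  rewrite pot_glue // big1 => [|v /d0 /gain0 //].
  rewrite potU // crossingC // /crossing big1 //.
  have := spS (subset_trans sW (subsetDl _ _)) W0; lia.
Qed.

Lemma sum_gain_ge W v : v \in W -> (gain v <= \sum_(v in W) gain v)%R.
Proof.
move=> vW; rewrite (bigD1 v) //= lerDl.
by apply: sumr_ge0 => z _; apply: gain_ge0.
Qed.

End Glue.

(** A proper [R] has a colouring by minimality. If its potential were below [gap1], it would be at
    most the gain of any one outside vertex touching [R], so every [W] would remain sparse after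
    gluing. *)
Lemma gap1P R : R \subset S -> R != set0 -> R != S -> (gap1 <= pot w m R)%R.
Proof.
move=> sRS R0 RS; rewrite leNgt; apply/negP => lt.
have prR : #|R| < #|S| by apply: proper_card; rewrite properEneq RS.
have [c cc] := IH prR w_gt0 (sparseS sRS spS).
have := @glue_sparse_contra R c pred0 0 sRS cc; apply=> //.
move=> W v sW vW dv.
have RW0 : (R :|: W)%SET != set0.
  by apply: contra R0 => /eqP h; rewrite -subset0 -h subsetUl.
have sRW : (R :|: W)%SET \subset S.
  by rewrite subUset sRS (subset_trans sW) // subsetDl.
have := @sum_gain_ge R c pred0 sRS W v vW.
have := @gain_bound R c pred0 sRS v dv.
have := spS sRW RW0; have := gap1E adm.
by move: lt; move: (\sum_(v in W) _)%R; clear; lia.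
Qed.

(** An edge [xy] leaving [R] is singled out. If [W] contains [y], then [y] alone has a large gain;
    otherwise [R :|: W] is a proper subset, and [gap1P] applies to it in place of [theta]. *)
Lemma gap2P R : R \subset S -> R != set0 -> R != S -> (gap2 <= pot w m R)%R.
Proof.
move=> sRS R0 RS; rewrite leNgt; apply/negP => lt.
have prR : #|R| < #|S| by apply: proper_card; rewrite properEneq RS.
have [/existsP[x /andP[xR /existsP[y /andP[ySR exy]]]]|n] :=
  boolP [exists x, (x \in R) && [exists y, (y \in (S :\: R)%SET) && e x y]]; last first.
  have [c cc] := IH prR w_gt0 (sparseS sRS spS).
  have := @glue_sparse_contra R c pred0 0 sRS cc; apply=> //.
  move=> W v sW vW /card_gt0P[z]; rewrite in_nbrs => /andP[zR evz].
  case/negP: n; apply/existsP; exists z; rewrite zR /=.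
  by apply/existsP; exists v; rewrite (subsetP sW) // e_sym.
(* The extra unit at [x] costs at most [step], which the first gap covers on every subset of [R]. In
   the resulting colouring, the class of [x] has true weight below [k]. *)
pose w1 v := w v + (v == x).
have w1_gt0 v : 0 < w1 v by rewrite ltn_addr.
have sp1 : sparse w1 m R.
  move=> A sA A0; rewrite (pot_shift w _ m).
  have : (\sum_(v in A) (charge (w v) (m v) - charge (w1 v) (m v)) <= step)%R.
    have st0 : (0 <= step)%R by have := u_step adm k.+1; rewrite !(u_big adm) //; lia.
    have d0 v : v != x -> (charge (w v) (m v) - charge (w1 v) (m v) = 0)%R.
      by move=> /negPf vx; rewrite /w1 vx addn0 subrr.
    have [xA|xA] := boolP (x \in A).
      rewrite (bigD1 x) //= big1 => [|v /andP[_ /d0 //]].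
      by rewrite addr0 /w1 eqxx addn1 /charge; have := u_step adm (w x); clear; lia.
    by rewrite big1 // => v vA; apply: d0; apply: contraNneq xA => <-.
  have : (gap1 <= pot w m A)%R.
    apply: gap1P A0 _; first exact: subset_trans sRS.
    by apply: contra RS => /eqP h; rewrite eqEsubset sRS -{1}h.
  have := step_gap1 adm.
  by move: (\sum_(v in A) _)%R; clear; lia.
have [c cc1] := IH prR w1_gt0 sp1.
have cc : coloring e k R w m c by apply: coloringW cc1 => v _; apply: leq_addr.
pose l := odflt 0 (c x).
(* When this fails for [y], either [x] is independent or [y] sees in [R] a second vertex of [F];
   both cases already have a large gain by [gain_bound2]. *)
pose J v := [&& v == y, c x != None &
  [forall z in nbrs R y, (c z == None) || (c z == c x)]].
have ccR := @glue_sparse_contra R c J l sRS cc; apply: ccR => //.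
- by move=> v v' /and3P[/eqP -> _ _] /and3P[/eqP -> _ _].
- move=> v z /and3P[/eqP -> cx /forall_inP h] zR eyz.
  have /h /orP[/eqP ->|/eqP ->] : z \in nbrs R y by rewrite in_nbrs zR.
    by left.
  by right; rewrite /l; case: (c x) cx.
- move=> v /and3P[_ cx _]; have [_ _ /(_ l)] := cc1; apply: leq_trans.
  have xl : (x \in R) && (c x == Some l) by rewrite xR /l; case: (c x) cx => //=.
  rewrite /class_weight (bigD1 x xl) [leqRHS](bigD1 x xl) /= /w1 eqxx addn1 addSn ltnS.
  by apply: leq_add => //; apply: leq_sum => z _; apply: leq_addr.
move=> W v sW vW dv.
have RW0 : (R :|: W)%SET != set0.
  by apply: contra R0 => /eqP h; rewrite -subset0 -h subsetUl.
have sRW : (R :|: W)%SET \subset S.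
  by rewrite subUset sRS (subset_trans sW) // subsetDl.
have [yS yR] : y \in S /\ y \notin R by move: ySR; rewrite inE => /andP[].
have [yW|yW] := boolP (y \in W); last first.
  have := @sum_gain_ge R c J sRS W v vW.
  have := @gain_bound R c J sRS v dv.
  have : (gap1 <= pot w m (R :|: W))%R.
    apply: gap1P => //; apply: contra yW => /eqP h.
    by move: yS; rewrite -h inE (negPf yR).
  have := gap2_gap1 adm.
  by move: lt; move: (\sum_(v in W) _)%R; clear; lia.
have xn : x \in nbrs R y by rewrite in_nbrs xR e_sym.
have : (gap2 - 1 <= gain R c J y)%R.
  apply: gain_bound2 => //; first by apply/card_gt0P; exists x.
  have [cx|cx] := boolP (c x == None).
    by apply/orP; left; apply/card_gt0P; exists x; rewrite inE xn.
  have [Jy|Jn] := boolP (J y); apply/or3P; first by apply: Or33.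
  apply: Or32.
  move: Jn; rewrite /J eqxx cx /= negb_forall_in => /exists_inP[z zn].
  rewrite negb_or => /andP[cz czx].
  have xz : x != z by apply: contra czx => /eqP ->.
  have <- : #|[set x; z]%SET| = 2 by rewrite cards2 xz.
  by apply/subset_leq_card/subsetP => t; rewrite !inE => /orP[] /eqP ->;
    rewrite ?cx ?cz ?andbT -in_nbrs.
have := @sum_gain_ge R c J sRS W y yW.
have := spS sRW RW0.
by move: lt; move: (\sum_(v in W) _)%R; clear; lia.
Qed.

End Minimal.
End Potential.

(** * Reducible configurations *)

Section Reductions.
Variables (T : finType) (e : rel T).
Hypotheses (e_sym : symmetric e) (e_irr : irreflexive e).
Implicit Types (A B D R S W : {set T}) (x y v : T) (c : T -> option nat).
Local Notation deg := (deg e).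
Local Notation nbrs := (nbrs e).
Variables (k E I : nat) (u : nat -> nat) (theta step gap1 gap2 : int).
Hypothesis adm : admissible k E I u theta step gap1 gap2.
Local Notation charge := (charge E I u).
Local Notation pot := (pot e E I u).
Local Notation sparse := (sparse e E I u theta).
Variables (S : {set T}) (w : T -> nat) (m : pred T).
Hypothesis w_gt0 : forall x, 0 < w x.
Hypothesis IH : forall S' w' m', #|S'| < #|S| -> (forall x, 0 < w' x) ->
  sparse w' m' S' -> colorable e k S' w' m'.
Hypothesis spS : sparse w m S.
Hypothesis not_col : ~ colorable e k S w m.

Lemma proper_gap R : R \subset S -> R != set0 -> R != S -> (gap2 <= pot w m R)%R.
Proof. exact: (gap2P e_sym e_irr adm w_gt0 IH spS not_col). Qed.

Definition add_at x n v := w v + (if v == x then n else 0).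

Lemma pot_D1 v W : v \notin W -> forall w' m',
  pot w' m' (v |: W)%SET = (pot w' m' W + charge (w' v) (m' v) - (E * deg W v)%:Z)%R.
Proof. by move=> vW w' m'; rewrite potU1. Qed.

Lemma colorD1 v : v \in S -> colorable e k (S :\ v)%SET w m.
Proof.
move=> vS; apply: IH => //; last exact: sparseS (subD1set _ _) spS.
by rewrite [X in _ < X](cardsD1 v) vS.
Qed.

(** A flag forces [v] into [F] and an excessive weight forces it into [I]; such a vertex alone would
    have potential [2 I - E], below [theta]. *)
Lemma forced_le v : v \in S -> m v -> w v <= k.
Proof.
move=> vS mv; rewrite leqNgt; apply/negP => kw.
have := spS (R := [set v]%SET); rewrite sub1set vS -card_gt0 cards1 => /(_ isT isT).
rewrite pot1 // !/(charge _ _) mv (u_big adm) //.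
by have := EI_theta adm; clear; lia.
Qed.

(** Placing [v] in [I] fails only if some neighbour is in [I]; if that is its only neighbour, [v]
    can form a class of its own. *)
Lemma free_deg v : v \in S -> ~~ m v -> w v <= k -> 1 < deg S v.
Proof.
move=> vS mv wk; rewrite ltnNge; apply/negP => d1; apply: not_col.
have [c cc] := colorD1 vS.
have vn : v \notin (S :\ v)%SET by rewrite !inE eqxx.
rewrite -(setD1K vS).
have [/exists_inP[y ySv /andP[evy cy]]|h] :=
  boolP [exists y in (S :\ v)%SET, e v y && (c y == None)]; last first.
  exists (upd c v None); apply: (coloring_extI e_sym e_irr vn cc) => // y yS evy.
  by apply: contra h => cy; apply/exists_inP; exists y; rewrite ?evy.
have [a [ca _]] : exists a, coloring e k (v |: S :\ v)%SET w m (upd c v (Some a)) /\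
    forall x, x \in (S :\ v)%SET -> c x != Some a.
  apply: (coloring_extF e_sym e_irr vn cc) => // z zS evz.
  have [->|zy] := eqVneq z y; first by apply/eqP.
  have : #|[set z; y]%SET| <= 1.
    apply: leq_trans d1; apply/subset_leq_card/subsetP => t.
    rewrite !inE => /orP[] /eqP ->.
      by move: zS; rewrite inE => /andP[_ ->].
    by move: ySv; rewrite inE => /andP[_ ->].
  by rewrite cards2 zy.
by exists (upd c v (Some a)).
Qed.

Lemma indep_deg v : v \in S -> k < w v -> ~~ m v /\ 0 < deg S v.
Proof.
move=> vS kw; have mv : ~~ m v.
  by apply: contraL kw => /(forced_le vS); rewrite leqNgt.
split=> //; rewrite lt0n; apply/eqP => d0; apply: not_col.
have [c cc] := colorD1 vS.
have vn : v \notin (S :\ v)%SET by rewrite !inE eqxx.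
rewrite -(setD1K vS); exists (upd c v None).
apply: (coloring_extI e_sym e_irr vn cc) => // y yS evy.
have /setP/(_ y) := cards0_eq d0.
by rewrite !inE evy; move: yS; rewrite inE => /andP[_ ->].
Qed.

Definition loss (a : T -> nat) v : int := ((u (w v))%:Z - (u (w v + a v))%:Z)%R.

Lemma color_add D (a : T -> nat) : D \subset S -> D != set0 ->
    (forall W, W \subset (S :\: D)%SET -> W != set0 ->
      (theta + \sum_(v in W) loss a v <= pot w m W)%R) ->
  colorable e k (S :\: D)%SET (fun v => w v + a v) m.
Proof.
move=> sD D0 h; apply: IH.
- rewrite -[X in _ < X](cardsID D S) (setIidPr sD).
  by rewrite -[ltnLHS]add0n ltn_add2r card_gt0.
- by move=> x; rewrite ltn_addr.
- move=> W sW W0; rewrite (pot_shift e E I u w _ m m).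
  have -> : (\sum_(v in W) (charge (w v) (m v) - charge (w v + a v) (m v)) =
      \sum_(v in W) loss a v)%R.
    by apply: eq_bigr => v _; rewrite !/(charge _ _) /loss; clear; lia.
  by have := h W sW W0; move: (\sum_(v in W) loss a v)%R; clear; lia.
Qed.

Lemma sum_loss1 W x n : (\sum_(v in W) loss (fun v => if v == x then n else 0) v =
  if x \in W then (u (w x))%:Z - (u (w x + n))%:Z else 0)%R.
Proof.
have h v : v != x -> loss (fun v => if v == x then n else 0) v = 0%R.
  by move=> /negPf vx; rewrite /loss vx addn0 subrr.
case: ifP => [xW|xW]; last first.
  by rewrite big1 // => v vW; apply: h; apply: contraFneq xW => <-.
rewrite (bigD1 x) //= big1 => [|v /andP[_ /h //]].
by rewrite addr0 /loss eqxx.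
Qed.

Lemma sum_loss2 W x y n : x != y ->
  (\sum_(v in W) loss (fun v => if (v == x) || (v == y) then n else 0) v =
    (if x \in W then (u (w x))%:Z - (u (w x + n))%:Z else 0) +
    (if y \in W then (u (w y))%:Z - (u (w y + n))%:Z else 0))%R.
Proof.
move=> xy; rewrite -!sum_loss1 -big_split /=; apply: eq_bigr => v _.
rewrite /loss; have [->|vx] := eqVneq v x; first by rewrite (negPf xy) addn0 subrr addr0.
by rewrite addn0 subrr add0r.
Qed.

Lemma proper_sub W D : D \subset S -> D != set0 -> W \subset (S :\: D)%SET ->
  W \subset S /\ W != S.
Proof.
move=> sD /set0Pn[x xD] sW; split; first exact: subset_trans sW (subsetDl _ _).
apply: contraTneq sW => ->; apply/subsetPn; exists x; first exact: (subsetP sD).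
by rewrite inE xD.
Qed.

(** Every nonempty proper subset has slack [gap2 - theta], which pays for raising one vertex. *)
Lemma color_add1 D x n : D \subset S -> D != set0 ->
    ((u (w x))%:Z - (u (w x + n))%:Z <= gap2 - theta)%R ->
  colorable e k (S :\: D)%SET (add_at x n) m.
Proof.
move=> sD D0 hx; apply: color_add => // W sW W0; rewrite sum_loss1.
have [sWS WS] := proper_sub sD D0 sW.
have := proper_gap sWS W0 WS; have := spS sWS W0; move: hx.
by case: ifP => _; clear; lia.
Qed.

(** A flagged leaf is deleted and its weight moved to its neighbour [x]: afterwards [v] joins the
    class of [x], or opens a class if [x] is independent. *)
Lemma forced_deg v : v \in S -> m v -> 1 < deg S v.
Proof.
move=> vS mv; have wk := forced_le vS mv.
have vn : v \notin (S :\ v)%SET by rewrite !inE eqxx.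
have sv : [set v]%SET \subset S by rewrite sub1set.
have v0 : [set v]%SET != set0 by rewrite -card_gt0 cards1.
rewrite ltnNge leq_eqVlt ltnS leqn0; apply/negP => /orP[/cards1P[x nx]|d0]; last first.
  apply: not_col; have [c cc] := colorD1 vS; rewrite -(setD1K vS).
  have [|a [ca _]] := coloring_extF e_sym e_irr vn cc (fun _ _ => leqnn _) _ wk.
    move=> y yS evy; have /setP/(_ y) := cards0_eq (eqP d0).
    by rewrite !inE evy; move: yS; rewrite inE => /andP[_ ->].
  by exists (upd c v (Some a)).
have xn y : y \in (S :\ v)%SET -> e v y -> y = x.
  move=> yS evy; apply/set1P; rewrite -nx in_nbrs evy.
  by move: yS; rewrite inE => /andP[_ ->].
have /andP[xS evx] : (x \in S) && e v x by rewrite -in_nbrs nx inE.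
have xSv : x \in (S :\ v)%SET.
  by rewrite !inE xS andbT; apply: contraTneq evx => ->; rewrite e_irr.
have [c cc] : colorable e k (S :\: [set v])%SET (add_at x (w v)) m.
  apply: color_add => // W sW W0; rewrite sum_loss1.
  have [sWS WS] := proper_sub sv v0 sW.
  have := spS sWS W0; case: ifP => xW; last by clear; lia.
  have vW : v \notin W by apply: contra vn => /(subsetP sW).
  have := spS (R := (v |: W)%SET); rewrite subUset sv sWS => /(_ isT).
  have -> : (v |: W)%SET != set0.
    by apply/set0Pn; exists v; rewrite !inE eqxx.
  (* Adding [v] back to [W] contributes [u (w v) - (E - I) - E] and must not go below [theta]; so
     [W] exceeds [theta] by at least [2 E - I - u (w v)], the budget in [u_merge]. *)
  move=> /(_ isT); rewrite potU1 // mv.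
  have -> : deg W v = 1.
    apply/eqP/cards1P; exists x; apply/setP => y; rewrite in_nbrs inE.
    apply/andP/eqP => [[yW evy]|->]; last by rewrite xW evx.
    by apply: xn evy; apply: (subsetP sW).
  rewrite !/(charge _ _) muln1; have := u_merge adm (w x) (w_gt0 v) wk.
  by clear; lia.
apply: not_col; rewrite -(setD1K vS).
case cx: (c x) => [a|]; last first.
  have [|y|a [ca _]] := coloring_extF e_sym e_irr vn cc _ _ wk.
  - by move=> y _; apply: leq_addr.
  - by move=> yS evy; rewrite (xn y).
  - by exists (upd c v (Some a)).
exists (upd c v (Some a)).
apply: (coloring_extJ e_sym e_irr vn cc _ xSv cx) => [y _||y yS evy].
- exact: leq_addr.
- by rewrite /add_at eqxx.
- by right; rewrite (xn y).
Qed.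

(** The weight of [v] is reserved at both neighbours and [v] is deleted. If both end up in [F], [v]
    is independent; if exactly one does, [v] joins its class; if neither does, [v] opens a class. A
    set containing both neighbours pays for the two raises by adding [v] back; the enlarged set may
    be all of [S], whence the minimum of [gap2] and the potential of [S]. *)
Lemma no_2vertex v x y : v \in S -> ~~ m v -> w v <= k ->
    nbrs S v = [set x; y]%SET -> x != y ->
    ((u (w x))%:Z - (u (w x + w v))%:Z <= gap2 - theta)%R ->
    ((u (w y))%:Z - (u (w y + w v))%:Z <= gap2 - theta)%R ->
    (((u (w x))%:Z - (u (w x + w v))%:Z) + ((u (w y))%:Z - (u (w y + w v))%:Z)
      <= Num.min gap2 (pot w m S) - (u (w v))%:Z + E%:Z + E%:Z - theta)%R ->
  False.
Proof.
move=> vS mv wk nv xy lx ly lxy.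
have vn : v \notin (S :\ v)%SET by rewrite !inE eqxx.
have sv : [set v]%SET \subset S by rewrite sub1set.
have v0 : [set v]%SET != set0 by rewrite -card_gt0 cards1.
have nE z : z \in (S :\ v)%SET -> e v z -> z = x \/ z = y.
  move=> zS evz; apply/set2P; rewrite -nv in_nbrs evz.
  by move: zS; rewrite inE => /andP[_ ->].
have nS z : z = x \/ z = y -> z \in (S :\ v)%SET /\ e v z.
  move/set2P; rewrite -nv in_nbrs => /andP[zS evz]; split=> //.
  by rewrite !inE zS andbT; apply: contraTneq evz => ->; rewrite e_irr.
have [xSv evx] := nS x (or_introl erefl).
have [ySv evy] := nS y (or_intror erefl).
have [c cc] : colorable e k (S :\: [set v])%SET
    (fun z => w z + if (z == x) || (z == y) then w v else 0) m.
  apply: color_add => // W sW W0; rewrite sum_loss2 //.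
  have [sWS WS] := proper_sub sv v0 sW.
  have gW := proper_gap sWS W0 WS.
  have [xW|xW] := boolP (x \in W); have [yW|yW] := boolP (y \in W); last 1 first.
  - by rewrite /= !addr0; apply: spS.
  - have vW : v \notin W by apply: contra vn => /(subsetP sW).
    have dW : deg W v = 2.
      rewrite !/(deg _ _) (_ : nbrs W v = [set x; y]%SET) ?cards2 ?xy //.
      apply/setP => z; rewrite in_nbrs.
      apply/andP/set2P => [[zW evz]|[]->]; rewrite ?xW ?yW ?evx ?evy //.
      by apply: nE evz; apply: (subsetP sW).
    have pW := pot_D1 vW w m; rewrite dW !/(charge _ _) (negPf mv) in pW.
    have gvW : (Num.min gap2 (pot w m S) <= pot w m (v |: W))%R.
      have [->|nS'] := eqVneq (v |: W)%SET S; first by rewrite ge_min lexx orbT.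
      rewrite ge_min proper_gap //; first by rewrite subUset sv.
      by apply/set0Pn; exists v; rewrite !inE eqxx.
    move: lxy gvW pW; move: (Num.min _ _) => g /=; clear; lia.
  - by move: lx gW => /=; clear; lia.
  - by move: ly gW => /=; clear; lia.
apply: not_col; rewrite -(setD1K vS).
have lew z : z \in (S :\ v)%SET -> w z <= w z + if (z == x) || (z == y) then w v else 0.
  by move=> _; apply: leq_addr.
case cx: (c x) => [a|]; case cy: (c y) => [b|].
- exists (upd c v None); apply: (coloring_extI e_sym e_irr vn cc) => // z zS evz.
  by case: (nE z zS evz) => ->; rewrite ?cx ?cy.
- exists (upd c v (Some a)).
  apply: (coloring_extJ e_sym e_irr vn cc lew xSv cx) => [|z zS evz].
    by rewrite eqxx.
  by case: (nE z zS evz) => ->; rewrite ?cx ?cy; [right|left].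
- exists (upd c v (Some b)).
  apply: (coloring_extJ e_sym e_irr vn cc lew ySv cy) => [|z zS evz].
    by rewrite eqxx orbT.
  by case: (nE z zS evz) => ->; rewrite ?cx ?cy; [left|right].
- have [|a [ca _]] := coloring_extF e_sym e_irr vn cc lew _ wk.
    by move=> z zS evz; case: (nE z zS evz) => ->.
  by exists (upd c v (Some a)).
Qed.

End Reductions.

(** * Discharging for components of order at most 4 and at most 6 *)

Section Thresholds.
Variables (T : finType) (e : rel T).
Hypotheses (e_sym : symmetric e) (e_irr : irreflexive e).
Implicit Types (S : {set T}) (w : T -> nat) (m : pred T).

Lemma sparse_colorable_ind k E I u theta :
    (forall S w m, (forall x, 0 < w x) ->
      (forall S' w' m', #|S'| < #|S| -> (forall x, 0 < w' x) ->
        sparse e E I u theta w' m' S' -> colorable e k S' w' m') ->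
      sparse e E I u theta w m S -> ~ colorable e k S w m -> False) ->
  forall S w m, (forall x, 0 < w x) -> sparse e E I u theta w m S ->
  colorable e k S w m.
Proof.
move=> h S w m; have [n] := ubnP #|S|.
elim: n S w m => // n IHn S w m leSn w_gt0 spS; apply: contrapT => nc.
apply: (h S w m) => // S' w' m' ltS; apply: IHn.
by apply: leq_trans ltS _; rewrite -ltnS.
Qed.

Lemma not_colorable_neq0 k S w m : ~ colorable e k S w m -> S != set0.
Proof. by move=> nc; apply: contra_not_neq nc => ->; apply: colorable0. Qed.

Lemma sum_lt0 S (F : T -> int) v : v \in S -> (F v < 0)%R ->
  (forall x, x \in S -> (F x <= 0)%R) -> (\sum_(x in S) F x < 0)%R.
Proof.
move=> vS Fv h; rewrite (bigD1 v) //=.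
have : (\sum_(x in S | x != v) F x <= 0)%R by apply: sumr_le0 => x /andP[/h].
by move: Fv; move: (\sum_(x in S | x != v) F x)%R; clear; lia.
Qed.

Lemma deg2P S v : deg e S v = 2 ->
  exists x y, x != y /\ nbrs e S v = [set x; y]%SET.
Proof. by move/eqP/cards2P => [x [y [xy nv]]]; exists x, y. Qed.

Lemma loss_le (u : nat -> nat) s : (forall a, u a <= u a.+1 + s) ->
  forall b a, u a <= u (a + b) + s * b.
Proof.
move=> us; elim=> [|b IHb] a; first by rewrite addn0 muln0 addn0.
by apply: leq_trans (IHb a) _; rewrite addnS mulnS; have := us (a + b); lia.
Qed.

(** From weight 1 on, each unit costs 2, until the default value, which is [I], is reached just
    above [k = 4]. *)
Definition u4 := nth 4 [:: 12; 12; 10; 8; 6].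

Lemma u4_big a : 4 < a -> u4 a = 4.
Proof. by move: a => [|[|[|[|[|a]]]]]; rewrite /u4 //= nth_nil. Qed.

Lemma u4_step a : u4 a <= u4 a.+1 + 2.
Proof. by move: a => [|[|[|[|[|a]]]]] //; rewrite !u4_big. Qed.

Lemma u4_admissible : admissible 4 9 4 u4 0 2 2 4.
Proof.
split => //.
- by move=> [|[|[|[|[|a]]]]] //; rewrite !u4_big.
- exact: u4_big.
- by move=> a; have := u4_step a; clear; lia.
- by move=> [|[|[|[|[|a]]]]] // _; rewrite addSn !u4_big.
- by move=> [|[|[|[|[|a]]]]] [|[|[|[|[|b]]]]] // _ _;
    rewrite [u4 _.+4]u4_big // [u4 (_.+4 + _)]u4_big.
Qed.

Theorem colorable4 S w m : (forall x, 0 < w x) ->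
  sparse e 9 4 u4 0 w m S -> colorable e 4 S w m.
Proof.
apply: sparse_colorable_ind => {}S {}w {}m w_gt0 IH spS nc.
have adm := u4_admissible.
have S0 := not_colorable_neq0 nc.
have ls := loss_le u4_step.
(* These terms add up to twice the potential of [S], which sparsity makes nonnegative. *)
suff lt0 v : v \in S ->
    (2 * charge 9 4 u4 (w v) (m v) - (9 * deg e S v)%:Z < 0)%R.
  have := spS S (subxx _) S0; rewrite leNgt => /negP; apply.
  suff : (2 * pot e 9 4 u4 w m S < 0)%R by clear; lia.
  rewrite pot_handshake //; have [v vS] := set0Pn _ S0.
  by apply: (sum_lt0 vS) => [|x xS]; [|apply: ltW]; apply: lt0.
move=> vS; have wv := w_gt0 v.
have [kw|wk] := ltnP 4 (w v).
  have [/negPf mv d1] := indep_deg e_sym e_irr adm w_gt0 IH spS nc vS kw.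
  by rewrite /charge mv (u_big adm) //; move: d1; clear; lia.
have [mv|mv] := boolP (m v).
  have d2 := forced_deg e_sym e_irr adm w_gt0 IH spS nc vS mv.
  have := u_le adm wv; rewrite /charge; move: (u4 _) d2 => t.
  by rewrite [u4 1]/u4 /=; clear; lia.
have d2 := free_deg e_sym e_irr w_gt0 IH spS nc vS mv wk.
rewrite /charge; move: d2; rewrite leq_eqVlt => /orP[/eqP d2|d3]; last first.
  by have := u_le adm wv; move: (u4 _) d3 => t; rewrite [u4 1]/u4 /=; clear; lia.
rewrite -d2.
(* At degree 2, weight at least 3 gives at most [2 * 8 - 18 < 0], while weights 1 and 2 are
   reducible. *)
have [w3|w2] := ltnP 2 (w v).
  by have := u_le adm w3; move: (u4 _) => t; rewrite [u4 3]/u4 /=; clear; lia.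
have [x [y [xy nv]]] := deg2P (esym d2).
exfalso; apply: (no_2vertex e_sym e_irr adm w_gt0 IH spS nc vS mv wk nv xy).
- by have := ls (w v) (w x); move: w2; clear; lia.
- by have := ls (w v) (w y); move: w2; clear; lia.
have := ls (w v) (w x); have := ls (w v) (w y).
have p0 := spS S (subxx _) S0.
have : (0 <= Num.min 4 (pot e 9 4 u4 w m S))%R by rewrite le_min p0.
move: (Num.min _ _) => p.
move: wv w2; case: (w v) => [|[|[|a]]] // _ _; rewrite /u4 /= -/u4;
  move: (u4 _) (u4 _) (u4 _) (u4 _) => a1 a2 a3 a4; clear; lia.
Qed.

(** The plateau [u6 5 = u6 6 = 3] has two reasons: [gap2u] at weight 1 requires [u6 6] to be at
    least 3, and raising a weight from 3 to 6 must cost no more than 2. *)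
Definition u6 := nth 2 [:: 7; 7; 6; 5; 4; 3; 3].

Lemma u6_big a : 6 < a -> u6 a = 2.
Proof. by move: a => [|[|[|[|[|[|[|a]]]]]]]; rewrite /u6 //= nth_nil. Qed.

Lemma u6_step a : u6 a <= u6 a.+1 + 1.
Proof. by move: a => [|[|[|[|[|[|[|a]]]]]]] //; rewrite !u6_big. Qed.

Lemma u6_admissible : admissible 6 5 2 u6 0 1 1 2.
Proof.
split => //.
- by move=> [|[|[|[|[|[|[|a]]]]]]] //; rewrite !u6_big.
- exact: u6_big.
- by move=> a; have := u6_step a; clear; lia.
- by move=> [|[|[|[|[|[|[|a]]]]]]] // _; rewrite addSn !u6_big.
- by move=> [|[|[|[|[|[|[|a]]]]]]] [|[|[|[|[|[|[|b]]]]]]] // _ _;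
    rewrite [u6 _.+4.+2]u6_big // [u6 (_.+4.+2 + _)]u6_big.
Qed.

Theorem colorable6 S w m : (forall x, 0 < w x) ->
  sparse e 5 2 u6 0 w m S -> colorable e 6 S w m.
Proof.
apply: sparse_colorable_ind => {}S {}w {}m w_gt0 IH spS nc.
have adm := u6_admissible.
have S0 := not_colorable_neq0 nc.
have p0 := spS S (subxx _) S0.
have ls := loss_le u6_step.
pose F v : int := (2 * charge 5 2 u6 (w v) (m v) - (5 * deg e S v)%:Z)%R.
have le0 v : v \in S -> (F v <= 0)%R /\
    (F v = 0 -> [/\ ~~ m v, w v = 3 & deg e S v = 2])%R.
  move=> vS; have wv := w_gt0 v.
  have [kw|wk] := ltnP 6 (w v).
    have [/negPf mv d1] := indep_deg e_sym e_irr adm w_gt0 IH spS nc vS kw.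
    by rewrite /F /charge mv (u_big adm) //; move: d1; clear; lia.
  have [mv|mv] := boolP (m v).
    have d2 := forced_deg e_sym e_irr adm w_gt0 IH spS nc vS mv.
    have := u_le adm wv; rewrite /F /charge mv; move: (u6 _) d2 => t.
    by rewrite [u6 1]/u6 /=; clear; lia.
  have d2 := free_deg e_sym e_irr w_gt0 IH spS nc vS mv wk.
  rewrite /F /charge (negPf mv).
  move: d2; rewrite leq_eqVlt => /orP[/eqP d2|d3]; last first.
    by have := u_le adm wv; move: (u6 _) d3 => t; rewrite [u6 1]/u6 /=; clear; lia.
  rewrite -d2.
  have [w3|w2] := ltnP 2 (w v).
    move: w3; rewrite leq_eqVlt => /orP[/eqP <-|w4]; first by [].
    by have := u_le adm w4; move: (u6 _) => t; rewrite [u6 4]/u6 /=; clear; lia.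
  have [x [y [xy nv]]] := deg2P (esym d2).
  exfalso; apply: (no_2vertex e_sym e_irr adm w_gt0 IH spS nc vS mv wk nv xy).
  - by have := ls (w v) (w x); move: w2; clear; lia.
  - by have := ls (w v) (w y); move: w2; clear; lia.
  have := ls (w v) (w x); have := ls (w v) (w y).
  have : (0 <= Num.min 2 (pot e 5 2 u6 w m S))%R by rewrite le_min p0.
  move: (Num.min _ _) => p.
  by move: wv w2; case: (w v) => [|[|[|a]]] // _ _; rewrite /u6 /= -/u6;
    move: (u6 _) (u6 _) (u6 _) (u6 _) => a1 a2 a3 a4; clear; lia.
(* The terms are nonpositive with nonnegative sum, so they all vanish and every vertex of [S] is an
   unflagged vertex of weight 3 and degree 2. *)
have all0 v : v \in S -> F v = 0%R.
  move=> vS; apply/eqP; rewrite eq_le (le0 v vS).1 leNgt /=; apply/negP => Fv.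
  have := sum_lt0 vS Fv (fun x xS => (le0 x xS).1).
  by rewrite -pot_handshake //; move: p0; clear; lia.
have [v vS] := set0Pn _ S0.
have [mv wv dv] := (le0 v vS).2 (all0 v vS).
have [x [y [xy nv]]] := deg2P dv.
have wz z : z \in nbrs e S v -> w z = 3.
  by rewrite in_nbrs => /andP[zS _]; have [] := (le0 z zS).2 (all0 z zS).
(* With neighbours of weight exactly 3, each raise costs [u6 3 - u6 6 = 2]; the total 4 fits in the
   budget of at least [10 - 5]. The generic bound of 1 per unit would give 3 for each raise, more
   than [gap2]. *)
apply: (no_2vertex e_sym e_irr adm w_gt0 IH spS nc vS mv _ nv xy); rewrite wv //.
- by rewrite wz // nv !inE eqxx.
- by rewrite wz // nv !inE eqxx orbT.
- rewrite !wz ?nv ?inE ?eqxx ?orbT //.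
  have : (0 <= Num.min 2 (pot e 5 2 u6 w m S))%R by rewrite le_min p0.
  by move: (Num.min _ _) => p; rewrite /u6 /=; clear; lia.
Qed.

End Thresholds.

(** * Reducible configurations of several vertices of weight 1 *)

Section LightReductions.
Variables (T : finType) (e : rel T).
Hypotheses (e_sym : symmetric e) (e_irr : irreflexive e).
Implicit Types (A B D Q R S W : {set T}) (x y v : T) (c : T -> option nat).
Local Notation deg := (deg e).
Local Notation nbrs := (nbrs e).
Variables (k E I : nat) (u : nat -> nat) (theta step gap1 gap2 : int).
Hypothesis adm : admissible k E I u theta step gap1 gap2.
Local Notation sparse := (sparse e E I u theta).
Variables (S : {set T}) (w : T -> nat) (m : pred T).
Hypothesis w_gt0 : forall x, 0 < w x.
Hypothesis IH : forall S' w' m', #|S'| < #|S| -> (forall x, 0 < w' x) ->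
  sparse w' m' S' -> colorable e k S' w' m'.
Hypothesis spS : sparse w m S.
Hypothesis not_col : ~ colorable e k S w m.
Local Notation add_at := (add_at w).

Lemma add_at_le x n A c : coloring e k A (add_at x n) m c -> coloring e k A w m c.
Proof. by apply: coloringW => v _; apply: leq_addr. Qed.

Lemma upd_out A c v o : v \notin A -> forall z, z \in A -> upd c v o z = c z.
Proof. by move=> vA z zA; rewrite /upd; case: eqP zA vA => [-> ->|]. Qed.

(** [v] is in class [t], which has spare room stored at [r]. If [x] is also in [F], both possible
    neighbours of [a] are in [F] and [a] is independent; otherwise [a] joins class [t] and uses up
    one spare unit. *)
Lemma attach Q a v x r n c t : a \notin Q -> w a = 1 -> ~~ m a ->
    coloring e k Q (add_at r n.+1) m c -> r \in Q -> c r = Some t -> c v = Some t ->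
    (forall z, z \in Q -> e a z -> z = v \/ z = x) ->
  exists c', coloring e k (a |: Q)%SET (add_at r n) m c' /\
    forall z, z \in Q -> c' z = c z.
Proof.
move=> aQ wa ma cc rQ cr cv an.
have le z : z \in Q -> add_at r n z <= add_at r n.+1 z.
  by move=> _; rewrite !/(add_at _ _ _); case: eqP; clear; lia.
case cx: (c x) => [s|].
  exists (upd c a None); split; last exact: upd_out.
  apply: (coloring_extI e_sym e_irr aQ cc le) => // z zQ /(an z zQ) [->|->];
  by rewrite ?cv ?cx.
exists (upd c a (Some t)); split; last exact: upd_out.
apply: (coloring_extJ e_sym e_irr aQ cc le rQ cr) => [|z zQ /(an z zQ) [->|->]].
- have ar : a == r = false by apply: contraNF aQ => /eqP ->.
  by rewrite !/(add_at _ _ _) eqxx ar wa addn0 addn1 addnS.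
- by right.
- by left.
Qed.

(** One unit is reserved at [x]. If [x] and [y] are both in [F], then [b] is independent and [a]
    uses that unit. If only one of them is, its neighbour in the pair is independent and the other
    vertex of the pair opens a class. If neither is, [a] and [b] fit in a common new class, or [a]
    is made independent. *)
Lemma no_adjacent2 a b x y : a \in S -> b \in S -> ~~ m a -> ~~ m b ->
    w a = 1 -> w b = 1 -> x != b -> y != a ->
    nbrs S a = [set b; x]%SET -> nbrs S b = [set a; y]%SET -> False.
Proof.
move=> aS bS ma mb wa wb xb ya na nb; apply: not_col.
pose D := [set a; b]%SET; pose Q := (S :\: D)%SET.
have sD : D \subset S by rewrite subUset !sub1set aS.
have D0 : D != set0 by apply/set0Pn; exists a; rewrite !inE eqxx.
have [xS eax] : x \in S /\ e a x by apply/andP; rewrite -in_nbrs na !inE eqxx orbT.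
have [yS eby] : y \in S /\ e b y by apply/andP; rewrite -in_nbrs nb !inE eqxx orbT.
have [_ eab] : b \in S /\ e a b by apply/andP; rewrite -in_nbrs na !inE eqxx.
have xa : x != a by apply: contraTneq eax => ->; rewrite e_irr.
have yb : y != b by apply: contraTneq eby => ->; rewrite e_irr.
have ab : a != b by apply: contraTneq eab => ->; rewrite e_irr.
have xQ : x \in Q by rewrite !inE xS negb_or xa xb.
have bQ : b \notin Q by rewrite !inE eqxx orbT.
have aQ : a \notin (b |: Q)%SET by rewrite !inE eqxx (negPf ab).
have SE : (a |: (b |: Q))%SET = S.
  apply/setP => z; rewrite !inE; have [->|za] := eqVneq z a; first by rewrite aS.
  by have [->|zb] := eqVneq z b; first by rewrite bS.
have bn z : z \in Q -> e b z -> z = y.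
  rewrite !inE negb_or => /andP[/andP[za zb] zS] ebz.
  have : z \in nbrs S b by rewrite in_nbrs zS.
  by rewrite nb !inE (negPf za) => /eqP.
have an z : z \in (b |: Q)%SET -> e a z -> z = b \/ z = x.
  move=> zQ eaz; apply/set2P; rewrite -na in_nbrs eaz -SE !inE.
  by move: zQ; rewrite !inE => ->; rewrite orbT.
have k2 := k_gt1 adm.
have [c cc] : colorable e k Q (add_at x 1) m.
  apply: (color_add1 e_sym e_irr adm w_gt0 IH spS not_col) => //.
  have := u_step adm (w x); have := step_gap1 adm; have := gap1_gap2 adm.
  by rewrite addn1; clear; lia.
have cw := add_at_le cc.
have updb o : upd c b o b = o by rewrite /upd eqxx.
have updx o : upd c b o x = c x by apply: upd_out bQ _ xQ.
rewrite -SE; case cx: (c x) => [s|]; case cy: (c y) => [t|].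
- have cb : coloring e k (b |: Q)%SET (add_at x 1) m (upd c b None).
    by apply: (coloring_extI e_sym e_irr bQ cc) => // z zQ ebz; rewrite (bn z) ?cy.
  exists (upd (upd c b None) a (Some s)).
  have xbQ : x \in (b |: Q)%SET by rewrite inE xQ orbT.
  apply: (coloring_extJ e_sym e_irr aQ cb _ xbQ) => [z _|||z zQ eaz].
  + exact: leq_addr.
  + by rewrite updx.
  + by rewrite !/(add_at _ _ _) eqxx wa.
  + by case: (an z zQ eaz) => ->; [left|right; rewrite updx].
- have [|z zQ ebz||l [cb _]] := coloring_extF e_sym e_irr bQ cw _ _ (_ : w b <= k).
  + by [].
  + by rewrite (bn z).
  + by rewrite wb ltnW.
  exists (upd (upd c b (Some l)) a None).
  apply: (coloring_extI e_sym e_irr aQ cb) => // z zQ eaz.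
  by case: (an z zQ eaz) => ->; rewrite ?updb ?updx ?cx.
- have cb : coloring e k (b |: Q)%SET w m (upd c b None).
    by apply: (coloring_extI e_sym e_irr bQ cw) => // z zQ ebz; rewrite (bn z) ?cy.
  have [|z zQ eaz||l [ca _]] := coloring_extF e_sym e_irr aQ cb _ _ (_ : w a <= k).
  + by [].
  + by case: (an z zQ eaz) => ->; rewrite ?updb ?updx ?cx.
  + by rewrite wa ltnW.
  by exists (upd (upd c b None) a (Some l)).
- have [|z zQ ebz||l [cb _]] := coloring_extF e_sym e_irr bQ cc _ _ (_ : add_at b 1 b <= k).
  + move=> z zQ; rewrite !/(add_at _ _ _); have /negPf -> : z != b by apply: contraNneq bQ => <-.
    by rewrite addn0 leq_addr.
  + by rewrite (bn z).
  + by rewrite !/(add_at _ _ _) eqxx wb.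
  have [||z zQ eaz|c' [cc' _]] := attach (v := b) (x := x) (t := l) aQ wa ma cb (setU11 _ _) _ _ _.
  + by rewrite updb.
  + by rewrite updb.
  + exact: an.
  by exists c'; apply: add_at_le cc'.
Qed.

(** Two units are reserved at [z], the neighbour of [v] other than the light vertices [a] and [b].
    They allow [v] and one of [a], [b] to join the class of [z], which suffices as soon as the other
    one can be independent. *)
Lemma no_3vertex v a b x y z : v \in S -> a \in S -> b \in S -> z \in S ->
    x \in S -> y \in S ->
    ~~ m v -> ~~ m a -> ~~ m b -> w v = 1 -> w a = 1 -> w b = 1 -> 2 < k ->
    ((u (w z))%:Z - (u (w z + 2))%:Z <= gap2 - theta)%R ->
    v != a -> v != b -> a != b ->
    z \notin [set v; a; b]%SET -> x \notin [set v; a; b]%SET ->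
    y \notin [set v; a; b]%SET ->
    (forall t, t \in S -> e v t -> [\/ t = a, t = b | t = z]) ->
    (forall t, t \in S -> e a t -> t = v \/ t = x) ->
    (forall t, t \in S -> e b t -> t = v \/ t = y) -> False.
Proof.
move=> vS aS bS zS xS yS mv ma mb wv wa wb k2 lz va vb ab zD xD yD nv na nb.
apply: not_col; pose D := [set v; a; b]%SET; pose Q := (S :\: D)%SET.
have sD : D \subset S by rewrite !subUset !sub1set vS aS bS.
have D0 : D != set0 by apply/set0Pn; exists v; rewrite !inE eqxx.
have zQ : z \in Q by rewrite inE zD.
have xQ : x \in Q by rewrite inE xD.
have yQ : y \in Q by rewrite inE yD.
pose Q1 := (v |: Q)%SET; pose Q2 := (a |: Q1)%SET.
have vQ : v \notin Q by rewrite !inE eqxx.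
have aQ : a \notin Q1 by rewrite !inE eqxx eq_sym (negPf va) orbT.
have bQ : b \notin Q2.
  by rewrite !inE eqxx [b == a]eq_sym [b == v]eq_sym (negPf ab) (negPf vb) !orbT.
have SE : (b |: Q2)%SET = S.
  apply/setP => t; rewrite !inE; have [->|tb] := eqVneq t b; first by rewrite bS.
  have [->|ta] := eqVneq t a; first by rewrite aS.
  by have [->|tv] := eqVneq t v; first by rewrite vS.
have sQ2 : Q2 \subset S by rewrite -SE subsetUr.
have sQ1 : Q1 \subset S by apply: subset_trans sQ2; rewrite subsetUr.
have sQ : Q \subset S by rewrite subsetDl.
have nv' t : t \in Q -> e v t -> t = z.
  move=> tQ evt; move: (tQ); rewrite !inE !negb_or => /andP[/andP[/andP[_ ta] tb] _].
  by case: (nv t (subsetP sQ _ tQ) evt) => // tE; move: ta tb; rewrite tE eqxx.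
have na' t : t \in Q1 -> e a t -> t = v \/ t = x.
  by move=> tQ; apply: na; apply: (subsetP sQ1).
have nb' t : t \in Q2 -> e b t -> t = v \/ t = y.
  by move=> tQ; apply: nb; apply: (subsetP sQ2).
have yQ1 : y \in Q1 by rewrite inE yQ orbT.
have zQ1 : z \in Q1 by rewrite inE zQ orbT.
have zQ2 : z \in Q2 by rewrite inE zQ1 orbT.
have vQ1 : v \in Q1 by rewrite setU11.
have vQ2 : v \in Q2 by rewrite inE vQ1 orbT.
have [c cc] : colorable e k Q (add_at z 2) m.
  exact: (color_add1 e_sym e_irr adm w_gt0 IH spS not_col).
have U c' o t : t \in Q -> upd c' v o t = c' t by apply: upd_out.
have Uv c' o : upd c' v o v = o by rewrite /upd eqxx.
have k1 : 1 <= k by apply: leq_trans k2.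
(* If [z] is independent, [v] opens a class with two spare units, one for each of [a] and [b]; this
   takes [2 < k]. *)
rewrite -SE; case cz: (c z) => [l|]; last first.
  have [|t tQ evt||l [cv _]] := coloring_extF e_sym e_irr vQ cc _ _ (_ : add_at v 2 v <= k).
  - move=> t tQ; rewrite !/(add_at _ _ _); have /negPf -> : t != v by apply: contraNneq vQ => <-.
    by rewrite addn0 leq_addr.
  - by rewrite (nv' t).
  - by rewrite !/(add_at _ _ _) eqxx wv.
  have [||t|c1 [cc1 e1]] := attach (v := v) (x := x) (t := l) aQ wa ma cv vQ1 _ _ _.
  - by rewrite Uv.
  - by rewrite Uv.
  - exact: na'.
  have [||t|c2 [cc2 _]] := attach (v := v) (x := y) (t := l) bQ wb mb cc1 vQ2 _ _ _.
  - by rewrite e1 // Uv.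
  - by rewrite e1 // Uv.
  - exact: nb'.
  by exists c2; apply: add_at_le cc2.
(* If [z] is in [F], [v] joins its class and one unit remains. If [x] is in [F] then [a] is
   independent and [b] gets the unit, and symmetrically for [y]. *)
have cJ : coloring e k Q1 (add_at z 1) m (upd c v (Some l)).
  apply: (coloring_extJ e_sym e_irr vQ cc _ zQ cz) => [t tQ||t tQ evt].
  - by rewrite !/(add_at _ _ _) leq_add2l; case: eqP.
  - have /negPf vz : v != z by apply: contraNneq vQ => ->.
    by rewrite !/(add_at _ _ _) eqxx vz wv -addnA.
  - by right; rewrite (nv' t).
case cx: (c x) => [s|].
  have ca : coloring e k Q2 (add_at z 1) m (upd (upd c v (Some l)) a None).
    apply: (coloring_extI e_sym e_irr aQ cJ) => // t tQ eat.
    by case: (na' t tQ eat) => ->; rewrite ?Uv ?U ?cx.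
  have Ua := upd_out (upd c v (Some l)) None aQ.
  have [||t|c2 [cc2 _]] := attach (v := v) (x := y) (t := l) bQ wb mb ca zQ2 _ _ _.
  - by rewrite Ua // U // cz.
  - by rewrite Ua // Uv.
  - exact: nb'.
  by exists c2; apply: add_at_le cc2.
case cy: (c y) => [s|].
  have [||t|c1 [cc1 e1]] := attach (v := v) (x := x) (t := l) aQ wa ma cJ zQ1 _ _ _.
  - by rewrite U // cz.
  - by rewrite Uv.
  - exact: na'.
  exists (upd c1 b None).
  apply: (coloring_extI e_sym e_irr bQ cc1) => // [t tQ|t tQ ebt]; first exact: leq_addr.
  by case: (nb' t tQ ebt) => ->; rewrite e1 // ?Uv // U // cy.
(* Here [x] and [y] are both independent, so [v] is made independent instead and [a] and [b] open
   their own classes. *)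
have cv : coloring e k Q1 w m (upd c v None).
  apply: (coloring_extI e_sym e_irr vQ cc) => // [t tQ|t tQ evt]; first exact: leq_addr.
  by rewrite (nv' t) // cz.
have [|t tQ eat||l1 [ca _]] := coloring_extF e_sym e_irr aQ cv _ _ (_ : w a <= k).
- by [].
- by case: (na' t tQ eat) => ->; rewrite ?Uv ?U.
- by rewrite wa.
have Ua := upd_out (upd c v None) (Some l1) aQ.
have [|t tQ ebt||l2 [cb _]] := coloring_extF e_sym e_irr bQ ca _ _ (_ : w b <= k).
- by [].
- by case: (nb' t tQ ebt) => ->; rewrite Ua // ?Uv // U.
- by rewrite wb.
by exists (upd (upd (upd c v None) a (Some l1)) b (Some l2)).
Qed.

End LightReductions.

(** * Discharging for components of order at most 3 *)

Section ThresholdThree.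
Variables (T : finType) (e : rel T).
Hypotheses (e_sym : symmetric e) (e_irr : irreflexive e).
Implicit Types (S : {set T}) (w : T -> nat) (m : pred T).

Definition u3 := nth 2 [:: 9; 9; 6; 4].

Lemma u3_big a : 3 < a -> u3 a = 2.
Proof. by move: a => [|[|[|[|a]]]]; rewrite /u3 //= nth_nil. Qed.

Lemma u3_admissible : admissible 3 7 2 u3 (-2)%R 3 1 3.
Proof.
split => //.
- by move=> [|[|[|[|a]]]] //; rewrite !u3_big.
- exact: u3_big.
- by move=> [|[|[|[|a]]]] //; rewrite !u3_big.
- by move=> [|[|[|[|a]]]] // _; rewrite addSn !u3_big.
- by move=> [|[|[|[|a]]]] [|[|[|[|b]]]] // _ _;
    rewrite [u3 _.+4]u3_big // [u3 (_.+4 + _)]u3_big.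
Qed.

Lemma u3_step a : 0 < a -> u3 a <= u3 a.+1 + (if a == 1 then 3 else 2).
Proof. by move: a => [|[|[|[|a]]]] // _; rewrite !u3_big. Qed.

Lemma u3_step2 a : u3 a <= u3 (a + 2) + 5.
Proof. by move: a => [|[|[|[|a]]]] //; rewrite addSn !u3_big. Qed.

Lemma unit_class_weight S w c (a : nat) (X : {set T}) :
    {in S, forall v, w v = 1} ->
    (forall v, v \in S -> c v = Some a -> v \in X) -> #|X| <= 3 ->
  class_weight S w c a <= 3.
Proof.
move=> w1 sX; apply: leq_trans.
rewrite /class_weight (eq_bigr (fun=> 1)) => [|v /andP[/w1 //]].
rewrite sum1_card; apply/subset_leq_card/subsetP => v; rewrite unfold_in.
by move=> /andP[vS /eqP]; apply: sX.
Qed.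

Lemma sum_le_neg (A : {set T}) (F : T -> int) :
  {in A, forall v, (F v <= -1)%R} -> (\sum_(v in A) F v <= - (#|A|%:Z))%R.
Proof.
move=> h; apply: le_trans (ler_sum _ h) _.
by rewrite sumr_const mulNrn lerN2 natz.
Qed.

Lemma deg2_other S v x : deg e S v = 2 -> x \in nbrs e S v ->
  exists y, y != x /\ nbrs e S v = [set x; y]%SET.
Proof.
move=> /deg2P [a [b [ab nv]]]; rewrite nv => /set2P[->|->].
  by exists b; rewrite eq_sym.
by exists a; rewrite setUC.
Qed.

(** Vertices of [D] have charge [2 * 9 - 2 * 7 = 4] and send 2 to each neighbour, both in [B]. The
    final charges on [B] are at most -1 each and sum to twice the potential of [S], at least -4; so
    [B] has at most four vertices. *)
Theorem colorable3 S w m : (forall x, 0 < w x) ->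
  sparse e 7 2 u3 (-2)%R w m S -> colorable e 3 S w m.
Proof.
apply: sparse_colorable_ind => {}S {}w {}m w_gt0 IH spS nc.
have adm := u3_admissible.
have S0 := not_colorable_neq0 nc.
have pS := spS S (subxx _) S0.
have irrS v x : x \in nbrs e S v -> x != v.
  by rewrite in_nbrs => /andP[_]; apply: contraTneq => ->; rewrite e_irr.
have memS v x : x \in nbrs e S v -> x \in S by rewrite in_nbrs => /andP[].
pose D := [set v in S | [&& ~~ m v, w v == 1 & deg e S v == 2]]%SET.
pose B := (S :\: D)%SET.
have DP v : v \in D -> [/\ v \in S, ~~ m v, w v = 1 & deg e S v = 2].
  by rewrite inE => /and4P[-> -> /eqP -> /eqP ->].
have sDS : D \subset S by apply/subsetP => v /DP[].
have dDB : [disjoint D & B] by rewrite -setI_eq0 /B setDE setICA setICr setI0.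
have SE : S = (D :|: B)%SET.
  apply/setP => x; rewrite in_setU [x \in B]in_setD.
  by case xD: (x \in D) => //=; rewrite (subsetP sDS).
have BP v : v \in B -> v \in S /\ v \notin D by rewrite inE => /andP[].
(* In [no_2vertex] the budget is at least [-2 - 9 + 14 + 2 = 5]. Raising a neighbour of weight 1
   costs 3 and a heavier one at most 2, so only two neighbours of weight 1 exceed it. *)
have D_w1 v x : v \in D -> x \in nbrs e S v -> w x = 1.
  move=> /DP[vS mv wv dv] xv; have [y [yx nv]] := deg2_other dv xv.
  apply/eqP; apply: contrapT => /negP wx.
  have := @no_2vertex _ _ e_sym e_irr _ _ _ _ _ _ _ _ adm _ _ _ w_gt0 IH spS nc v x y vS mv.
  rewrite wv eq_sym yx nv; apply=> //.
  - by have := u3_step (w_gt0 x); rewrite addn1; case: ifP; clear; lia.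
  - by have := u3_step (w_gt0 y); rewrite addn1; case: ifP; clear; lia.
  have : (-2 <= Num.min 3 (pot e 7 2 u3 w m S))%R by rewrite le_min pS.
  move: (Num.min _ _) => p.
  have := u3_step (w_gt0 x); have := u3_step (w_gt0 y); rewrite (negPf wx) !addn1.
  by case: ifP; rewrite [u3 1]/u3 /=; clear; lia.
have D_indep v x : v \in D -> x \in D -> ~~ e v x.
  move=> vD xD; apply/negP => evx.
  have [vS mv wv dv] := DP v vD; have [xS mx wx dx] := DP x xD.
  have xv : x \in nbrs e S v by rewrite in_nbrs xS.
  have vx : v \in nbrs e S x by rewrite in_nbrs vS e_sym.
  have [y [yx nv]] := deg2_other dv xv; have [z [zv nx]] := deg2_other dx vx.
  exact: (no_adjacent2 e_sym e_irr adm w_gt0 IH spS nc vS xS mv mx wv wx yx zv nv nx).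
have degE' v : deg e S v = deg e D v + deg e B v by rewrite {1}SE degU.
have D_deg v : v \in D -> deg e D v = 0 /\ deg e B v = 2.
  move=> vD; have [_ _ _] := DP v vD; rewrite degE'.
  suff -> : deg e D v = 0 by [].
  apply/eqP; rewrite cards_eq0; apply/eqP/setP => x; rewrite in_nbrs in_set0.
  by apply/negbTE/negP => /andP[/(D_indep v x vD)/negP].
(* Two neighbours in [D] would form the configuration of [no_3vertex]; independence of [D] keeps
   their other neighbours outside it. *)
have B3 v : v \in B -> ~~ m v -> w v = 1 -> deg e S v = 3 -> deg e D v <= 1.
  move=> /BP[vS vD] mv wv dv; rewrite leqNgt; apply/negP => d2.
  have /card_gt0P[a aN] : 0 < deg e D v by apply: ltnW.
  have : 0 < #|nbrs e D v :\ a|%SET.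
    by move: d2; rewrite /deg (cardsD1 a) aN.
  case/card_gt0P => b; rewrite in_setD1 => /andP[ba bN].
  have aN' : a \in nbrs e S v.
    by move: aN; rewrite !in_nbrs => /andP[/(subsetP sDS) -> ->].
  have bN' : b \in nbrs e S v.
    by move: bN; rewrite !in_nbrs => /andP[/(subsetP sDS) -> ->].
  have /eqP/cards1P[z zE] : #|nbrs e S v :\ a :\ b|%SET = 1.
    have bN2 : b \in (nbrs e S v :\ a)%SET by rewrite in_setD1 ba.
    have := dv; rewrite /deg (cardsD1 a (nbrs e S v)) aN'.
    by rewrite (cardsD1 b (nbrs e S v :\ a)%SET) bN2; clear; lia.
  have /andP[zb /andP[za zN]] : [&& z != b, z != a & z \in nbrs e S v].
    by have := set11 z; rewrite -zE !inE => /and4P[-> -> -> ->].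
  have aD : a \in D by move: aN; rewrite in_nbrs => /andP[].
  have bD : b \in D by move: bN; rewrite in_nbrs => /andP[].
  have [aS ma wa da] := DP a aD; have [bS mb wb db] := DP b bD.
  have va : v \in nbrs e S a by rewrite in_nbrs vS e_sym; move: aN; rewrite in_nbrs => /andP[].
  have vb : v \in nbrs e S b by rewrite in_nbrs vS e_sym; move: bN; rewrite in_nbrs => /andP[].
  have [x [xv na]] := deg2_other da va; have [y [yv nb]] := deg2_other db vb.
  have xa : x \in nbrs e S a by rewrite na !inE eqxx orbT.
  have yb : y \in nbrs e S b by rewrite nb !inE eqxx orbT.
  have xB : x != b.
    apply: contraTneq xa => ->; rewrite in_nbrs negb_and; apply/orP; right.
    exact: D_indep.
  have yA : y != a.
    apply: contraTneq yb => ->; rewrite in_nbrs negb_and; apply/orP; right.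
    exact: D_indep.
  apply: (no_3vertex e_sym e_irr adm w_gt0 IH spS nc vS aS bS (memS _ _ zN)
    (memS _ _ xa) (memS _ _ yb) mv ma mb wv wa wb) => //.
  - by have := u3_step2 (w z); clear; lia.
  - by rewrite eq_sym irrS.
  - by rewrite eq_sym irrS.
  - by rewrite eq_sym.
  - by rewrite !inE !negb_or irrS //= za zb.
  - by rewrite !inE !negb_or xv irrS.
  - by rewrite !inE !negb_or yv yA irrS.
  - move=> t tS evt; have [->|ta] := eqVneq t a; first exact: Or31.
    have [->|tb] := eqVneq t b; first exact: Or32.
    by apply: Or33; apply/set1P; rewrite -zE !inE ta tb tS.
  - by move=> t tS eat; apply/set2P; rewrite -na in_nbrs tS.
  - by move=> t tS eat; apply/set2P; rewrite -nb in_nbrs tS.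
pose G v : int := (2 * charge 7 2 u3 (w v) (m v) - (7 * deg e S v)%:Z
  + (2 * deg e D v)%:Z)%R.
have sumG : (- 4 <= \sum_(v in B) G v)%R.
  have -> : (\sum_(v in B) G v = 2 * pot e 7 2 u3 w m S)%R.
    have sumS (F : T -> int) :
        (\sum_(v in S) F v = \sum_(v in D) F v + \sum_(v in B) F v)%R.
      by rewrite -sumz_disjU // -SE.
    rewrite pot_handshake // sumS.
    have -> : (\sum_(v in D) (2 * charge 7 2 u3 (w v) (m v) - (7 * deg e S v)%:Z)
        = \sum_(v in D) (2 * deg e B v)%:Z)%R.
      apply: eq_bigr => v vD; have [_ /negPf mv wv dv] := DP v vD.
      by have [_ ->] := D_deg v vD; rewrite /charge mv wv dv.
    have -> : (\sum_(v in D) (2 * deg e B v)%:Z = (2 * crossing e D B)%:Z)%R.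
      by rewrite /crossing big_distrr /= (big_morph Posz PoszD (erefl _)).
    rewrite crossingC //.
    have -> : ((2 * crossing e B D)%:Z = \sum_(v in B) (2 * deg e D v)%:Z)%R.
      by rewrite /crossing big_distrr /= (big_morph Posz PoszD (erefl _)).
    by rewrite -big_split /=; apply: eq_bigr => v _; rewrite /G addrC.
  by move: pS; clear; lia.
have w2D v : v \in B -> 1 < w v -> deg e D v = 0.
  move=> /BP[vS _] wv; apply/eqP; rewrite cards_eq0; apply/eqP/setP => x.
  rewrite in_nbrs in_set0; apply/negbTE/negP => /andP[xD evx].
  by move: wv; rewrite (D_w1 x v xD) // in_nbrs vS e_sym.
have Gw2 v : v \in B -> 1 < w v ->
    [/\ ~~ m v -> (G v <= -2)%R, m v -> (G v <= -5)%R
      & (-2 <= G v)%R -> 1 < deg e B v].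
  move=> vB wv; have [vS vD] := BP v vB.
  have d0 := w2D v vB wv; rewrite /G d0 degE' d0 add0n.
  have [kw|wk] := ltnP 3 (w v).
    have [/negPf mv d1] := indep_deg e_sym e_irr adm w_gt0 IH spS nc vS kw.
    rewrite /charge mv u3_big //; move: d1; rewrite degE' d0 add0n.
    by clear; split; lia.
  have [mv|mv] := boolP (m v).
    have := forced_deg e_sym e_irr adm w_gt0 IH spS nc vS mv; rewrite degE' d0 add0n.
    have := u_le adm wv; rewrite /charge; move: (u3 _) => t.
    by rewrite [u3 2]/u3 /=; clear; split; lia.
  have := free_deg e_sym e_irr w_gt0 IH spS nc vS mv wk; rewrite degE' d0 add0n.
  have := u_le adm wv; rewrite /charge; move: (u3 _) => t.
  by rewrite [u3 2]/u3 /=; clear; split; lia.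
have Gw1 v : v \in B -> w v = 1 -> (G v <= -1)%R /\
    ((-1 <= G v)%R -> [/\ ~~ m v, deg e D v = 1 & deg e B v = 2]).
  move=> vB wv; have [vS vD] := BP v vB; rewrite /G /charge wv [u3 1]/u3 /=.
  have dS := degE' v.
  have [mv|mv] := boolP (m v).
    have := forced_deg e_sym e_irr adm w_gt0 IH spS nc vS mv.
    by move: dS; clear; split; lia.
  have wk : w v <= 3 by rewrite wv.
  have := free_deg e_sym e_irr w_gt0 IH spS nc vS mv wk.
  rewrite leq_eqVlt => /orP[/eqP d2|].
    by case/negP: vD; rewrite inE vS mv wv -d2.
  rewrite leq_eqVlt => /orP[/eqP d3|].
    have := B3 v vB mv wv (esym d3); move: d3 dS; clear => d3 dS d1; split; first by lia.
    by move=> h; split=> //; lia.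
  by move: dS; clear => dS d4; split; lia.
have Gle v : v \in B -> (G v <= -1)%R.
  move=> vB; have := w_gt0 v; rewrite leq_eqVlt => /orP[/eqP wv|wv].
    by case: (Gw1 v vB (esym wv)).
  have [] := Gw2 v vB wv; case: (m v) => /= h1 h2 _.
    by apply: le_trans (h2 isT) _.
  by apply: le_trans (h1 isT) _.
have sumGD v : v \in B -> (\sum_(t in B) G t <= G v + 1 - #|B|%:Z)%R.
  move=> vB; rewrite (big_setD1 v vB) /= (cardsD1 v B) vB.
  have : (\sum_(t in B :\ v) G t <= - (#|(B :\ v)%SET|%:Z))%R.
    by apply: sum_le_neg => t; rewrite inE => /andP[_ /Gle].
  by move: (\sum_(t in B :\ v) G t)%R; clear; lia.
have D_m t : t \in D -> ~~ m t by case/DP.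
have D_w t : t \in D -> w t = 1 by case/DP.
have inS t : t \in S -> t \in D \/ t \in B by rewrite {1}SE inE => /orP.
have BnD t : t \in B -> t \in D = false by move=> /BP[_ /negPf].
have [/exists_inP[b0 b0B wb0]|nw] := boolP [exists b in B, 1 < w b].
  have [Gf Gm Gd] := Gw2 b0 b0B wb0.
  have sb0 := sumGD b0 b0B.
  have B1 : 0 < #|B| by apply/card_gt0P; exists b0.
  have mb0 : ~~ m b0.
    by apply/negP => /Gm; move: sumG sb0 B1; move: (\sum_(t in B) G t)%R; clear; lia.
  have cB : #|B| <= 3.
    by move: (Gf mb0) sumG sb0 B1; move: (\sum_(t in B) G t)%R; clear; lia.
  have rest t : t \in B -> t != b0 -> w t = 1.
    move=> tB tb0; apply/eqP; rewrite eqn_leq w_gt0 andbT leqNgt; apply/negP => wt.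
    have [Gf' Gm' _] := Gw2 t tB wt.
    have Gt : (G t <= -2)%R.
      by case: (m t) Gf' Gm' => /= h1 h2; [apply: le_trans (h2 isT) _|apply: h1].
    have tB' : t \in (B :\ b0)%SET by apply/setD1P.
    have : (\sum_(t in B) G t <= G b0 + G t + 2 - #|B|%:Z)%R.
      rewrite (big_setD1 b0 b0B) /= (big_setD1 t tB') /= (cardsD1 b0 B) b0B.
      rewrite (cardsD1 t (B :\ b0)%SET) tB'.
      have : (\sum_(s in B :\ b0 :\ t) G s <= - (#|(B :\ b0 :\ t)%SET|%:Z))%R.
        by apply: sum_le_neg => s /setD1P[_ /setD1P[_ /Gle]].
      by move: (\sum_(s in B :\ b0 :\ t) G s)%R; clear; lia.
    have c2 : 1 < #|B|.
      by rewrite (cardsD1 b0) b0B (cardsD1 t) tB'.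
    (* A second heavy vertex brings the sum below -4: either [G b0 <= -3], or [G b0 = -2], in which
       case [b0] has two neighbours in [B] and [B] has at least three vertices. *)
    have [Gb0|Gb0] := lerP (-2)%R (G b0); last first.
      by move: Gb0 Gt sumG c2; move: (\sum_(t in B) G t)%R; clear; lia.
    have := Gd Gb0.
    have : deg e B b0 < #|B|.
      rewrite (cardsD1 b0) b0B add1n ltnS; apply/subset_leq_card/subsetP => s.
      rewrite in_nbrs => /andP[sB es]; apply/setD1P; split=> //.
      by apply: contraTneq es => ->; rewrite e_irr.
    by move: Gb0 (Gf mb0) Gt sumG; move: (\sum_(t in B) G t)%R; clear; lia.
  (* A heavy vertex has no neighbour in [D], so [D] together with [b0] is independent; the rest of
     [B] consists of at most two vertices of weight 1, which share one class. *)
  apply: nc; exists (fun t => if t \in (B :\ b0)%SET then Some 0 else None).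
  have b0D t : t \in D -> ~~ e t b0 /\ ~~ e b0 t.
    move=> tD; have h : ~~ e t b0.
      apply/negP => et; have := w2D b0 b0B wb0; move/eqP; rewrite cards_eq0.
      by move/eqP/setP/(_ t); rewrite in_nbrs tD e_sym et in_set0.
    by rewrite -[e b0 t]e_sym.
  have cl t : t \in S -> (t \in (B :\ b0)%SET) = (t \notin D) && (t != b0).
    by move=> tS; rewrite in_setD1 in_setD tS andbT andbC.
  split.
  - move=> s t sS tS est; rewrite !cl //.
    have [sD|sD] := boolP (s \in D); have [tD|tD] := boolP (t \in D) => //=.
    + by have := D_indep s t sD tD; rewrite est.
    + by have [tb|//] := eqVneq t b0; have [] := b0D s sD; rewrite -tb est.
    + by have [sb|//] := eqVneq s b0; have [_] := b0D t tD; rewrite -sb est.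
    + have [sb|_] := eqVneq s b0; have [tb|_] := eqVneq t b0 => //=.
      by move: est; rewrite sb tb e_irr.
  - move=> t tS mt; rewrite cl // (contraL (D_m t)) //=.
    by have [tb|//] := eqVneq t b0; rewrite -tb mt in mb0.
  - move=> a; rewrite /class_weight.
    rewrite (eq_bigl (fun t => (t \in (B :\ b0)%SET) && (a == 0))); last first.
      move=> t; case: ifP => tB; last by rewrite andbF.
      rewrite eqE /= [0 == a]eq_sym; case: (a == 0); rewrite ?andbF // andbT.
      by move: tB => /setD1P[_ /BP[->]].
    apply: leq_trans (_ : \sum_(t in B :\ b0) 1 <= 3).
      rewrite big_mkcondr /=; apply: leq_sum => t /setD1P[tb tB].
      by case: ifP => // _; rewrite rest.
    rewrite sum1_card; move: cB; rewrite (cardsD1 b0) b0B; clear; lia.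
have w1 t : t \in S -> w t = 1.
  move=> /inS[/D_w //|tB]; apply/eqP; rewrite eqn_leq w_gt0 andbT leqNgt.
  by apply: contra nw => wt; apply/exists_inP; exists t.
have [cB|cB] := leqP #|B| 3.
  apply: nc; exists (fun t => if t \in B then Some 0 else None); split.
  - move=> s t /inS[sD|sB] /inS[tD|tB] est.
    + by have := D_indep s t sD tD; rewrite est.
    + by rewrite tB; case: ifP.
    + by rewrite sB; case: ifP.
    + by rewrite sB tB.
  - by move=> t /inS[/D_m/negPf->//|->].
  - move=> a; apply: (unit_class_weight (X := B)) => // t tS.
    by case: ifP.
(* Four vertices use up the whole deficit, so each final charge is exactly -1. Then [B] induces a
   2-regular graph, a 4-cycle through [b1], [b2], [b3], [b4], and each of its vertices has one
   neighbour in [D]. *)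
have B4 : forall b, b \in B -> (-1 <= G b)%R /\ #|B| = 4.
  move=> b bB; have := sumGD b bB; have := Gle b bB.
  by move: sumG cB; move: (\sum_(t in B) G t)%R; clear; lia.
have Bfull b : b \in B -> [/\ ~~ m b, deg e D b = 1 & deg e B b = 2].
  move=> bB; have [Gb _] := B4 b bB.
  have wb := w1 b (proj1 (BP b bB)).
  exact: (proj2 (Gw1 b bB wb)).
have /card_gt0P[b1 b1B] : 0 < #|B| by apply: leq_trans cB.
have c4 := (B4 b1 b1B).2.
have [b2 [b4 [b24 n1]]] := deg2P (let: And3 _ _ h := Bfull b1 b1B in h).
have /andP[b2B e12] : (b2 \in B) && e b1 b2 by rewrite -in_nbrs n1 !inE eqxx.
have /andP[b4B e14] : (b4 \in B) && e b1 b4 by rewrite -in_nbrs n1 !inE eqxx orbT.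
have b12 : b1 != b2 by apply: contraTneq e12 => ->; rewrite e_irr.
have b14 : b1 != b4 by apply: contraTneq e14 => ->; rewrite e_irr.
pose X := [set b1; b2; b4]%SET.
have cX : #|X| = 3.
  by rewrite /X setUC cardsU1 cards2 !inE b12 negb_or eq_sym b14 eq_sym b24.
have sX : X \subset B by rewrite !subUset !sub1set b1B b2B b4B.
have /eqP/cards1P[b3 b3E] : #|(B :\: X)%SET| = 1.
  have := cardsID X B; rewrite (setIidPr sX) cX c4; clear; lia.
have /andP[b3X b3B] : (b3 \notin X) && (b3 \in B).
  by have := set11 b3; rewrite -b3E inE.
have BE t : t \in B -> [\/ t = b1, t = b2, t = b3 | t = b4].
  move=> tB; have [tX|tX] := boolP (t \in X).
    move: tX; rewrite !inE => /orP[/orP[]|] /eqP ->.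
    - exact: Or41.
    - exact: Or42.
    - exact: Or44.
  by apply: Or43; apply/set1P; rewrite -b3E inE tX.
move: (b3X); rewrite !inE !negb_or => /andP[/andP[b31 b32] b34].
have e13 : ~~ e b1 b3.
  apply/negP => e13; have : b3 \in nbrs e B b1 by rewrite in_nbrs b3B.
  by rewrite n1 !inE (negPf b32) (negPf b34).
have n3 : nbrs e B b3 = [set b2; b4]%SET.
  apply/eqP; rewrite eqEcard cards2 b24; have [_ _] := Bfull b3 b3B.
  rewrite /deg => ->; rewrite andbT; apply/subsetP => t; rewrite in_nbrs.
  case/andP => /BE[] ->; rewrite !inE ?eqxx ?orbT //.
    by rewrite e_sym (negPf e13).
  by rewrite e_irr.
have /andP[_ e32] : (b2 \in B) && e b3 b2 by rewrite -in_nbrs n3 !inE eqxx.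
have e24 : ~~ e b2 b4.
  apply/negP => e24; have [_ _] := Bfull b2 b2B.
  have : #|[set b1; b3; b4]%SET| <= deg e B b2.
    apply/subset_leq_card/subsetP => t.
    by case/setUP => [/set2P[]|/set1P] ->; rewrite in_nbrs ?b1B ?b3B ?b4B // e_sym.
  rewrite setUC cardsU1 cards2 !inE negb_or [b1 == b3]eq_sym b31.
  by rewrite [b4 == b1]eq_sym b14 [b4 == b3]eq_sym b34 => /[swap] ->.
(* The opposite vertices [b1] and [b3] are independent, while [b2] and [b4] get separate classes. A
   vertex of [D] joins the class of the only one of [b2], [b4] it sees, is independent if it sees
   both, and otherwise, being adjacent to both [b1] and [b3], goes to a third class. *)
apply: nc; pose f t := match e t b2, e t b4 with
  | true, true => None | true, false => Some 0 | false, true => Some 1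
  | false, false => Some 2 end.
pose c t := if t \in D then f t else if t == b2 then Some 0
  else if t == b4 then Some 1 else None.
have c1 : c b1 = None by rewrite /c BnD // (negPf b12) (negPf b14).
have c2 : c b2 = Some 0 by rewrite /c BnD // eqxx.
have c3 : c b3 = None by rewrite /c BnD // (negPf b32) (negPf b34).
have c4' : c b4 = Some 1 by rewrite /c BnD // eq_sym (negPf b24) eqxx.
have cD s t : s \in D -> t \in B -> e s t -> compat (c s) (c t).
  move=> sD tB est; rewrite {1}/c sD /f.
  have full : e s b2 -> e s b4 -> t = b2 \/ t = b4.
    move=> es2 es4; apply/set2P.
    have [_ d2] := D_deg s sD.
    have : [set b2; b4]%SET \subset nbrs e B s.
      by rewrite subUset !sub1set !in_nbrs b2B b4B es2 es4.
    move=> h; have /eqP -> : [set b2; b4]%SET == nbrs e B s.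
      by rewrite eqEcard h cards2 b24 /= -/(deg e B s) d2.
    by rewrite in_nbrs tB.
  case es2: (e s b2) full; case es4: (e s b4) => /= full.
  - by case: (full isT isT) => ->; rewrite ?c2 ?c4'.
  - by case: (BE t tB) est => ->; rewrite ?c1 ?c2 ?c3 ?es4.
  - by case: (BE t tB) est => ->; rewrite ?c1 ?c4' ?c3 ?es2.
  - by case: (BE t tB) est => ->; rewrite ?c1 ?es2 ?c3 ?es4.
exists c; split.
- move=> s t /inS[sD|sB] /inS[tD|tB] est.
  + by have := D_indep s t sD tD; rewrite est.
  + exact: cD.
  + by rewrite compatC; apply: cD => //; rewrite e_sym.
  + move: est; case: (BE s sB) => ->; case: (BE t tB) => ->;
      rewrite ?c1 ?c2 ?c3 ?c4' ?e_irr ?(negPf e13) ?(negPf e24) //.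
    * by rewrite e_sym (negPf e13).
    * by rewrite e_sym (negPf e24).
- by move=> t /inS[/D_m/negPf->//|/Bfull[/negPf->]].
- have degD b : b \in B -> #|nbrs e D b| = 1 by case/Bfull.
  move=> a; case: a => [|[|a]].
  + apply: (unit_class_weight (X := (b2 |: nbrs e D b2)%SET)) => // [t tS|].
      rewrite /c in_setU1 in_nbrs; case: (t \in D); last first.
        by case: eqP => //; case: eqP.
      by rewrite /f; rewrite [e b2 t]e_sym; case: (e t b2); case: (e t b4); rewrite ?orbT.
    by rewrite (leq_trans (leq_card_setU _ _).1) // cards1 degD.
  + apply: (unit_class_weight (X := (b4 |: nbrs e D b4)%SET)) => // [t tS|].
      rewrite /c in_setU1 in_nbrs; case: (t \in D); last first.
        by case: eqP => //; case: eqP.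
      by rewrite /f; case: (e t b2); rewrite [e b4 t]e_sym; case: (e t b4); rewrite ?orbT.
    by rewrite (leq_trans (leq_card_setU _ _).1) // cards1 degD.
  + apply: (unit_class_weight (X := nbrs e D b1)) => // [t tS|].
      rewrite /c; case: ifP => tD; last by case: eqP => //; case: eqP.
      rewrite /f; case et2: (e t b2); case et4: (e t b4) => // _.
      rewrite in_nbrs tD /= e_sym; apply/negPn/negP => et1.
      have [_ d2] := D_deg t tD.
      have : nbrs e B t \subset [set b3]%SET.
        apply/subsetP => s; rewrite in_nbrs => /andP[/BE[] ->]; rewrite inE //.
        * by rewrite (negPf et1).
        * by rewrite et2.
        * by rewrite et4.
      by move/subset_leq_card; rewrite cards1 -/(deg e B t) d2.
    by rewrite degD.
Qed.

End ThresholdThree.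

(** * Cycle spaces and Euler's bound *)

Lemma F2_addxx (x : 'F_2) : (x + x = 0)%R.
Proof. exact: (addrr_pchar2 (pchar_Fp (isT : prime 2))). Qed.

Lemma F2_add_eq (x y : 'F_2) : (x + y = 0)%R -> x = y.
Proof. by move=> xy; rewrite -[LHS]addr0 -(F2_addxx y) addrA xy add0r. Qed.

Section EdgeCount.
Variables (T : finType) (e : rel T).
Hypotheses (e_sym : symmetric e) (e_irr : irreflexive e).

Definition lt_rank (x y : T) : bool := enum_rank x < enum_rank y.

Definition arcs (R : {set T}) : {set T * T} :=
  [set p | [&& p.1 \in R, p.2 \in R, e p.1 p.2 & lt_rank p.1 p.2]]%SET.

Lemma lt_rank_total x y : x != y -> lt_rank x y = ~~ lt_rank y x.
Proof.
move=> xy; rewrite /lt_rank -leqNgt ltn_neqAle.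
by rewrite (inj_eq val_inj) (inj_eq enum_rank_inj) xy.
Qed.

Lemma card_arcs R : crossing e R R = #|arcs R|.*2.
Proof.
pose P (p : T * T) := [&& p.1 \in R, p.2 \in R & e p.1 p.2].
pose sw (p : T * T) := (p.2, p.1).
have swK : involutive sw by case.
have -> : crossing e R R = #|[set p | P p]%SET|.
  rewrite /crossing; under eq_bigr do rewrite degE.
  rewrite pair_big_dep /= -sum1dep_card [RHS]big_mkcond [LHS]big_mkcond /=.
  by apply: eq_bigr => p _; rewrite /P andbA; case: (_ && _) => //=; case: (e _ _).
rewrite -addnn -(cardsID [set p | lt_rank p.1 p.2]%SET); congr (_ + _).
  by apply: eq_card => p; rewrite !inE /P -!andbA.
rewrite -[RHS](card_imset _ (inv_inj swK)); apply: eq_card => p.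
apply/idP/imsetP => [|[q]].
  rewrite !inE => /andP[nlt /and3P[p1 p2 ep]]; exists (sw p); rewrite ?swK //.
  rewrite inE /= p1 p2 e_sym ep lt_rank_total ?nlt //.
  by apply: contraTneq ep => ->; rewrite e_irr.
rewrite inE => /and4P[q1 q2 eq ltq] ->; rewrite !inE /P /= q1 q2 e_sym eq !andbT.
rewrite -lt_rank_total //.
by apply: contraTneq eq => ->; rewrite e_irr.
Qed.

Lemma nedges_arcs R : nedges e R = #|arcs R|.
Proof. by rewrite /nedges card_arcs doubleK. Qed.

End EdgeCount.

(** A path is extended at its head [x] by a neighbour other than the second vertex [y]. By
    finiteness it eventually meets itself, and the detour around [y] makes the closed part longer
    than 2. *)
Lemma exists_cycle (T : finType) (z : rel T) (x0 y0 : T) :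
    symmetric z -> irreflexive z ->
    (forall x y, z x y -> exists2 y', z x y' & y' != y) ->
  z x0 y0 -> exists c, graph_cycle z c.
Proof.
move=> z_sym z_irr h z0.
suff main n : forall (x y : T) (s : seq T), #|T| - size s <= n -> uniq [:: x, y & s] ->
    path z x (y :: s) -> exists c, graph_cycle z c.
  apply: (main #|T| x0 y0 [::]); rewrite ?leq_subr //=.
    by rewrite inE andbT; apply: contraTneq z0 => ->; rewrite z_irr.
  by rewrite z0.
elim: n => [|n IHn] x y s lt us ps.
  have := card_uniqP us; have := max_card (mem [:: x, y & s]).
  by move=> + E; rewrite E /=; move: lt; move: #|T| (size s) => p q; clear; lia.
have zxy : z x y by move: ps => /= /andP[].
have [y' zxy' yy'] := h x y zxy.
have xy' : y' != x by apply: contraTneq zxy' => ->; rewrite z_irr.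
have [y's|y's] := boolP (y' \in s); last first.
  apply: (IHn y' x (y :: s)).
  - have := card_uniqP us; have := max_card (mem [:: x, y & s]).
    by move=> + E; rewrite E /=; move: lt; move: #|T| (size s) => p q; clear; lia.
  - by move: us; rewrite /= !inE !negb_or xy' yy' y's => ->.
  - by rewrite /= z_sym zxy'.
case/splitPr: y's us ps => s1 s2 us ps.
have E : [:: x, y & s1 ++ y' :: s2] = [:: x, y & rcons s1 y'] ++ s2.
  by rewrite /= cat_rcons.
move: us; rewrite E cat_uniq => /andP[us _].
have ps' : path z x (y :: rcons s1 y').
  by move: ps; rewrite -cat_rcons -cat_cons cat_path => /andP[].
exists [:: x, y & rcons s1 y']; apply/andP; split; first by rewrite /= size_rcons.
apply/andP; split=> //.
suff : path z x (rcons (y :: rcons s1 y') x) by [].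
by rewrite rcons_path ps' /= last_rcons z_sym.
Qed.

Section FaceSystem.
Variables (T : finType) (e : rel T).
Hypotheses (e_sym : symmetric e) (e_irr : irreflexive e).
Variable (R : {set T}).
Variables (F : finType) (phi : F -> T -> T -> 'F_2).

(* [phi f] is the indicator, modulo 2, of the boundary of the face [f]. *)
Record face_system : Prop := FaceSystem {
  face_sym : forall f x y, phi f x y = phi f y x;
  face_le2 : forall x y, x \in R -> y \in R -> e x y ->
    #|[set f | phi f x y != 0%R]%SET| <= 2;
  face_cycle : forall f v, v \in R -> (\sum_(y in nbrs e R v) phi f v y = 0)%R;
  face_span : forall z : T -> T -> 'F_2, (forall x y, z x y = z y x) ->
    (forall v, v \in R -> (\sum_(y in nbrs e R v) z v y = 0)%R) ->
    exists h : F -> 'F_2, forall x y, x \in R -> y \in R -> e x y ->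
      z x y = (\sum_f h f * phi f x y)%R
}.
Hypothesis fs : face_system.

Local Notation EE := (arcs e R).

(** Evenness gives each end of a boundary edge a second boundary edge, so the boundary contains a
    cycle. Counting degrees along the cycle shows that there are at least as many boundary edges as
    its length. *)
Lemma boundary_size g f : girth_geq e g ->
  [set i in EE | phi f i.1 i.2 != 0%R]%SET != set0 ->
  g <= #|[set i in EE | phi f i.1 i.2 != 0%R]%SET|.
Proof.
move=> girth; set X := [set i in EE | _]%SET => /set0Pn[[x0 y0]].
pose z x y := [&& x \in R, y \in R, e x y & phi f x y != 0%R].
have z_sym : symmetric z.
  by move=> x y; rewrite /z (face_sym fs) e_sym andbCA.
have z_irr : irreflexive z by move=> x; rewrite /z e_irr !andbF.
rewrite !inE /= => /andP[/and4P[x0R y0R e0 _] p0].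
have z0 : z x0 y0 by rewrite /z x0R y0R e0.
have other x y : z x y -> exists2 y', z x y' & y' != y.
  move=> /and4P[xR yR exy pxy].
  have := face_cycle fs f xR; rewrite (bigD1 y) ?in_nbrs ?yR //= => s0.
  have [/exists_inP[y' y'N /andP[yy' py']]|n] :=
      boolP [exists y' in nbrs e R x, (y' != y) && (phi f x y' != 0%R)].
    exists y' => //; move: y'N; rewrite in_nbrs /z xR => /andP[-> ->].
    by rewrite py'.
  rewrite big1 in s0; first by move: pxy; rewrite -[phi f x y]addr0 s0 eqxx.
  move=> y' /andP[y'N yy']; apply/eqP/negPn; apply: contra n => py'.
  by apply/exists_inP; exists y'; rewrite ?yy'.
have [c cyc] := exists_cycle z_sym z_irr other z0.
have cyc_e : graph_cycle e c.
  rewrite /graph_cycle /ucycleb; move: cyc => /andP[-> /andP[cz ->]]; rewrite andbT.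
  by apply: sub_cycle cz => x y /and4P[].
apply: leq_trans (girth c cyc_e) _.
have -> : X = arcs z R.
  apply/setP => p; rewrite !inE /z.
  by case: (p.1 \in R); case: (p.2 \in R); case: (e _ _); case: (lt_rank _ _);
    rewrite ?andbF ?andbT.
rewrite -leq_double -(card_arcs z_sym z_irr).
have /and3P[_ cz uc] := cyc.
have cR x : x \in c -> x \in R.
  by move=> /(next_cycle cz)/and4P[].
have d2 x : x \in c -> 2 <= deg z R x.
  move=> xc; have zx := next_cycle cz xc.
  have [y' zx' yy'] := other x _ zx.
  have <- : #|[set next c x; y']%SET| = 2 by rewrite cards2 eq_sym yy'.
  apply/subset_leq_card/subsetP => t; rewrite !inE => /orP[] /eqP ->.
    by rewrite zx andbT; case/and4P: zx.
  by rewrite zx' andbT; case/and4P: zx'.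
have sCR : [set x in c]%SET \subset R by apply/subsetP => x; rewrite inE => /cR.
rewrite /crossing (big_setID [set x in c]%SET) /= (setIidPr sCR).
apply: leq_trans (leq_addr _ _); rewrite -(card_uniqP uc) -muln2.
rewrite -[#|c|](cardsE (mem c)) -sum_nat_const.
by apply: leq_sum => x; rewrite inE => /d2.
Qed.

Local Notation nE := #|EE|.

Definition boundary_mx : 'M['F_2]_(nE, #|R|) := (\matrix_(i, j)
  (((enum_val i).1 == enum_val j)%:R + ((enum_val i).2 == enum_val j)%:R))%R.

Definition face_mx : 'M['F_2]_(#|F|, nE) := (\matrix_(f, i)
  phi (enum_val f) (enum_val i).1 (enum_val i).2)%R.

Lemma arcsP p : p \in EE ->
  [/\ p.1 \in R, p.2 \in R, e p.1 p.2 & (p.2, p.1) \notin EE].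
Proof.
rewrite !inE /= => /and4P[-> -> ep lt]; split=> //.
rewrite negb_and; apply/orP; right; rewrite !negb_and; apply/orP; right.
rewrite -lt_rank_total ?lt ?orbT //.
by apply: contraTneq ep => ->; rewrite e_irr.
Qed.

(** The left kernel of [boundary_mx] is the cycle space: a row in it is an edge set meeting every
    vertex evenly, which [face_span] writes as a combination of faces. *)
Lemma kermx_face : (kermx boundary_mx <= face_mx)%MS.
Proof.
apply/row_subP => r; set v := row r _.
have v0 : (v *m boundary_mx = 0)%R by apply/sub_kermxP; apply: row_sub.
pose z x y : 'F_2 := (\sum_i v 0 i *
  ((enum_val i == (x, y))%:R + (enum_val i == (y, x))%:R))%R.
have [||h zh] := face_span fs (z := z).
- by move=> x y; rewrite /z; apply: eq_bigr => i _; rewrite addrC.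
- move=> x xR; rewrite exchange_big /=.
  have /matrixP/(_ 0%R (enum_rank_in xR x)) := v0; rewrite !mxE => M0; rewrite -[RHS]M0.
  apply: eq_bigr => i _; rewrite -mulr_sumr [boundary_mx _ _]mxE enum_rankK_in //; congr (_ * _)%R.
  have [i1 i2 ei _] := arcsP (enum_valP i).
  move: (enum_val i) i1 i2 ei => [a b] /= aR bR eab.
  have one c d : c \in R -> d \in R -> e c d ->
      (\sum_(y in nbrs e R x) ((c, d) == (x, y))%:R = (c == x)%:R :> 'F_2)%R.
    move=> cR dR ecd; have [cx|cx] := eqVneq c x; last first.
      by rewrite big1 // => y _; rewrite xpair_eqE (negPf cx).
    rewrite (bigD1 d) /= ?in_nbrs ?dR -?cx // xpair_eqE !eqxx big1 ?addr0 // => y.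
    by move=> /andP[_ /negPf yd]; rewrite xpair_eqE [d == y]eq_sym yd andbF.
  rewrite big_split /= one //; congr (_ + _)%R; rewrite -(one b a) // 1?e_sym //.
  by apply: eq_bigr => y _; rewrite !xpair_eqE andbC.
apply/submxP; exists (\row_f h (enum_val f))%R.
apply/rowP => i; rewrite [RHS]mxE.
have [i1 i2 ei ni] := arcsP (enum_valP i).
have := zh _ _ i1 i2 ei.
have sw (j : 'I_nE) : (enum_val j == ((enum_val i).2, (enum_val i).1)) = false.
  by apply: contraNF ni => /eqP <-; exact: (enum_valP j).
rewrite /z (bigD1 i) //= sw -surjective_pairing eqxx addr0 mulr1.
rewrite big1 ?addr0 => [->|j ji]; last first.
  by rewrite sw (inj_eq enum_val_inj) (negPf ji) addr0 mulr0 //.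
under [RHS]eq_bigr do rewrite !mxE.
rewrite -(big_enum_val (fun f => h f * phi f (enum_val i).1 (enum_val i).2)%R).
exact: eq_bigl.
Qed.

Definition nonzero_faces := [set f | row f face_mx != 0%R]%SET.

Lemma rank_face : \rank face_mx <= #|nonzero_faces|.
Proof.
pose M : 'M['F_2]_(#|nonzero_faces|, nE) := (\matrix_j row (enum_val j) face_mx)%R.
apply: leq_trans (rank_leq_row M); apply/mxrankS/row_subP => f.
have [->|f0] := eqVneq (row f face_mx) 0%R; first exact: sub0mx.
have fN : f \in nonzero_faces by rewrite inE.
have -> : row f face_mx = row (enum_rank_in fN f) M.
  by rewrite rowK enum_rankK_in.
exact: row_sub.
Qed.

(** The cycle space has dimension at least [nE - #|R|], hence so many faces have nonzero boundary.
    Each of these boundaries has at least [g] edges, and each edge is on at most two of them. *)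
Theorem euler_bound g : girth_geq e g ->
  g * nedges e R <= 2 * nedges e R + g * #|R|.
Proof.
move=> girth; rewrite (nedges_arcs e_sym e_irr).
have nz : nE - #|R| <= #|nonzero_faces|.
  apply: leq_trans rank_face; apply: leq_trans (mxrankS kermx_face).
  by rewrite mxrank_ker leq_sub2l // rank_leq_col.
suff : g * #|nonzero_faces| <= 2 * nE by nia.
pose X (f : 'I_#|F|) := [set i | phi (enum_val f) (i : T * T).1 i.2 != 0%R]%SET.
have le1 : g * #|nonzero_faces| <=
    \sum_(f < #|F|) #|[set i in EE | phi (enum_val (f : 'I_#|F|)) i.1 i.2 != 0%R]%SET|.
  rewrite mulnC -sum_nat_const [X in _ <= X](bigID (mem nonzero_faces)) /=.
  apply: leq_trans (leq_addr _ _); apply: leq_sum => f; rewrite inE => f0.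
  apply: boundary_size => //; apply: contraNneq f0 => X0; apply/eqP/rowP => i.
  rewrite !mxE; apply/eqP/negPn/negP => p0; have := enum_valP i.
  by move/setP: X0 => /(_ (enum_val i)); rewrite in_set0 inE p0 andbT => ->.
apply: leq_trans le1 _.
under eq_bigr do rewrite -sum1dep_card big_mkcondr /=.
rewrite exchange_big /= mulnC -sum_nat_const; apply: leq_sum => p pE.
have [p1 p2 ep _] := arcsP pE.
apply: leq_trans (face_le2 fs p1 p2 ep).
rewrite -sum1dep_card -big_mkcond /=.
rewrite -(big_enum_val_cond (fun f => phi f p.1 p.2 != 0%R) (fun=> 1)).
by apply: eq_leq; apply: eq_bigl.
Qed.

End FaceSystem.

(** * Grids and their minors *)

Section Grid.
Variable n : nat.

Definition gpoint : finType := ('I_n.+1 * 'I_n.+1)%type.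
Definition square : finType := ('I_n * 'I_n)%type.
Implicit Types (p q : gpoint) (s t : square).

Definition gx p : nat := p.1.
Definition gy p : nat := p.2.
Definition sx s : nat := s.1.
Definition sy s : nat := s.2.

Lemma gx_lt p : gx p < n.+1. Proof. exact: ltn_ord. Qed.
Lemma gy_lt p : gy p < n.+1. Proof. exact: ltn_ord. Qed.
Lemma sx_lt s : sx s < n. Proof. exact: ltn_ord. Qed.
Lemma sy_lt s : sy s < n. Proof. exact: ltn_ord. Qed.

Definition next_to (i j : nat) := (i == j.+1) || (j == i.+1).

Definition adj p q : bool :=
  ((gx p == gx q) && next_to (gy p) (gy q)) ||
  ((gy p == gy q) && next_to (gx p) (gx q)).

Definition corner s p : bool :=
  ((gx p == sx s) || (gx p == (sx s).+1)) &&
  ((gy p == sy s) || (gy p == (sy s).+1)).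

Definition inside p : bool := (0 < gx p < n) && (0 < gy p < n).

Definition pt i j : gpoint := (inord i, inord j).

Lemma gpoint_eq p q : (p == q) = (gx p == gx q) && (gy p == gy q).
Proof. by case: p q => [a b] [c d]; rewrite xpair_eqE. Qed.

Lemma square_eq s t : (s == t) = (sx s == sx t) && (sy s == sy t).
Proof. by case: s t => [a b] [c d]; rewrite xpair_eqE. Qed.

Lemma pt_val p : pt (gx p) (gy p) = p.
Proof. by case: p => a b; rewrite /pt /gx /gy /= !inord_val. Qed.

Lemma ptK i j : i <= n -> j <= n -> gx (pt i j) = i /\ gy (pt i j) = j.
Proof. by move=> hi hj; split; rewrite /gx /gy /= inordK. Qed.

Lemma adj_sym : symmetric adj.
Proof.
by move=> p q; apply/idP/idP; rewrite /adj /next_to; lia.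
Qed.

Lemma adj_irr : irreflexive adj.
Proof. by move=> p; rewrite /adj /next_to; lia. Qed.

Lemma corner_adj s p (x : 'F_2) : corner s p ->
  (\sum_(q | adj p q && corner s q) x = 0)%R.
Proof.
move=> sp; have [b1 b2] := (sx_lt s, sy_lt s).
(* The two neighbours of [p] on the square, obtained by reflecting one coordinate of [p] in the
   midline of the square. *)
pose q1 := pt (sx s + (sx s).+1 - gx p) (gy p); pose q2 := pt (gx p) (sy s + (sy s).+1 - gy p).
have [b3 b4] := (gx_lt p, gy_lt p).
have e1 : (gx q1 = sx s + (sx s).+1 - gx p) /\ (gy q1 = gy p).
  by apply: ptK; move: sp; rewrite /corner; lia.
have e2 : (gx q2 = gx p) /\ (gy q2 = sy s + (sy s).+1 - gy p).
  by apply: ptK; move: sp; rewrite /corner; lia.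
rewrite (bigD1 q1) /=; last first.
  by move: sp; rewrite /adj /corner /next_to; lia.
rewrite (bigD1 q2) /=; last first.
  by move: sp; rewrite gpoint_eq /adj /corner /next_to; lia.
rewrite big1 ?addr0 ?F2_addxx // => q.
by move: sp; rewrite !gpoint_eq /adj /corner /next_to; lia.
Qed.

(** For adjacent [p] and [q], the coefficient of the edge [pq] in the sum of the boundaries of the
    squares, weighted by [h]. *)
Definition side_sum (h : square -> 'F_2) p q : 'F_2 :=
  (\sum_(s | corner s p && corner s q) h s)%R.

Lemma side_sumC h p q : side_sum h p q = side_sum h q p.
Proof. by apply: eq_bigl => s; rewrite andbC. Qed.

Lemma side_sum_even h p : (\sum_(q | adj p q) side_sum h p q = 0)%R.
Proof.
rewrite /side_sum (exchange_big_dep (corner^~ p)) /=; last by move=> q s _ /andP[].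
apply: big1 => s sp; under eq_bigl do rewrite sp.
exact: corner_adj.
Qed.

Lemma two_squares p q : inside p -> adj p q ->
  exists s1 s2, s1 != s2 /\
    forall s, corner s p && corner s q = (s == s1) || (s == s2).
Proof.
case/andP=> /andP[p1 p1n] /andP[p2 p2n] apq.
have [b3 b4] := (gx_lt q, gy_lt q).
have P1 : (gx p).-1 < n by lia.
have P2 : (gy p).-1 < n by lia.
have [/andP[e1 e2]|ne] := boolP ((gx p == gx q) && next_to (gy p) (gy q)).
  have M : minn (gy p) (gy q) < n by move: e2; rewrite /next_to; lia.
  pose s1 : square := (Ordinal P1, Ordinal M).
  pose s2 : square := (Ordinal p1n, Ordinal M).
  have [x1 y1] : sx s1 = (gx p).-1 /\ sy s1 = minn (gy p) (gy q) by [].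
  have [x2 y2] : sx s2 = gx p /\ sy s2 = minn (gy p) (gy q) by [].
  exists s1, s2; move: s1 s2 x1 y1 x2 y2 => s1 s2 x1 y1 x2 y2.
  split=> [|s]; first by rewrite square_eq; lia.
  by apply/idP/idP; move: e2; rewrite !square_eq /corner /next_to; lia.
have M : minn (gx p) (gx q) < n by move: apq ne; rewrite /adj /next_to; lia.
pose s1 : square := (Ordinal M, Ordinal P2).
pose s2 : square := (Ordinal M, Ordinal p2n).
have [x1 y1] : sx s1 = minn (gx p) (gx q) /\ sy s1 = (gy p).-1 by [].
have [x2 y2] : sx s2 = minn (gx p) (gx q) /\ sy s2 = gy p by [].
exists s1, s2; move: s1 s2 x1 y1 x2 y2 => s1 s2 x1 y1 x2 y2.
split=> [|s]; first by rewrite square_eq; lia.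
by apply/idP/idP; move: apq ne; rewrite !square_eq /adj /corner /next_to; lia.
Qed.

Lemma side_sum2 h p q s1 s2 : s1 != s2 ->
    (forall s, corner s p && corner s q = (s == s1) || (s == s2)) ->
  side_sum h p q = (h s1 + h s2)%R.
Proof.
move=> s12 E; rewrite /side_sum (eq_bigl _ _ E) (bigD1 s1) ?eqxx //=; congr (_ + _)%R.
rewrite (big_pred1 s2) // => s /=; case: (eqVneq s s1) => [->|] /=.
  by rewrite (negPf s12).
by rewrite andbT.
Qed.

Section Boundary.
Variable z : gpoint -> gpoint -> 'F_2.
Hypothesis z_sym : forall p q, z p q = z q p.
Hypothesis z_adj : forall p q, ~~ adj p q -> z p q = 0%R.
Hypothesis z_even : forall p, (\sum_q z p q = 0)%R.

Let Z i j i' j' : 'F_2 := z (pt i j) (pt i' j').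

Lemma Z_even i j : 0 < j -> i < n -> j < n ->
  ((if i is i'.+1 then Z i j i' j else 0) + Z i j i.+1 j + (Z i j i j.-1 + Z i j i j.+1)
    = 0)%R.
Proof.
move=> j0 ilt jlt; have [p1 p2] := ptK (ltnW ilt) (ltnW jlt).
have [a1 a2] := ptK ilt (ltnW jlt).
have [b1 b2] := ptK (ltnW ilt) (leq_trans (leq_pred j) (ltnW jlt)).
have [c1 c2] := ptK (ltnW ilt) jlt.
rewrite -[RHS](z_even (pt i j)) (bigD1 (pt i.+1 j)) //= (bigD1 (pt i j.-1)) /=; last first.
  by rewrite gpoint_eq; lia.
rewrite (bigD1 (pt i j.+1)) /=; last by rewrite !gpoint_eq; lia.
case: i ilt p1 p2 a1 a2 b1 b2 c1 c2 => [|i] ilt p1 p2 a1 a2 b1 b2 c1 c2.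
  rewrite big1 ?add0r ?addr0 // => q; rewrite !gpoint_eq => h.
  by apply: z_adj; move: h; rewrite /adj /next_to; lia.
have [d1 d2] := ptK (ltnW (ltnW ilt)) (ltnW jlt).
rewrite (bigD1 (pt i j)) /=; last by rewrite !gpoint_eq; lia.
rewrite big1 ?addr0 => [|q]; last first.
  rewrite !gpoint_eq => h.
  by apply: z_adj; move: h; rewrite /adj /next_to; lia.
by rewrite /Z; ring.
Qed.

(** The parity of the number of edges of [z] crossed by the horizontal ray going left from the
    square [(a, b)]: its winding number modulo 2. *)
Definition height a b : 'F_2 := (\sum_(i < a.+1) Z i b i b.+1)%R.

Lemma height_vert a b : (height a.+1 b + height a b = Z a.+1 b a.+1 b.+1)%R.
Proof. by rewrite /height big_ord_recr /= addrAC F2_addxx add0r. Qed.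

(** Passing from row [b] to row [b.+1] replaces the vertical edges below the points [(i, b.+1)] by
    those above. By evenness at these points the change telescopes to the horizontal edge leaving
    the last one. *)
Lemma height_hor a b : a < n -> b.+1 < n ->
  (height a b.+1 + height a b = Z a b.+1 a.+1 b.+1)%R.
Proof.
move=> + blt; elim: a => [|a IHa] alt.
  have := Z_even (ltn0Sn b) alt blt; rewrite /height !big_ord1 /= add0r => /F2_add_eq ->.
  by rewrite addrC /Z (z_sym (pt 0 b)).
have := Z_even (ltn0Sn b) alt blt; rewrite /= => ev.
have ih := IHa (ltnW alt).
have hS c d : (height c.+1 d = height c d + Z c.+1 d c.+1 d.+1)%R.
  by rewrite /height big_ord_recr.
apply: F2_add_eq; rewrite -[RHS]ev !hS.
transitivity ((height a b.+1 + height a b) + Z a.+1 b.+1 a.+1 b.+2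
  + Z a.+1 b a.+1 b.+1 + Z a.+1 b.+1 a.+2 b.+1)%R; first by ring.
rewrite ih /Z (z_sym (pt a b.+1)) (z_sym (pt a.+1 b)); ring.
Qed.

Lemma height_diff p q s t : adj p q -> s != t ->
    corner s p -> corner s q -> corner t p -> corner t q ->
  (height (sx s) (sy s) + height (sx t) (sy t) = z p q)%R.
Proof.
wlog pq : p q / (gx p <= gx q) && (gy p <= gy q).
  move=> h apq st sp sq tp tq.
  have [|n1] := boolP ((gx p <= gx q) && (gy p <= gy q)); first by move=> *; apply: h.
  rewrite z_sym; apply: h; rewrite // 1?adj_sym //.
  by move: apq n1; rewrite /adj /next_to; lia.
wlog ts : s t / (sx t <= sx s) && (sy t <= sy s).
  move=> h apq st sp sq tp tq.
  have [|n1] := boolP ((sx t <= sx s) && (sy t <= sy s)); first by move=> *; apply: h.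
  rewrite addrC; apply: h; rewrite // 1?eq_sym //.
  by move: apq st sp sq tp tq pq n1; rewrite square_eq /adj /next_to /corner; lia.
have [b1 b2] := (sx_lt s, sy_lt s).
move=> apq st sp sq tp tq; rewrite -(pt_val p) -(pt_val q).
have [/andP[e1 e2]|ne] := boolP ((gx p == gx q) && next_to (gy p) (gy q)).
  have E : [/\ sx s = (sx t).+1, sy s = sy t & gx p = (sx t).+1] /\
      [/\ gy p = sy t, gx q = (sx t).+1 & gy q = (sy t).+1].
    move: e1 e2 st sp sq tp tq pq ts; rewrite square_eq /next_to /corner.
    by clear; move=> *; split; split; lia.
  by case: E => [[-> -> ->] [-> -> ->]]; apply: height_vert.
have E : [/\ sy s = (sy t).+1, sx s = sx t & gy p = (sy t).+1] /\
    [/\ gx p = sx t, gy q = (sy t).+1 & gx q = (sx t).+1].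
  move: apq ne st sp sq tp tq pq ts; rewrite square_eq /adj /next_to /corner.
  by clear; move=> *; split; split; lia.
have b3 := sx_lt t.
by case: E b2 => [[-> -> ->] [-> -> ->]] b2; apply: height_hor.
Qed.

End Boundary.
End Grid.

Lemma sum_sym_F2 (G : finType) (A : {set G}) (X : G -> G -> 'F_2) :
    (forall p q, X p q = X q p) -> (forall p, X p p = 0%R) ->
  (\sum_(p in A) \sum_(q in A) X p q = 0)%R.
Proof.
move=> Xs X0; have [k] := ubnP #|A|; elim: k A => // k IHk A lek.
have [->|[a aA]] := set_0Vmem A; first by rewrite big_set0.
rewrite (big_setD1 a aA) /= (big_setD1 a aA) /= X0 add0r.
rewrite [X in (_ + X)%R](eq_bigr (fun p => X p a + \sum_(q in (A :\ a)%SET) X p q)%R);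
  last by move=> p _; rewrite (big_setD1 a aA).
rewrite big_split /= IHk ?addr0; last first.
  by move: lek; rewrite (cardsD1 a) aA.
by rewrite (eq_bigr (fun p => X p a)) ?F2_addxx // => p _.
Qed.

Section PathChain.
Variable G : finType.
Implicit Types (p q a b : G) (s : seq G).

(** The multiplicity modulo 2 of the undirected edge [pq] in the walk [a :: s], that is, the walk as
    a 1-chain. *)
Fixpoint chain a s p q : 'F_2 :=
  if s is b :: s' then
    (((a == p) && (b == q))%:R + ((b == p) && (a == q))%:R + chain b s' p q)%R
  else 0%R.

Lemma chain_sym a s p q : chain a s p q = chain a s q p.
Proof.
elim: s a => //= b s IHs a; rewrite IHs; congr (_ + _)%R.
by rewrite addrC [(b == p) && _]andbC [(a == p) && _]andbC.
Qed.

Lemma sum_delta p : (\sum_q (p == q)%:R = 1 :> 'F_2)%R.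
Proof.
rewrite (bigD1 p) //= eqxx big1 ?addr0 // => q qp.
by rewrite eq_sym (negPf qp).
Qed.

Lemma chain_boundary a s p :
  (\sum_q chain a s p q = (a == p)%:R + (last a s == p)%:R)%R.
Proof.
elim: s a => [|b s IHs] a /=; first by rewrite big1 // F2_addxx.
rewrite big_split /= IHs big_split /=.
have E (c d : G) : (\sum_q ((c == p) && (d == q))%:R = (c == p)%:R :> 'F_2)%R.
  case: (c == p); last by rewrite big1.
  by rewrite -[RHS](sum_delta d).
rewrite !E addrA -(addrA (a == p)%:R%R) F2_addxx addr0 //.
Qed.

Lemma chain_neq0 (r : rel G) a s p q : symmetric r -> path r a s ->
  (chain a s p q != 0)%R -> r p q.
Proof.
move=> rs; elim: s a => [|b s IHs] a; first by move=> _ /eqP [].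
move=> /= /andP[rab ps]; have [/andP[/eqP <- /eqP <-] //|n1] := boolP ((a == p) && (b == q)).
have [/andP[/eqP <- /eqP <-] //|n2] := boolP ((b == p) && (a == q)).
  by rewrite rs.
by rewrite !add0r; apply: IHs.
Qed.

End PathChain.

(** * Faces of a minor of a grid *)

Section GridMinor.
Variables (T : finType) (e : rel T).
Hypotheses (e_sym : symmetric e) (e_irr : irreflexive e).
Variable R : {set T}.
Variables (n : nat).
Local Notation gpoint := (gpoint n).
Local Notation square := (square n).
Variables (A : T -> {set gpoint}) (base : T -> gpoint) (port : T -> T -> gpoint).

Definition sub_adj (X : {set gpoint}) : rel gpoint :=
  fun p q => [&& adj p q, p \in X & q \in X].

(* Contracting each [A v] in the grid gives a graph containing [e]. *)
Record grid_minor : Prop := GridMinor {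
  gm_inside : forall v p, p \in A v -> inside p;
  gm_disj : forall u v p, p \in A u -> p \in A v -> u = v;
  gm_conn : forall v p, p \in A v -> connect (sub_adj (A v)) (base v) p;
  gm_port : forall x y, e x y -> port x y \in A x;
  gm_adj : forall x y, e x y -> adj (port x y) (port y x)
}.
Hypothesis gm : grid_minor.

Definition inner (p q : gpoint) := [exists v, (p \in A v) && (q \in A v)].
Definition marked (p q : gpoint) :=
  [exists x in R, [exists y in nbrs e R x, (p == port x y) && (q == port y x)]].
Definition kept p q := inner p q || marked p q.

Definition open_side : rel square := fun s t =>
  [exists p, [exists q, [&& adj p q, ~~ kept p q, corner s p && corner s q
    & corner t p && corner t q]]].

Definition face_of (s : square) := fingraph.root open_side s.

(** Counts modulo 2 the sides of the edge between the ports that lie in the face [f]; an edge with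
    [f] on both sides is not on its boundary. *)
Definition face_bd (f : square) x y : 'F_2 :=
  side_sum (fun s => (face_of s == f)%:R%R) (port x y) (port y x).

Lemma sub_adj_sym X : symmetric (sub_adj X).
Proof. by move=> p q; rewrite /sub_adj adj_sym [(p \in X) && _]andbC. Qed.

Lemma open_side_sym : connect_sym open_side.
Proof.
apply: sym_connect_sym => s t; apply/existsP/existsP => -[p /existsP[q]];
  move=> /and4P[apq kpq sp tp]; exists p; apply/existsP; exists q;
  by rewrite apq kpq sp tp.
Qed.

Lemma port_inj x y x' y' : e x y -> e x' y' -> port x y = port x' y' ->
  port y x = port y' x' -> x = x' /\ y = y'.
Proof.
move=> exy exy' E1 E2; split.
  by apply: (gm_disj gm (gm_port gm exy)); rewrite E1; apply: gm_port.
have eyx : e y x by rewrite e_sym.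
by apply: (gm_disj gm (gm_port gm eyx)); rewrite E2; apply: gm_port; rewrite // e_sym.
Qed.

Lemma face_bd_sym f x y : face_bd f x y = face_bd f y x.
Proof. exact: side_sumC. Qed.

Lemma face_bd_le2 x y : e x y -> #|[set f | face_bd f x y != 0%R]%SET| <= 2.
Proof.
move=> exy; have px := gm_port gm exy.
have [s1 [s2 [s12 E]]] := two_squares (gm_inside gm px) (gm_adj gm exy).
apply: leq_trans (_ : #|[set face_of s1; face_of s2]%SET| <= _).
  apply/subset_leq_card/subsetP => f; rewrite !inE; apply: contraNT.
  rewrite negb_or => /andP[f1 f2]; rewrite /face_bd (side_sum2 _ s12 E).
  by rewrite ![_ == f]eq_sym (negPf f1) (negPf f2) addr0.
by rewrite cards2; case: (_ != _).
Qed.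

(** The boundary of the union of the squares of [f] is even at each grid point. Summed over the
    branch set [A v], the inner edges cancel in pairs, leaving the edges that leave [A v]; among
    these, the unmarked ones have the same face on both sides. *)
Lemma face_bd_cycle f v : v \in R ->
  (\sum_(y in nbrs e R v) face_bd f v y = 0)%R.
Proof.
move=> vR; pose D p q : 'F_2 := if adj p q
  then side_sum (fun s => (face_of s == f)%:R%R) p q else 0%R.
have D_sym p q : D p q = D q p by rewrite /D adj_sym side_sumC.
have D0 p : D p p = 0%R by rewrite /D adj_irr.
have tot : (\sum_(p in A v) \sum_q D p q = 0)%R.
  apply: big1 => p _; rewrite -big_mkcond /=; exact: side_sum_even.
have cut : (\sum_(p in A v) \sum_(q | q \notin A v) D p q = 0)%R.
  move: tot; under eq_bigr do rewrite (bigID (mem (A v))) /=.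
  by rewrite big_split /= sum_sym_F2 // add0r.
rewrite -[RHS]cut [RHS]pair_big_dep /=.
have inj : {in nbrs e R v &, injective (fun y => (port v y, port y v))}.
  move=> y y'; rewrite !in_nbrs => /andP[_ evy] /andP[_ evy'] [E1 E2].
  by have [] := port_inj evy evy' E1 E2.
transitivity (\sum_(pq in [set (port v y, port y v) | y in nbrs e R v]) D pq.1 pq.2)%R.
  rewrite big_imset //=; apply: eq_bigr => y; rewrite in_nbrs => /andP[_ evy].
  by rewrite /D (gm_adj gm evy).
rewrite big_mkcond [RHS]big_mkcond /=; apply: eq_bigr => -[p q] _ /=.
case: ifP => [/imsetP[y yN [-> ->]]|ni].
  move: yN; rewrite in_nbrs => /andP[yR evy]; rewrite (gm_port gm evy).
  have eyv : e y v by rewrite e_sym.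
  case: ifP => // /negbFE pA; have := gm_disj gm (gm_port gm eyv) pA.
  by move=> yv; rewrite yv e_irr in evy.
case: ifP => // /andP[pA qA]; rewrite /D; case: ifP => // apq.
have [s1 [s2 [s12 E]]] := two_squares (gm_inside gm pA) apq.
rewrite (side_sum2 _ s12 E).
have -> : face_of s1 = face_of s2; last by rewrite F2_addxx.
apply/eqP; rewrite (root_connect open_side_sym); apply: connect1.
apply/existsP; exists p; apply/existsP; exists q; rewrite apq !E !eqxx orbT !andbT /=.
rewrite negb_or; apply/andP; split.
  apply/existsP => -[u /andP[pu qu]].
  by rewrite (gm_disj gm pu pA) (negPf qA) in qu.
apply/negP => /exists_inP[x xR /exists_inP[y]]; rewrite in_nbrs => /andP[yR exy].
move=> /andP[/eqP pE /eqP qE].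
have xv : x = v by apply: (gm_disj gm _ pA); rewrite pE; apply: gm_port.
case/negP: ni; apply/imsetP; exists y; rewrite ?in_nbrs ?yR -?xv //.
by rewrite pE qE.
Qed.

Section Lift.
Variable z : T -> T -> 'F_2.
Hypothesis z_sym : forall x y, z x y = z y x.
Hypothesis z_even : forall v, v \in R -> (\sum_(y in nbrs e R v) z v y = 0)%R.

(** The hypothesis is placed under the existential so that [cid] yields a total function; the same
    form recurs in the later choices. *)
Lemma inner_path x p : exists s, p \in A x ->
  path (sub_adj (A x)) (base x) s /\ last (base x) s = p.
Proof.
have [pA|_] := boolP (p \in A x); last by exists [::].
by have /connectP[s ps ->] := gm_conn gm pA; exists s.
Qed.

Definition route x y := projT1 (cid (inner_path x (port x y))).

Lemma routeP x y : e x y -> path (sub_adj (A x)) (base x) (route x y) /\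
  last (base x) (route x y) = port x y.
Proof.
by move=> exy; rewrite /route; case: cid => s /= h; apply: h; apply: gm_port.
Qed.

(** The edge [xy] becomes the grid walk from [base x] through the two ports to [base y]. The term of
    [(x, y)] provides the part in [A x] and one orientation of the port edge, the term of [(y, x)]
    the rest. *)
Definition lifted p q : 'F_2 := (\sum_(x in R) \sum_(y in nbrs e R x)
  z x y * (chain (base x) (route x y) p q
    + ((p == port x y) && (q == port y x))%:R))%R.

Lemma nbrsP x y : y \in nbrs e R x -> y \in R /\ e x y.
Proof. by rewrite in_nbrs => /andP[]. Qed.

Lemma lift_sym p q : lifted p q = lifted q p.
Proof.
rewrite /lifted.
have S p' q' : (\sum_(x in R) \sum_(y in nbrs e R x)
  z x y * (chain (base x) (route x y) p' q' + ((p' == port x y) && (q' == port y x))%:R)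
  = \sum_(x in R) \sum_(y in nbrs e R x) z x y * chain (base x) (route x y) p' q'
  + \sum_(x in R) \sum_(y in nbrs e R x) z x y * ((p' == port x y) && (q' == port y x))%:R)%R.
  rewrite -big_split /=; apply: eq_bigr => x _; rewrite -big_split /=.
  by apply: eq_bigr => y _; rewrite mulrDr.
rewrite !S; congr (_ + _)%R.
  by apply: eq_bigr => x _; apply: eq_bigr => y _; rewrite chain_sym.
rewrite (exchange_big_dep (mem R)) /=; last by move=> x y _ /nbrsP[].
apply: eq_bigr => x xR; apply: eq_big => [y|y _].
  by rewrite !in_nbrs xR e_sym.
by rewrite z_sym andbC.
Qed.

Lemma lift_kept p q : (lifted p q != 0)%R -> adj p q && kept p q.
Proof.
apply: contraR => nk; apply/eqP; rewrite /lifted big1 // => x xR.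
rewrite big1 // => y yN; have [yR exy] := nbrsP yN.
have [ps _] := routeP exy.
have -> : chain (base x) (route x y) p q = 0%R.
  apply/eqP; apply: contraR nk => /(chain_neq0 (@sub_adj_sym _) ps) /and3P[-> px qx].
  by apply/orP; left; apply/existsP; exists x; rewrite px.
case: andP => [[/eqP pE /eqP qE]|_]; last by rewrite addr0 mulr0.
case/negP: nk; rewrite pE qE (gm_adj gm exy); apply/orP; right.
by apply/exists_inP; exists x => //; apply/exists_inP; exists y; rewrite ?eqxx.
Qed.

(** The end of each route at a port cancels with the port edge. What remains is concentrated at
    [base x], where it is the sum of [z] around [x]. *)
Lemma lift_even p : (\sum_q lifted p q = 0)%R.
Proof.
rewrite /lifted exchange_big /= big1 // => x xR; rewrite exchange_big /=.
have E y : y \in nbrs e R x -> (\sum_q z x y * (chain (base x) (route x y) p q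
    + ((p == port x y) && (q == port y x))%:R) = z x y * (base x == p)%:R)%R.
  move=> /nbrsP[yR exy]; have [_ lp] := routeP exy.
  rewrite -mulr_sumr big_split /= chain_boundary lp.
  have -> : (\sum_q ((p == port x y) && (q == port y x))%:R = (port x y == p)%:R :> 'F_2)%R.
    rewrite eq_sym; case: (_ == p); last by rewrite big1.
    by rewrite -[RHS](sum_delta (port y x)); apply: eq_bigr => q _; rewrite eq_sym.
  by rewrite -addrA F2_addxx addr0.
by rewrite (eq_bigr _ E) -mulr_suml z_even // mul0r.
Qed.

Lemma lift_port x y : x \in R -> y \in R -> e x y ->
  lifted (port x y) (port y x) = z x y.
Proof.
move=> xR yR exy; have eyx : e y x by rewrite e_sym.
have yN : y \in nbrs e R x by rewrite in_nbrs yR.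
have C x' y' : e x' y' -> chain (base x') (route x' y') (port x y) (port y x) = 0%R.
  move=> exy'; have [ps _] := routeP exy'; apply/eqP/negPn/negP.
  move=> /(chain_neq0 (@sub_adj_sym _) ps) /and3P[_ px qx].
  have E := gm_disj gm (gm_port gm exy) px.
  have E' := gm_disj gm (gm_port gm eyx) qx.
  by move: exy; rewrite E E' e_irr.
rewrite /lifted (bigD1 x) //= (bigD1 y) //= C // !eqxx add0r mulr1.
rewrite !big1 ?addr0 // => [x' /andP[x'R xx']|y' /andP[/nbrsP[y'R exy'] yy']].
  rewrite big1 // => y' /nbrsP[y'R exy']; rewrite C // add0r.
  case: andP => [[/eqP E1 /eqP E2]|_]; last by rewrite mulr0.
  by have [E _] := port_inj exy exy' E1 E2; rewrite E eqxx in xx'.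
rewrite C // add0r; case: andP => [[/eqP E1 /eqP E2]|_]; last by rewrite mulr0.
by have [_ E] := port_inj exy exy' E1 E2; rewrite E eqxx in yy'.
Qed.

(** The heights of the lifted cycle are the coefficients. They do not change across a side that is
    not kept, since the lift vanishes there, so they are constant on each face; across a port edge
    they differ by [z]. *)
Lemma face_bd_span : exists h : square -> 'F_2,
  forall x y, x \in R -> y \in R -> e x y ->
    z x y = (\sum_f h f * face_bd f x y)%R.
Proof.
pose h (s : square) := height lifted (sx s) (sy s).
have l_adj p q : ~~ adj p q -> lifted p q = 0%R.
  by move=> npq; apply/eqP; apply: contraR npq => /lift_kept/andP[].
have hd p q s t : adj p q -> s != t -> corner s p -> corner s q -> corner t p ->
    corner t q -> (h s + h t = lifted p q)%R.
  by move=> *; apply: (height_diff lift_sym l_adj lift_even).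
have h_open s t : open_side s t -> h s = h t.
  case/existsP => p /existsP[q /and4P[apq npq /andP[sp sq] /andP[tp tq]]].
  have [->//|st] := eqVneq s t; apply: F2_add_eq; rewrite (hd p q) //.
  by apply/eqP; apply: contraR npq => /lift_kept/andP[].
have h_face s : h (face_of s) = h s.
  rewrite /face_of; have /connectP[r pr ->] := connect_root open_side s.
  elim: r s pr => //= t r IHr s /andP[/h_open -> pr]; exact: IHr.
exists h => x y xR yR exy; rewrite -(lift_port xR yR exy).
have [s1 [s2 [s12 E]]] := two_squares (gm_inside gm (gm_port gm exy)) (gm_adj gm exy).
have /andP[c1 c2] : corner s1 (port x y) && corner s1 (port y x) by rewrite E eqxx.
have /andP[c3 c4] : corner s2 (port x y) && corner s2 (port y x) by rewrite E eqxx orbT.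
rewrite -(hd _ _ _ _ (gm_adj gm exy) s12 c1 c2 c3 c4).
under eq_bigr do rewrite /face_bd (side_sum2 _ s12 E) mulrDr.
rewrite big_split /=.
have pick s : (\sum_f h f * (face_of s == f)%:R = h s)%R.
  rewrite (bigD1 (face_of s)) //= eqxx mulr1 h_face big1 ?addr0 // => f nf.
  by rewrite eq_sym (negPf nf) mulr0.
by rewrite !pick.
Qed.

End Lift.

Theorem grid_minor_faces : face_system e R face_bd.
Proof.
split.
- exact: face_bd_sym.
- by move=> x y _ _; apply: face_bd_le2.
- exact: face_bd_cycle.
- move=> z z_sym z_even; exact: face_bd_span.
Qed.

End GridMinor.

(** * Branch sets and ports from a drawing on the grid *)

Section GridDrawing.
Variables (T : finType) (e : rel T).
Hypotheses (e_sym : symmetric e) (e_irr : irreflexive e).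
Variable n : nat.
Local Notation gpoint := (gpoint n).
Variables (St : T -> {set gpoint}) (Mid : T -> T -> {set gpoint}).

Definition oedge x y := e x y && lt_rank x y.

(* [St v] covers the beginnings of the arcs issued from [v], and [Mid x y] the
   middle part of the arc [xy]. *)
Record grid_drawing : Prop := GridDrawing {
  gd_int : forall v p, p \in St v -> inside p;
  gd_int_mid : forall x y p, oedge x y -> p \in Mid x y -> inside p;
  gd_conn : forall v p q, p \in St v -> q \in St v -> connect (sub_adj (St v)) p q;
  gd_conn_mid : forall x y p q, oedge x y -> p \in Mid x y -> q \in Mid x y ->
    connect (sub_adj (Mid x y)) p q;
  gd_ne : forall v, exists p, p \in St v;
  gd_mid : forall x y, oedge x y -> (exists2 p, p \in Mid x y & p \in St x) /\
    (exists2 p, p \in Mid x y & p \in St y);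
  gd_disj : forall u v p, p \in St u -> p \in St v -> u = v;
  gd_disj_mid : forall x y v p, oedge x y -> p \in Mid x y -> p \in St v ->
    v = x \/ v = y;
  gd_disj_mid2 : forall x y x' y' p, oedge x y -> oedge x' y' ->
    p \in Mid x y -> p \in Mid x' y' -> x = x' /\ y = y'
}.
Hypothesis gd : grid_drawing.

Lemma start_ex x y : exists p, oedge x y -> p \in Mid x y /\ p \in St x.
Proof.
have [exy|_] := boolP (oedge x y).
  by have [[p pM pS] _] := gd_mid gd exy; exists p.
by have [p _] := gd_ne gd x; exists p.
Qed.

Definition start x y := projT1 (cid (start_ex x y)).

Lemma startP x y : oedge x y -> start x y \in Mid x y /\ start x y \in St x.
Proof. by rewrite /start; case: cid. Qed.

Definition avoid x y : rel gpoint := sub_adj (Mid x y :\: St y)%SET.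

(* The part of the middle of [xy] that is given to the branch set of [x]. *)
Definition reach x y : {set gpoint} :=
  [set p in (Mid x y :\: St y)%SET | connect (avoid x y) (start x y) p]%SET.

Definition branch x : {set gpoint} :=
  (St x :|: \bigcup_(y | oedge x y) reach x y)%SET.

Lemma start_reach x y : oedge x y -> start x y \in reach x y.
Proof.
move=> exy; have [sM sS] := startP exy.
rewrite inE connect0 andbT inE sM andbT; apply: contraL exy => sy.
by rewrite (gd_disj gd sS sy) /oedge e_irr.
Qed.

Lemma reach_path x y a s : a \in reach x y -> path (avoid x y) a s ->
  path (sub_adj (reach x y)) a s.
Proof.
elim: s a => //= b s IHs a aR /andP[ab ps].
have bR : b \in reach x y.
  move: aR; rewrite inE => /andP[_ ca]; rewrite inE.
  have /and3P[_ _ ->] := ab; exact: connect_trans ca (connect1 ab).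
by rewrite IHs // andbT /sub_adj aR bR; case/and3P: ab => ->.
Qed.

Lemma sub_adjS (X Y : {set gpoint}) a b : X \subset Y ->
  connect (sub_adj X) a b -> connect (sub_adj Y) a b.
Proof.
move=> sXY; apply: connect_sub => p q /and3P[apq pX qX].
by apply: connect1; rewrite /sub_adj apq !(subsetP sXY).
Qed.

Lemma branch_conn v p q : p \in St v -> q \in branch v ->
  connect (sub_adj (branch v)) p q.
Proof.
move=> pS; rewrite inE => /orP[qS|/bigcupP[y exy qR]].
  exact: sub_adjS (subsetUl _ _) (gd_conn gd pS qS).
have [sM sS] := startP exy.
apply: connect_trans (sub_adjS (subsetUl _ _) (gd_conn gd pS sS)) _.
move: (qR); rewrite inE => /andP[_ /connectP[s ps ->]].
apply: (@sub_adjS (reach v y)).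
  apply: subset_trans (subsetUr _ _); exact: bigcup_sup.
by apply/connectP; exists s => //; apply: reach_path => //; apply: start_reach.
Qed.

Lemma reachP x y p : p \in reach x y -> p \in Mid x y /\ p \notin St y.
Proof. by rewrite inE => /andP[]; rewrite inE => /andP[]. Qed.

Lemma branch_disj u v p : p \in branch u -> p \in branch v -> u = v.
Proof.
have SR x y v' : p \in St v' -> oedge x y -> p \in reach x y -> v' = x.
  move=> pS exy /reachP[pM pn]; case: (gd_disj_mid gd exy pM pS) => // vy.
  by rewrite -vy pS in pn.
rewrite !inE => /orP[pu|/bigcupP[y exy pu]] /orP[pv|/bigcupP[y' exy' pv]].
- exact: (gd_disj gd pu pv).
- exact: SR exy' pv.
- by apply/esym; apply: SR exy pu.
- have [pu' _] := reachP pu; have [pv' _] := reachP pv.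
  by have [] := gd_disj_mid2 gd exy exy' pu' pv'.
Qed.

(** A walk in [Mid x y] goes from a point of [St x] to a point of [St y]. Before it enters [St y] it
    stays in [reach x y], so its first step into [St y] joins the two branch sets. *)
Lemma oport_ex x y : exists pq : gpoint * gpoint, oedge x y ->
  [/\ pq.1 \in branch x, pq.2 \in branch y & adj pq.1 pq.2].
Proof.
have [exy|_] := boolP (oedge x y); last first.
  by have [p _] := gd_ne gd x; exists (p, p).
have [sM _] := startP exy; have [_ [q qM qS]] := gd_mid gd exy.
have /connectP[s ps qE] := gd_conn_mid gd exy sM qM.
have sR := start_reach exy.
elim: s (start x y) sR ps qE => [|b s IHs] a aR /=.
  by move=> _ qa; have [_] := reachP aR; rewrite -qa qS.
move=> /andP[/and3P[ab aM bM] ps] qE.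
have [bS|bS] := boolP (b \in St y).
  exists (a, b) => _; split=> //=; last by rewrite inE bS.
  by rewrite inE; apply/orP; right; apply/bigcupP; exists y.
apply: (IHs b) => //; rewrite inE inE bS bM /=.
move: (aR); rewrite inE => /andP[aX ca]; apply: connect_trans ca (connect1 _).
by rewrite /avoid /sub_adj ab aX inE bS.
Qed.

Definition oport x y := projT1 (cid (oport_ex x y)).

Definition port x y := if lt_rank x y then (oport x y).1 else (oport y x).2.

Lemma portP x y : e x y -> [/\ port x y \in branch x, port y x \in branch y
  & adj (port x y) (port y x)].
Proof.
move=> exy; have xy : x != y by apply: contraTneq exy => ->; rewrite e_irr.
rewrite /port (lt_rank_total xy).
have O a b : oedge a b -> [/\ (oport a b).1 \in branch a,
    (oport a b).2 \in branch b & adj (oport a b).1 (oport a b).2].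
  by move=> ab; rewrite /oport; case: cid => pq /= h; apply: h.
case yx: (lt_rank y x) => /=.
  by have [? ? ?] := O y x ltac:(by rewrite /oedge e_sym exy); rewrite adj_sym.
by apply: O; rewrite /oedge exy lt_rank_total // yx.
Qed.

Theorem drawing_minor : exists base, grid_minor e branch base port.
Proof.
exists (fun v => projT1 (cid (gd_ne gd v))); split.
- move=> v p; rewrite inE => /orP[/(gd_int gd)//|/bigcupP[y exy /reachP[pM _]]].
  exact: (gd_int_mid gd exy pM).
- exact: branch_disj.
- by move=> v p pB; case: cid => q /= qS; apply: branch_conn.
- by move=> x y /portP[].
- by move=> x y /portP[].
Qed.

End GridDrawing.

Lemma coloring_IF_partition (T : finType) (e : rel T) (k g : nat) :
    symmetric e -> k < g -> girth_geq e g ->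
    colorable e k [set: T]%SET (fun=> 1) xpred0 ->
  exists I F : {set T}, IF_partition e k I F.
Proof.
move=> e_sym kg girth [c [cc _ cw]].
have ceq x y : e x y -> compat (c x) (c y) by apply: cc; rewrite inE.
pose F := [set x | c x != None]%SET; exists (~: F)%SET, F.
have comp (x : {x : T | x \in F}) : #|component (@induced T e F) x| <= k.
  have [a xa] : exists a, c (val x) = Some a.
    by have := valP x; rewrite inE; case: (c _) => // a _; exists a.
  (* Labels do not change along the edges of [F], so the component of [x] lies in one class, and
     with unit weights the weight of a class is its cardinality. *)
  apply: leq_trans (cw a); rewrite /class_weight sum1dep_card.
  rewrite -[X in X <= _](card_imset _ val_inj).
  apply/subset_leq_card/subsetP => y.
  case/imsetP => z zc ->; have /connectP[s ps ->] : connect (@induced T e F) x z.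
    by rewrite /component in_set in zc.
  rewrite !inE /=.
  elim: s x xa ps {z zc} => [|z s IHs] x xa /=; first by rewrite xa.
  move=> /andP[exz ps]; apply: IHs ps; have := ceq _ _ exz.
  by have := valP z; rewrite inE xa; case: (c (val z)) => //= b _ /eqP ->.
split=> //.
- by rewrite setUC setUCr.
- by rewrite -setI_eq0 setIC setICr.
- move=> x y; rewrite !inE !negbK => /eqP cx /eqP cy; apply/negP => /ceq.
  by rewrite cx cy.
- move=> s; apply/negP => /andP[s2 /andP[cs us]].
  have gs : g <= size s.
    rewrite -(size_map val); apply: girth; apply/andP; split; first by rewrite size_map.
    apply/andP; split; last by rewrite map_inj_uniq //; apply: val_inj.
    by rewrite cycle_map.
  case: s s2 cs us gs => // x s s2 cs us gs.
  have : size (x :: s) <= #|component (@induced T e F) x|.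
    rewrite -(card_uniqP us); apply/subset_leq_card/subsetP => y ys.
    rewrite /component in_set; move: cs; rewrite [cycle _ _]/(path _ x (rcons s x)) => cs.
    apply: (path_connect cs); move: ys; rewrite !inE mem_rcons inE => /orP[->//|->].
    by rewrite !orbT.
  by have := comp x; lia.
Qed.

From mathcomp Require Import all_classical all_reals all_analysis.
Import numFieldNormedType.Exports.

(** * From a plane drawing to a grid minor *)

Section Cells.
Variable R : realType.
Local Open Scope classical_set_scope.
Local Open Scope ring_scope.
Implicit Types (p q : R * R) (K : set (R * R)).

Lemma compact_separated K K' : compact K -> compact K' -> K `&` K' = set0 ->
  exists2 d : R, 0 < d & forall p q, K p -> K' q -> d <= `|p - q|.
Proof.
move=> cK cK' KK'.
have [ne|K0] := pselect (K `*` K' !=set0); last first.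
  by exists 1 => // p q Kp Kq; case: K0; exists (p, q).
pose f (z : (R * R) * (R * R)) : R := `|z.1 - z.2|.
have cf : {within K `*` K', continuous f}.
  apply: continuous_subspaceT => z.
  apply: (continuous_comp (f := fun z : (R * R) * (R * R) => z.1 - z.2)).
    by apply: cvgB; [exact: cvg_fst|exact: cvg_snd].
  exact: norm_continuous.
have [c /set_mem[Kc1 Kc2] cmin] := compact_EVT_min ne (compact_setX cK cK') cf.
exists (f c).
  rewrite /f normr_gt0 subr_eq0; apply/eqP => c12.
  have : (K `&` K') c.1 by split=> //; rewrite c12.
  by rewrite KK'.
by move=> p q Kp Kq; apply: (cmin (p, q)); apply/mem_set.
Qed.

Variables (n : nat) (d L : R).
Hypothesis d0 : 0 < d.
Local Notation gpoint := (gpoint n).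
Implicit Types c : gpoint.

(** The mesh is [d]; the shift by 2 keeps a margin, so that the cells met by the drawing are
    [inside] the grid. *)
Definition scale (x : R) : R := (x + L) / d + 2.

(** A grid point [c] stands here for the closed unit cell with lower left corner [c]; adjacent grid
    points are cells with a common side. Closedness lets a point touch up to four cells. *)
Definition touch p c : bool :=
  ((gx c)%:R <= scale p.1 <= (gx c).+1%:R) && ((gy c)%:R <= scale p.2 <= (gy c).+1%:R).

Definition in_box p : bool :=
  (2 <= scale p.1 <= n%:R - 1) && (2 <= scale p.2 <= n%:R - 1).

Definition cells K : {set gpoint} := [set c | `[< exists2 p, K p & touch p c >]]%SET.

Lemma cellsP K c : reflect (exists2 p, K p & touch p c) (c \in cells K).
Proof. by rewrite inE; apply: asboolP. Qed.

Lemma touch_inside p c : in_box p -> touch p c -> inside c.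
Proof.
have E (a : nat) (x : R) : 2 <= x <= n%:R - 1 -> a%:R <= x <= a.+1%:R -> (0 < a < n)%N.
  move=> /andP[x2 xn] /andP[ax xa]; apply/andP; split.
    by rewrite -ltnS -(ltr_nat R); lra.
  by rewrite -(ltr_nat R); lra.
move=> /andP[b1 b2] /andP[t1 t2]; rewrite /inside.
by rewrite (E _ _ b1 t1) (E _ _ b2 t2).
Qed.

Lemma touch_ex p : in_box p -> exists c, touch p c.
Proof.
have E (x : R) : 2 <= x <= n%:R - 1 -> (Num.truncn x <= n)%N /\
    (Num.truncn x)%:R <= x <= (Num.truncn x).+1%:R.
  move=> /andP[x2 xn]; have x0 : 0 <= x by lra.
  have /andP[t1 t2] := truncn_itv x0; split; last by rewrite t1 ltW.
  by rewrite -(ler_nat R); lra.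
move=> /andP[/E[n1 t1] /E[n2 t2]]; exists (pt n (Num.truncn (scale p.1)) (Num.truncn (scale p.2))).
by have [gX gY] := ptK n1 n2; rewrite /touch gX gY t1.
Qed.

Lemma touch_near_nat (a b : nat) (x : R) :
  a%:R <= x <= a.+1%:R -> b%:R <= x <= b.+1%:R -> (a == b) || next_to a b.
Proof.
move=> /andP[a1 a2] /andP[b1 b2].
have : (a <= b.+1)%N by rewrite -(ler_nat R); lra.
have : (b <= a.+1)%N by rewrite -(ler_nat R); lra.
by rewrite /next_to; lia.
Qed.

(** Two cells touched by the same point may differ in both coordinates; the cell mixing their
    coordinates is touched too and is adjacent to both. *)
Lemma touch_connect (X : {set gpoint}) p c c' : (forall c, touch p c -> c \in X) ->
  touch p c -> touch p c' -> connect (sub_adj X) c c'.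
Proof.
move=> pX tc tc'; have /andP[tx ty] := tc; have /andP[tx' ty'] := tc'.
have [mX mY] := ptK (gx_lt c : (gx c <= n)%N) (gy_lt c' : (gy c' <= n)%N).
set c1 := pt n (gx c) (gy c') in mX mY.
have t1 : touch p c1 by rewrite /touch mX mY tx.
apply: (@connect_trans _ _ c1).
  have /orP[/eqP E|nt] := touch_near_nat ty ty'.
    by rewrite /c1 -E pt_val.
  by apply: connect1; rewrite /sub_adj !pX // /adj mX mY eqxx nt.
have /orP[/eqP E|nt] := touch_near_nat tx tx'.
  by rewrite /c1 E pt_val.
by apply: connect1; rewrite /sub_adj !pX // /adj mX mY eqxx nt orbT.
Qed.

Lemma scale_continuous : continuous scale.
Proof.
move=> x; apply: cvgD; last exact: cvg_cst.
apply: cvgM; last exact: cvg_cst.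
by apply: cvgD; [exact: cvg_id|exact: cvg_cst].
Qed.

Lemma nbhsS p (P Q : R * R -> Prop) : (forall q, P q -> Q q) ->
  (\forall q \near p, P q) -> \forall q \near p, Q q.
Proof. by move=> PQ; apply: filterS. Qed.

(** Cells are closed and finite in number, so those not touched by [p] stay untouched in a
    neighbourhood of [p]. *)
Lemma touch_near p : \forall q \near p, forall c, touch q c -> touch p c.
Proof.
apply: (@filter_forall _ gpoint (fun c q => touch q c -> touch p c) (nbhs p) (nbhs_filter p)) => c.
have S1 : scale q.1 @[q --> p] --> scale p.1.
  by apply: continuous_comp; [exact: cvg_fst|exact: scale_continuous].
have S2 : scale q.2 @[q --> p] --> scale p.2.
  by apply: continuous_comp; [exact: cvg_snd|exact: scale_continuous].
have [tp|] := boolP (touch p c); first by near=> q.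
rewrite /touch !negb_and -!ltNge => /orP[/orP[h|h]|/orP[h|h]].
- apply: nbhsS (cvgr_lt _ S1 _ h) => q /= qh /andP[/andP[+ _] _].
  by rewrite leNgt qh.
- apply: nbhsS (cvgr_gt _ S1 _ h) => q /= qh /andP[/andP[_ +] _].
  by rewrite leNgt qh.
- apply: nbhsS (cvgr_lt _ S2 _ h) => q /= qh /andP[_ /andP[+ _]].
  by rewrite leNgt qh.
- apply: nbhsS (cvgr_gt _ S2 _ h) => q /= qh /andP[_ /andP[_ +]].
  by rewrite leNgt qh.
Unshelve. all: by end_near. Qed.

(** The points of [K] all of whose cells are reachable from [c] form a relatively open and closed
    subset: nearby points of [K] only touch cells that [p] touches, and the cells at [p] are
    mutually connected. *)
Lemma cells_connected K c c' : connected K -> (forall p, K p -> in_box p) ->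
  c \in cells K -> c' \in cells K -> connect (sub_adj (cells K)) c c'.
Proof.
move=> cK boxK /cellsP[p0 Kp0 tp0] /cellsP[q0 Kq0 tq0].
have tX p : K p -> forall c, touch p c -> c \in cells K.
  by move=> Kp c1 tc; apply/cellsP; exists p.
pose P p := forall c1, touch p c1 -> connect (sub_adj (cells K)) c c1.
have PE p : K p -> \forall q \near p, K q -> (P p <-> P q).
  move=> Kp; apply: nbhsS (touch_near p) => q tqp Kq; split=> [Pp|Pq] c1 t1.
    exact/Pp/tqp.
  have [c2 t2] := touch_ex (boxK q Kq).
  apply: connect_trans (Pq c2 t2) _.
  exact: touch_connect (tX p Kp) (tqp _ t2) t1.
have B : [set p | K p /\ P p] = K.
  apply: cK.
  - exists p0; split=> // c1 t1; exact: touch_connect (tX p0 Kp0) tp0 t1.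
  - exists [set p | K p -> P p]°; first exact: open_interior.
    apply/seteqP; split=> [p [Kp Pp]|p [Kp /interior_subset]]; last by split=> //; auto.
    split=> //; apply: nbhsS (PE p Kp) => q h Kq; exact/(h Kq).
  - exists (~` [set p | K p -> ~ P p]°); first exact/open_closedC/open_interior.
    apply/seteqP; split=> [p [Kp Pp]|p [Kp nP]].
      by split=> // /interior_subset /(_ Kp).
    split=> //; apply: contrapT => nPp; apply: nP.
    by apply: nbhsS (PE p Kp) => q h Kq /(h Kq).
have : [set p | K p /\ P p] q0 by rewrite B.
by case=> _; apply.
Qed.

Lemma touch_dist p q c : touch p c -> touch q c -> `|p - q| <= d.
Proof.
have E x y (a : nat) : a%:R <= scale x <= a.+1%:R -> a%:R <= scale y <= a.+1%:R ->
    `|x - y| <= d.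
  move=> /andP[x1 x2] /andP[y1 y2].
  have -> : x - y = (scale x - scale y) * d.
    by rewrite /scale; field; rewrite gt_eqF.
  rewrite normrM (gtr0_norm d0) -[leRHS]mul1r ler_pM2r // ler_norml.
  by apply/andP; split; lra.
move=> /andP[p1 p2] /andP[q1 q2]; rewrite prod_normE ge_max.
by rewrite (E _ _ _ p1 q1) (E _ _ _ p2 q2).
Qed.

End Cells.

Section Family.
Variable R : realType.
Local Open Scope classical_set_scope.
Local Open Scope ring_scope.
Variables (J : finType) (K : J -> set (R * R)).
Hypothesis cK : forall j, compact (K j).
Hypothesis conK : forall j, connected (K j).

Lemma family_bounded : exists M : R, forall j p, K j p -> `|p| <= M.
Proof.
have : \forall M \near +oo, forall j p, K j p -> `|p| <= M.
  apply: (@filter_forall R J (fun j M => forall p, K j p -> `|p| <= M) +oo _) => j.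
  by have [M0 [_ hM0]] := compact_bounded (@cK j); exists M0; split=> [|M M0M p Kp];
    [exact: num_real|exact: (hM0 M)].
by case/filter_ex => M hM; exists M.
Qed.

Lemma family_separated : exists2 d : R, 0 < d &
  forall i j, K i `&` K j = set0 -> forall p q, K i p -> K j q -> d < `|p - q|.
Proof.
have h : \forall d \near (0:R)^'+, forall ij : J * J, K ij.1 `&` K ij.2 = set0 ->
    forall p q, K ij.1 p -> K ij.2 q -> d < `|p - q|.
  apply: (@filter_forall R (J * J)%type (fun ij d => K ij.1 `&` K ij.2 = set0 ->
    forall p q, K ij.1 p -> K ij.2 q -> d < `|p - q|) (0:R)^'+ _) => -[i j] /=.
  have [KK|nKK] := pselect (K i `&` K j = set0); last by near=> d.
  have [d0 d0_gt0 hd] := compact_separated (@cK i) (@cK j) KK.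
  near=> d => _ p q Kp Kq; apply: lt_le_trans (hd p q Kp Kq).
  by near: d; apply: nbhs_right_lt.
have [d [hd d0]] := filter_ex (filterI h (nbhs_right_gt 0)).
by exists d => // i j KK p q; apply: (hd (i, j)).
Unshelve. all: by end_near. Qed.

(** The mesh is smaller than the distance between any two disjoint members, and two points touching
    a common cell are at distance at most the mesh. Hence covers meet only when the sets do. *)
Lemma cells_family : exists n (X : J -> {set gpoint n}),
  [/\ forall j c, c \in X j -> inside c,
      forall j c c', c \in X j -> c' \in X j -> connect (sub_adj (X j)) c c',
      forall i j p, K i p -> K j p -> exists2 c, c \in X i & c \in X j
    & forall i j c, c \in X i -> c \in X j -> exists2 p, K i p & K j p].
Proof.
have [M hM] := family_bounded; have [d d0 hd] := family_separated.
(* Scaled coordinates range over [[2, 2 * M / d + 2]], which must end before [n - 1]. *)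
pose n := (Num.truncn (2 * M / d + 4)).+1.
have nM : 2 * M / d + 4 < n%:R by apply: truncnS_gt.
have box j p : K j p -> in_box n d M p.
  move=> Kp; have := hM j p Kp; rewrite prod_normE ge_max => /andP[m1 m2].
  have E (x : R) : `|x| <= M -> 2 <= scale d M x <= n%:R - 1.
    rewrite ler_norml => /andP[x1 x2]; rewrite /scale.
    have : 0 <= (x + M) / d by apply: divr_ge0; [lra|apply: ltW].
    have : (x + M) / d <= 2 * M / d by rewrite ler_pM2r ?invr_gt0 //; lra.
    by move=> h1 h2; apply/andP; split; lra.
  by rewrite /in_box !E.
exists n, (fun j => cells n d M (K j)); split.
- move=> j c /cellsP[p Kp tc]; exact: touch_inside (box j p Kp) tc.
- move=> j c c'; apply: cells_connected => //; exact: box.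
- move=> i j p Kip Kjp; have [c tc] := touch_ex (box i p Kip).
  by exists c; apply/cellsP; exists p.
- move=> i j c /cellsP[p Kp tp] /cellsP[q Kq tq].
  have [KK|nKK] := pselect (K i `&` K j = set0).
    have := hd i j KK p q Kp Kq; rewrite ltNge => /negP[].
    exact: (touch_dist d0 tp tq).
  have /set0P[r [Kir Kjr]] : K i `&` K j != set0 by apply/eqP.
  by exists r.
Qed.

End Family.

Section PlanarMinor.
Variable R : realType.
Local Open Scope classical_set_scope.
Local Open Scope ring_scope.
Variables (T : finType) (e : rel T).
Hypotheses (e_sym : symmetric e) (e_irr : irreflexive e).
Variables (pos : T -> R * R) (edge : {set T} -> set (R * R)).
Hypothesis pd : plane_drawing e pos edge.
Local Notation oedge := (oedge e).

Let pos_inj : injective pos. Proof. by case: pd. Qed.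

Lemma param_ex x y : exists g : R -> R * R, e x y ->
  [/\ {within `[0, 1], continuous g}, set_inj `[0, 1] g, g 0 = pos x, g 1 = pos y
    & edge [set x; y]%SET = g @` `[0, 1]].
Proof.
case: pd => _ arc _ _; have [exy|_] := boolP (e x y); last by exists (fun=> 0).
by have [g hg] := arc x y exy; exists g.
Qed.

Definition param x y := projT1 (cid (param_ex x y)).

Lemma paramP x y : e x y -> [/\ {within `[0, 1], continuous (param x y)},
  set_inj `[0, 1] (param x y), param x y 0 = pos x, param x y 1 = pos y
  & edge [set x; y]%SET = param x y @` `[0, 1]].
Proof. by rewrite /param; case: cid. Qed.

Lemma oedge_e x y : oedge x y -> e x y. Proof. by case/andP. Qed.

Lemma oedge_asym x y : oedge x y -> oedge y x = false.
Proof.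
by move=> /andP[_ l]; rewrite /(oedge _ _) /lt_rank ltnNge (ltnW l) andbF.
Qed.

Lemma mem01 (t : R) : 0 <= t <= 1 -> t \in `[0, 1]%classic.
Proof. by move=> t01; rewrite inE /= in_itv. Qed.

(** [param x y] and [param y x] are chosen separately and need not be reverses of each other;
    restricting to [oedge] fixes one parametrization per arc. *)
Definition on_arc x y (t : R) (p : R * R) : Prop :=
  [/\ oedge x y, 0 <= t <= 1 & p = param x y t].

Lemma on_arc_edge x y t p : on_arc x y t p -> edge [set x; y]%SET p.
Proof.
move=> [exy t01 ->]; have [_ _ _ _ ->] := paramP (oedge_e exy).
by exists t => //=; rewrite in_itv.
Qed.

Lemma on_arc_pos x y t z : on_arc x y t (pos z) -> (t = 0 /\ z = x) \/ (t = 1 /\ z = y).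
Proof.
move=> h; have E := on_arc_edge h; case: h => exy t01 zE.
have [_ inj g0 g1 _] := paramP (oedge_e exy).
case: pd => _ _ /(_ x y z (oedge_e exy) E) [] zxy _; [left|right]; split=> //.
  by apply: inj; rewrite ?mem01 ?lexx ?ler01 // g0 -zE zxy.
by apply: inj; rewrite ?mem01 ?lexx ?ler01 // g1 -zE zxy.
Qed.

(** Distinct arcs meet only at vertices, and on a single arc the orientation and injectivity
    determine the parameter. *)
Lemma on_arc_inj x y t x' y' t' p : on_arc x y t p -> on_arc x' y' t' p ->
  [/\ x = x', y = y' & t = t'] \/ exists z, p = pos z.
Proof.
move=> h h'; have [exy t01 pE] := h; have [exy' t01' pE'] := h'.
have [Es|Ns] := eqVneq [set x; y]%SET [set x'; y']%SET; last first.
  right; case: pd => _ _ _ /(_ x y x' y' (oedge_e exy) (oedge_e exy')).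
  move/eqP: Ns => Ns /(_ Ns p) [|z _ <-]; last by exists z.
  by split; [apply: on_arc_edge h|apply: on_arc_edge h'].
have irr a b : oedge a b -> a != b.
  by move=> /oedge_e; apply: contraTneq => ->; rewrite e_irr.
have xx : x = x'.
  have : x \in [set x'; y']%SET by rewrite -Es !inE eqxx.
  rewrite !inE => /orP[/eqP//|/eqP xy'].
  have : x' \in [set x; y]%SET by rewrite Es !inE eqxx.
  rewrite !inE => /orP[/eqP//|/eqP x'y].
  by move: exy'; rewrite x'y -xy' oedge_asym.
have yy : y = y'.
  have : y \in [set x'; y']%SET by rewrite -Es !inE eqxx orbT.
  by rewrite !inE -xx eq_sym (negPf (irr _ _ exy)) => /eqP.
left; split=> //; rewrite -xx -yy in pE'.
have [_ inj _ _ _] := paramP (oedge_e exy).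
by apply: inj; rewrite ?mem01 // -pE -pE'.
Qed.

Lemma third_bounds : [/\ 0 <= 3^-1 :> R, 3^-1 < 2 / 3 :> R & 2 / 3 <= 1 :> R].
Proof. by split; lra. Qed.

(** The closed third of the arc next to [v]. The default [[set pos v]] makes every part contain
    [pos v], so stars are connected, and nonempty even at isolated vertices. Closed thirds share
    their ends with [middle], so each middle meets both stars. *)
Definition part v y : set (R * R) :=
  if oedge v y then param v y @` `[0, 3^-1]
  else if oedge y v then param y v @` `[2 / 3, 1] else [set pos v].

Definition star v : set (R * R) := \bigcup_(y in [set: T]) part v y.

Definition middle x y : set (R * R) :=
  if oedge x y then param x y @` `[3^-1, 2 / 3] else [set pos x].

Lemma image_param x y (a b : R) : oedge x y -> 0 <= a -> b <= 1 ->
  compact (param x y @` `[a, b]) /\ connected (param x y @` `[a, b]).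
Proof.
move=> exy a0 b1; have [cg _ _ _ _] := paramP (oedge_e exy).
have sub : `[a, b] `<=` `[0, 1].
  move=> t /=; rewrite !in_itv /= => /andP[at_ tb].
  by rewrite (le_trans a0 at_) (le_trans tb b1).
have cg' := continuous_subspaceW sub cg; split.
  by apply: continuous_compact => //; apply: segment_compact.
by apply: connected_continuous_connected => //; apply: segment_connected.
Qed.

Lemma part_compact_connected v y : compact (part v y) /\ connected (part v y).
Proof.
have [h1 h2 h3] := third_bounds.
rewrite /part; case: ifP => [evy|_]; first by apply: image_param => //; lra.
case: ifP => [eyv|_]; first by apply: image_param => //; lra.
by split; [exact: compact_set1|exact: connected1].
Qed.

Lemma middle_compact_connected x y : compact (middle x y) /\ connected (middle x y).
Proof.
have [h1 h2 h3] := third_bounds.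
rewrite /middle; case: ifP => [exy|_]; first by apply: image_param => //; lra.
by split; [exact: compact_set1|exact: connected1].
Qed.

Lemma part_pos v y : part v y (pos v).
Proof.
have [h1 h2 h3] := third_bounds.
rewrite /part; case: ifP => [evy|_].
  have [_ _ g0 _ _] := paramP (oedge_e evy).
  by exists 0 => //=; rewrite in_itv /= lexx.
case: ifP => [eyv|//]; have [_ _ _ g1 _] := paramP (oedge_e eyv).
by exists 1 => //=; rewrite in_itv /= lexx andbT.
Qed.

Lemma star_compact_connected v : compact (star v) /\ connected (star v).
Proof.
split; last first.
  apply: bigcup_connected => [|y _]; last by have [] := part_compact_connected v y.
  by exists (pos v) => y _; apply: part_pos.
have -> : star v = \big[setU/set0]_(y <- index_enum T) part v y.
  rewrite -bigcup_seq; apply/seteqP; split=> p [y _ py]; exists y => //.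
  by rewrite /= mem_index_enum.
by apply: bigsetU_compact => y _; have [] := part_compact_connected v y.
Qed.

Lemma starP v p : star v p -> p = pos v \/ exists x y t,
  on_arc x y t p /\ ((x = v /\ t <= 3^-1) \/ (y = v /\ 2 / 3 <= t)).
Proof.
have [h1 h2 h3] := third_bounds.
move=> [y _]; rewrite /part; case: ifP => [evy [t /=]|_].
  rewrite in_itv /= => /andP[t0 t1] <-; right; exists v, y, t; split; last by left.
  by split=> //; apply/andP; split; lra.
case: ifP => [eyv [t /=]|_ ->]; last by left.
rewrite in_itv /= => /andP[t0 t1] <-; right; exists y, v, t; split; last by right.
by split=> //; apply/andP; split; lra.
Qed.

Lemma middleP x y p : oedge x y -> middle x y p ->
  exists2 t, on_arc x y t p & 3^-1 <= t <= 2 / 3.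
Proof.
have [h1 h2 h3] := third_bounds.
move=> exy; rewrite /middle exy => -[t /=]; rewrite in_itv /= => /andP[t0 t1] <-.
by exists t; [split=> //; apply/andP; split; lra|rewrite t0].
Qed.

Lemma star_disj u v p : star u p -> star v p -> u = v.
Proof.
have [h1 h2 h3] := third_bounds.
have posE a b : star a (pos b) -> a = b.
  move=> /starP[/pos_inj //|[x [y [t [h]]]]].
  by case: (on_arc_pos h) => -[-> ->] [] [// _] h4; exfalso; lra.
move=> hu hv; have [pu|[x [y [t [h c]]]]] := starP hu.
  by apply/esym/posE; rewrite -pu.
have [pv|[x' [y' [t' [h' c']]]]] := starP hv; first by apply: posE; rewrite -pv.
case: (on_arc_inj h h') => [[xx yy tt]|[z pz]]; last first.
  by rewrite pz in hu hv; rewrite (posE _ _ hu) (posE _ _ hv).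
case: c c' => -[<- c] [] [<- c'] //; exfalso; move: c c'; rewrite tt; lra.
Qed.

Lemma middle_star x y v p : oedge x y -> middle x y p -> star v p -> v = x \/ v = y.
Proof.
have [h1 h2 h3] := third_bounds.
move=> exy /(middleP exy)[t h tb] /starP[pv|[x' [y' [t' [h' c']]]]].
  by rewrite pv in h; case: (on_arc_pos h) => -[_ ->]; [left|right].
case: (on_arc_inj h h') => [[xx yy tt]|[z pz]].
  by case: c' => -[<- _]; [left|right].
by rewrite pz in h; case: (on_arc_pos h) => -[t0 _]; exfalso; move: tb; rewrite t0; lra.
Qed.

Lemma middle_disj x y x' y' p : oedge x y -> oedge x' y' -> middle x y p ->
  middle x' y' p -> x = x' /\ y = y'.
Proof.
have [h1 h2 h3] := third_bounds.
move=> exy exy' /(middleP exy)[t h tb] /(middleP exy')[t' h' tb'].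
case: (on_arc_inj h h') => [[-> -> _]//|[z pz]].
by rewrite pz in h; case: (on_arc_pos h) => -[t0 _]; exfalso; move: tb; rewrite t0; lra.
Qed.

Lemma middle_meets x y : oedge x y ->
  (exists2 p, middle x y p & star x p) /\ (exists2 p, middle x y p & star y p).
Proof.
have [h1 h2 h3] := third_bounds; move=> exy; split.
  exists (param x y 3^-1); rewrite /middle ?exy.
    by exists 3^-1 => //=; rewrite in_itv /= lexx ltW.
  exists y => //; rewrite /part exy; exists 3^-1 => //=.
  by rewrite in_itv /= lexx h1.
exists (param x y (2 / 3)); rewrite /middle ?exy.
  by exists (2 / 3) => //=; rewrite in_itv /= lexx ltW.
exists x => //; rewrite /part exy (oedge_asym exy); exists (2 / 3) => //=.
by rewrite in_itv /= lexx.
Qed.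

Theorem plane_drawing_minor : exists n A base port, @grid_minor T e n A base port.
Proof.
pose K (j : T + T * T) := match j with inl v => star v | inr p => middle p.1 p.2 end.
have cK j : compact (K j).
  by case: j => [v|[x y]]; [have [] := star_compact_connected v
    |have [] := middle_compact_connected x y].
have conK j : connected (K j).
  by case: j => [v|[x y]]; [have [] := star_compact_connected v
    |have [] := middle_compact_connected x y].
have [n [X [Xint Xconn Xmeet Xdisj]]] := cells_family cK conK.
pose St v := X (inl v); pose Mid x y := X (inr (x, y)).
have gd : grid_drawing e St Mid.
  split.
  - by move=> v; apply: Xint.
  - by move=> x y p _; apply: Xint.
  - by move=> v; apply: Xconn.
  - by move=> x y p q _; apply: Xconn.
  - move=> v; have sp : K (inl v) (pos v) by exists v => //; apply: part_pos.
    by have [c cX _] := Xmeet _ _ _ sp sp; exists c.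
  - move=> x y exy; have [[p mp sp] [q mq sq]] := middle_meets exy; split.
      exact: (Xmeet (inr (x, y)) (inl x) p).
    exact: (Xmeet (inr (x, y)) (inl y) q).
  - move=> u v c cu cv; have [p pu pv] := Xdisj _ _ _ cu cv.
    exact: star_disj pu pv.
  - move=> x y v c exy cm cv; have [p pm pv] := Xdisj _ _ _ cm cv.
    exact: middle_star exy pm pv.
  - move=> x y x' y' c exy exy' cm cm'; have [p pm pm'] := Xdisj _ _ _ cm cm'.
    exact: middle_disj exy exy' pm pm'.
have [base gm] := drawing_minor e_sym e_irr gd.
by exists n, (branch gd), base, (port e_irr gd).
Qed.

End PlanarMinor.

(** * Euler's bound for plane drawings and the three girth conditions *)

Lemma planar_euler (R : realType) (T : finType) (e : rel T) (g : nat) (W : {set T}) :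
    symmetric e -> irreflexive e -> planar R e -> girth_geq e g ->
  g * nedges e W <= 2 * nedges e W + g * #|W|.
Proof.
move=> e_sym e_irr [pos [edge pd]] girth.
have [n [A [base [port gm]]]] := plane_drawing_minor e_sym e_irr pd.
exact: (euler_bound e_sym e_irr (grid_minor_faces e_sym e_irr W gm) girth).
Qed.

Theorem mainTheorem4 (R : realType) (T : finType) (e : rel T)
    (e_sym : symmetric e) (e_irr : irreflexive e)
    (e_planar : planar R e) :
  (girth_geq e 9 -> exists I F : {set T}, IF_partition e 3 I F) /\
  (girth_geq e 8 -> exists I F : {set T}, IF_partition e 4 I F) /\
  (girth_geq e 7 -> exists I F : {set T}, IF_partition e 6 I F).
Proof.
have main k g E I u theta : k < g -> girth_geq e g ->
    (forall W m w, (forall x, 0 < w x) -> sparse e E I u theta w m W ->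
      colorable e k W w m) ->
    (* With [a] edges and [b] vertices, this says that Euler's bound puts the unweighted potential
       at or above [theta]; it is the only arithmetic that depends on the three sets of
       constants. *)
    (forall a b, g * a <= 2 * a + g * b -> (theta <= (b * u 1)%:Z - (E * a)%:Z)%R) ->
    exists I F : {set T}, IF_partition e k I F.
  move=> kg girth col h; apply: (coloring_IF_partition e_sym kg girth).
  apply: col => // W _ _; rewrite pot_unweighted; apply: h.
  exact: planar_euler e_planar girth.
split; [|split] => girth.
- apply: (main 3 9 7 2 u3 (-2)%R) => // [W m w|a b].
    exact: colorable3.
  by rewrite /u3 /=; clear; lia.
- apply: (main 4 8 9 4 u4 0%R) => // [W m w|a b].
    exact: colorable4.
  by rewrite /u4 /=; clear; lia.
- apply: (main 6 7 5 2 u6 0%R) => // [W m w|a b].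
    exact: colorable6.
  by rewrite /u6 /=; clear; lia.
Qed.
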